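(* The following collections are full categories of partitions, generated as indicated, and they correspond, for every $n\in\mathbb N$, to the indicated quantum groups (i.e. $C_G(k,l)=\mathrm{span}\{T_p:p\in P_X(k,l)\}$ for all $k,l\in\mathbb N_0$, where $G$ is the quantum group and $P_X$ the category), which hence are easy quantum groups: (1) $\langle p_{\rm hl}\rangle$ is the category of all pair partitions (all blocks of size two), each pair connecting one $\oplus$ with one $\ominus$. It corresponds to $O_n^*$. (2) $\langle p_{\rm hl},\ p_{\rm four}\rangle$ is the category of all partitions with blocks of even size, each block consisting half of points labelled by $\oplus$ and half of points labelled by $\ominus$. It corresponds to $H_n^*$. (3) $\langle p_{\rm hl},\ \uparrow\otimes\uparrow\rangle$ is the category of all partitions consisting of an arbitrary number of blocks of size two, each connecting one $\oplus$ with one $\ominus$, and an even number of blocks of size one. It corresponds to $B_n^{\#*}$.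
   Context: For $k,l\in\mathbb N_0$, $P(k,l)$ is the set of all (possibly crossing) set partitions of $k$ upper points $1,\dots,k$ and $l$ lower points $1',\dots,l'$ (numbered left to right; for $k=0$ primes are omitted), drawn by connecting points of the same block by lines between two horizontal rows. A full category of partitions $P_X$ is a collection of subsets $P_X(k,l)\subseteq P(k,l)$, $k,l\in\mathbb N_0$, closed under: tensor product (horizontal concatenation); composition ($p\in P(k,l)$, $q\in P(l,m)$ give $pq\in P(k,m)$ by vertical concatenation, then removing the middle points and any components not connected to upper or lower points); involution (turning upside down); rotation (moving an outermost upper point to the same end of the lower row, or conversely, keeping connections); and containing the unit partition $|\in P(1,1)$ and the pair partition $\sqcap\in P(0,2)$. $\langle p_1,\dots,p_m\rangle$ is the smallest full category of partitions containing $p_1,\dots,p_m$. Special partitions: $\uparrow\otimes\uparrow\in P(0,2)$ consists of two singletons; $p_{\rm four}\in P(0,4)$ is the four block $\{1,2,3,4\}$; $p_{\rm hl}\in P(3,3)$ is the half-liberating partition $\{1,3'\},\{2,2'\},\{3,1'\}$. Labelling by $\oplus,\ominus$: the points of $p\in P(k,l)$ are labelled alternately $\oplus,\ominus,\oplus,\dots$, starting with $\oplus$ at the rightmost upper point, proceeding from right to left along the upper row and then from left to right along the lower row. For $p\in P(k,l)$, $T_p:(\mathbb C^n)^{\otimes k}\to(\mathbb C^n)^{\otimes l}$ is $T_p(e_{i_1}\otimes\cdots\otimes e_{i_k})=\sum_{j_1,\dots,j_l=1}^n\delta_p(i,j)\,e_{j_1}\otimes\cdots\otimes e_{j_l}$,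 where $\delta_p(i,j)=1$ if points in the same block carry equal indices (indices $i$ on upper, $j$ on lower points), and $0$ otherwise. For an orthogonal quantum group $G$ (given by a C*-algebra $A_G$ with generating orthogonal $n\times n$ matrix $u=(u_{ij})$ of self-adjoint elements, comultiplication $\Delta(u_{ij})=\sum_k u_{ik}\otimes u_{kj}$, counit $u_{ij}\mapsto\delta_{ij}$ and antipode $u_{ij}\mapsto u_{ji}$), $C_G(k,l)=\{T:(\mathbb C^n)^{\otimes k}\to(\mathbb C^n)^{\otimes l}\text{ linear}: Tu^{\otimes k}=u^{\otimes l}T\}$. A compact quantum group $S_n\subseteq G\subseteq O_n^+$ is easy if its intertwiner spaces are spanned by the $T_p$, $p\in P_X(k,l)$, for some collection $P_X$ of partitions containing all noncrossing pair partitions. $A_{O_n^+}$, $A_{H_n^+}$, $A_{B_n^{\#+}}$ are the universal unital C*-algebras generated by self-adjoint $u_{ij}$, $1\le i,j\le n$, subject to, respectively: the orthogonality relations $\sum_k u_{ik}u_{jk}=\sum_k u_{ki}u_{kj}=\delta_{ij}$; orthogonality and $u_{ik}u_{jk}=u_{ki}u_{kj}=0$ whenever $i\neq j$; orthogonality and $\sum_k u_{ik}=\sum_k u_{kj}$ for all $i,j$. The quantum groups $O_n^*$, $H_n^*$, $B_n^{\#*}$ are given by the quotients of $A_{O_n^+}$, $A_{H_n^+}$, $A_{B_n^{\#+}}$, respectively, by the relations $u_{ij}u_{kl}u_{pq}=u_{pq}u_{kl}u_{ij}$ for all $i,j,k,l,p,q$. *)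

(* Defs.v *)
From HB Require Import structures.
From mathcomp Require Import all_boot all_order all_algebra all_fingroup.
From mathcomp Require Import all_classical all_reals.
From mathcomp Require Import complex.
Set Implicit Arguments.
Unset Strict Implicit.
Unset Printing Implicit Defensive.
Import Order.TTheory GRing.Theory Num.Theory.

(* [inl i] is the i-th upper point and [inr j] the j-th lower point, both
   counted from the left, starting at 0. *)
Definition diagram (k l : nat) := {set {set 'I_k + 'I_l}}.

Definition partitions k l : {set diagram k l} :=
  [set p | finset.partition p [set: 'I_k + 'I_l]].

Definition collection := forall k l, {set diagram k l}.

Definition relabel (S T : finType) (f : S -> T) (p : {set {set S}}) :
  {set {set T}} := [set [set f x | x in b] | b : {set S} in p].

Definition tensor_left k l k' l' (x : 'I_k + 'I_l) :
    'I_(k + k') + 'I_(l + l') :=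
  match x with inl i => inl (lshift k' i) | inr j => inr (lshift l' j) end.

Definition tensor_right k l k' l' (x : 'I_k' + 'I_l') :
    'I_(k + k') + 'I_(l + l') :=
  match x with inl i => inl (rshift k i) | inr j => inr (rshift l j) end.

Definition tensor k l k' l' (p : diagram k l) (q : diagram k' l') :
    diagram (k + k') (l + l') :=
  relabel (@tensor_left k l k' l') p :|: relabel (@tensor_right k l k' l') q.

Definition involution k l (p : diagram k l) : diagram l k :=
  relabel (fun x => match x with inl i => inr i | inr j => inl j end) p.

(* Rotations: the upper point [a] becomes the lower point [b], and conversely;
   the order of the remaining points is kept. *)
Definition rot_down k l (a : 'I_k.+1) (b : 'I_l.+1) (p : diagram k.+1 l) :
    diagram k l.+1 :=
  relabel (fun x => match x with
                    | inl i => if unlift a i is Some i' then inl i' else inr b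
                    | inr j => inr (lift b j)
                    end) p.

Definition rot_up k l (a : 'I_k.+1) (b : 'I_l.+1) (p : diagram k l.+1) :
    diagram k.+1 l :=
  relabel (fun x => match x with
                    | inl i => inl (lift a i)
                    | inr j => if unlift b j is Some j' then inr j' else inl a
                    end) p.

Section Composition.
Variables (k l m : nat).

Definition glue_top (x : 'I_k + 'I_l) : 'I_k + 'I_l + 'I_m := inl x.

Definition glue_bot (x : 'I_l + 'I_m) : 'I_k + 'I_l + 'I_m :=
  match x with inl i => inl (inr i) | inr j => inr j end.

Definition glue_outer (x : 'I_k + 'I_m) : 'I_k + 'I_l + 'I_m :=
  match x with inl i => inl (inl i) | inr j => inr j end.

Definition glued (p : diagram k l) (q : diagram l m) :
    rel ('I_k + 'I_l + 'I_m) :=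
  fun x y =>
    [exists b in p, (x \in glue_top @: b) && (y \in glue_top @: b)] ||
    [exists b in q, (x \in glue_bot @: b) && (y \in glue_bot @: b)].

Definition compose (p : diagram k l) (q : diagram l m) : diagram k m :=
  equivalence_partition
    (fun x y => connect (glued p q) (glue_outer x) (glue_outer y))
    [set: 'I_k + 'I_m].

End Composition.

Definition p_unit : diagram 1 1 := [set [set: 'I_1 + 'I_1]].
Definition p_pair : diagram 0 2 := [set [set: 'I_0 + 'I_2]].
Definition p_four : diagram 0 4 := [set [set: 'I_0 + 'I_4]].
Definition p_upup : diagram 0 2 := [set [set x] | x : 'I_0 + 'I_2].
Definition p_hl : diagram 3 3 :=
  [set [set inl i; inr (rev_ord i)] | i : 'I_3].

Record full_category (X : collection) : Prop := FullCategory {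
  cat_sub : forall k l, X k l \subset partitions k l;
  cat_tensor : forall k l k' l' (p : diagram k l) (q : diagram k' l'),
    p \in X k l -> q \in X k' l' -> tensor p q \in X (k + k')%N (l + l')%N;
  cat_compose : forall k l m (p : diagram k l) (q : diagram l m),
    p \in X k l -> q \in X l m -> compose p q \in X k m;
  cat_involution : forall k l (p : diagram k l),
    p \in X k l -> involution p \in X l k;
  cat_rot_down_left : forall k l (p : diagram k.+1 l),
    p \in X k.+1 l -> rot_down ord0 ord0 p \in X k l.+1;
  cat_rot_down_right : forall k l (p : diagram k.+1 l),
    p \in X k.+1 l -> rot_down ord_max ord_max p \in X k l.+1;
  cat_rot_up_left : forall k l (p : diagram k l.+1),
    p \in X k l.+1 -> rot_up ord0 ord0 p \in X k.+1 l;
  cat_rot_up_right : forall k l (p : diagram k l.+1),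
    p \in X k l.+1 -> rot_up ord_max ord_max p \in X k.+1 l;
  cat_unit : p_unit \in X 1 1;
  cat_pair : p_pair \in X 0 2
}.

Record sized_diagram :=
  Sized { sd_upper : nat; sd_lower : nat; sd_blocks : diagram sd_upper sd_lower }.

Definition contains (X : collection) (g : sized_diagram) : bool :=
  sd_blocks g \in X (sd_upper g) (sd_lower g).

Definition generated_category (gs : seq sized_diagram) : collection := fun k l =>
  [set p | `[< forall X : collection,
                 full_category X -> all (contains X) gs -> p \in X k l >]].

(* Position in the cyclic order starting at the rightmost upper point, running
   from right to left along the upper row and then from left to right along the
   lower row. *)
Definition position k l (x : 'I_k + 'I_l) : nat :=
  match x with inl i => rev_ord i | inr j => k + j end.

Definition oplus k l : {set 'I_k + 'I_l} := [set x | ~~ odd (position x)].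
Definition ominus k l : {set 'I_k + 'I_l} := [set x | odd (position x)].

Definition one_oplus_one_ominus k l (b : {set 'I_k + 'I_l}) : bool :=
  (#|b| == 2) && (#|b :&: oplus k l| == 1) && (#|b :&: ominus k l| == 1).

Definition cat_Ostar : collection := fun k l =>
  [set p in partitions k l | [forall b in p, one_oplus_one_ominus b]].

Definition cat_Hstar : collection := fun k l =>
  [set p in partitions k l |
    [forall b in p, ~~ odd #|b| && (#|b :&: oplus k l| == #|b :&: ominus k l|)]].

Definition cat_Bstar : collection := fun k l =>
  [set p in partitions k l |
    [forall b in p, one_oplus_one_ominus b || (#|b| == 1)] &&
    ~~ odd #|[set b in p | #|b| == 1]|].

Definition noncrossing k l (p : diagram k l) : Prop :=
  forall b c, b \in p -> c \in p -> forall x y x' y',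
    x \in b -> x' \in b -> y \in c -> y' \in c ->
    (position x < position y < position x')%N ->
    (position x' < position y')%N -> b = c.

Definition noncrossing_pair_partition k l (p : diagram k l) : Prop :=
  [/\ p \in partitions k l, forall b, b \in p -> #|b| = 2 & noncrossing p].

Local Open Scope ring_scope.

(* The norm takes its values in [R] and is not that of [normedModType]: the
   hierarchy has no common superclass of rings and normed modules below
   [numDomainType], so [algType] and [completeNormedModType] cannot be joined. *)
HB.mixin Record isCStarAlgebra (R : realType) A & GRing.Algebra R[i] A := {
  star : A -> A;
  starD : forall x y, star (x + y) = star x + star y;
  starZ : forall (a : R[i]) x, star (a *: x) = Num.conj a *: star x;
  starM : forall x y, star (x * y) = star y * star x;
  starK : involutive star;
  cnorm : A -> R;
  cnorm_eq0 : forall x, cnorm x = 0 -> x = 0;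
  cnormD : forall x y, cnorm (x + y) <= cnorm x + cnorm y;
  cnormZ : forall (a : R[i]) x, cnorm (a *: x) = complex.Re `|a| * cnorm x;
  cnormM : forall x y, cnorm (x * y) <= cnorm x * cnorm y;
  cnorm_star : forall x, cnorm (star x * x) = cnorm x ^+ 2;
  cnorm_complete : forall w : nat -> A,
    (forall e, 0 < e -> exists N, forall p q, (N <= p)%N -> (N <= q)%N ->
       cnorm (w p - w q) < e) ->
    exists x, forall e, 0 < e -> exists N, forall p, (N <= p)%N ->
       cnorm (w p - x) < e
}.

#[short(type="cstarAlgType")]
HB.structure Definition CStarAlgebra (R : realType) :=
  {A of GRing.Algebra R[i] A & isCStarAlgebra R A}.

Section CStar.
Variable R : realType.
Implicit Types A B T : cstarAlgType R.

Definition star_preserving A B (f : A -> B) : Prop :=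
  forall x, f (star x) = star (f x).

Definition star_character A (f : A -> R[i]^o) : Prop :=
  forall x, f (star x) = Num.conj (f x : R[i]).

Definition norm_closure A (S : set A) : set A :=
  [set x | forall e : R, 0 < e -> exists2 y, S y & cnorm (x - y) < e].

Definition norm_closed A (S : set A) : Prop := (norm_closure S `<=` S)%classic.

Record closed_star_subalgebra A (S : set A) : Prop := ClosedStarSubalgebra {
  csa_closed : norm_closed S;
  csa_one : S 1;
  csa_lin : forall (a : R[i]) x y, S x -> S y -> S (a *: x + y);
  csa_mul : forall x y, S x -> S y -> S (x * y);
  csa_star : forall x, S x -> S (star x)
}.

Definition generates A n (u : 'M[A]_n) : Prop :=
  forall S : set A, closed_star_subalgebra S -> (forall i j, S (u i j)) ->
  S = setT.

Record closed_ideal A (I : set A) : Prop := ClosedIdeal {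
  ci_closed : norm_closed I;
  ci_zero : I 0;
  ci_add : forall x y, I x -> I y -> I (x + y);
  ci_mull : forall a x, I x -> I (a * x);
  ci_mulr : forall a x, I x -> I (x * a)
}.

Definition generated_ideal A (rels : set A) : set A :=
  [set x | forall I : set A, closed_ideal I -> (rels `<=` I)%classic -> I x].

(* [A] is the quotient of [A0] by the relations [r = 0], [rels r]. *)
Definition is_quotient A0 A (pi : {lrmorphism A0 -> A}) (rels : set A0) :
    Prop :=
  [/\ star_preserving pi, forall y, exists x, pi x = y
    & forall x, pi x = 0 <-> generated_ideal rels x].

Definition relation_family n := forall A, 'M[A]_n -> Prop.

Definition universal n (rel : relation_family n) A (u : 'M[A]_n) : Prop :=
  [/\ rel A u, generates u &
   forall B (v : 'M[B]_n), rel B v ->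
     exists f : {lrmorphism A -> B},
       star_preserving f /\ forall i j, f (u i j) = v i j].

Definition rel_O n : relation_family n := fun A u =>
  [/\ forall i j, star (u i j) = u i j,
      forall i j, \sum_k u i k * u j k = (i == j)%:R
    & forall i j, \sum_k u k i * u k j = (i == j)%:R].

Definition rel_H n : relation_family n := fun A u =>
  rel_O u /\
  forall i j k, i != j -> u i k * u j k = 0 /\ u k i * u k j = 0.

Definition rel_Bsharp n : relation_family n := fun A u =>
  rel_O u /\ forall i j, \sum_k u i k = \sum_k u k j.

Definition half_commutators A n (u : 'M[A]_n) : set A :=
  [set x | exists i j k l p q,
     x = u i j * u k l * u p q - u p q * u k l * u i j].

Definition half_liberated n (rel : relation_family n) A (u : 'M[A]_n) : Prop :=
  exists (A0 : cstarAlgType R) (u0 : 'M[A0]_n) (pi : {lrmorphism A0 -> A}),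
    [/\ universal rel u0, is_quotient pi (half_commutators u0)
      & forall i j, u i j = pi (u0 i j)].

Definition is_Ostar n A (u : 'M[A]_n) := half_liberated (@rel_O n) u.
Definition is_Hstar n A (u : 'M[A]_n) := half_liberated (@rel_H n) u.
Definition is_Bsharpstar n A (u : 'M[A]_n) := half_liberated (@rel_Bsharp n) u.

(* [T] is a completion of the algebraic tensor product of [A] and [B] with
   respect to some C*-norm; [i1 a * i2 b] is the elementary tensor of [a] and
   [b], and [cst_inj] says that the algebraic tensor product embeds. *)
Record cstar_tensor A B T
    (i1 : {lrmorphism A -> T}) (i2 : {lrmorphism B -> T}) : Prop :=
  CStarTensor {
    cst_star1 : star_preserving i1;
    cst_star2 : star_preserving i2;
    cst_comm : forall a b, i1 a * i2 b = i2 b * i1 a;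
    cst_inj : forall m (a : 'I_m -> A) (b : 'I_m -> B),
      (forall c : 'I_m -> R[i], \sum_r c r *: a r = 0 -> forall r, c r = 0) ->
      \sum_r i1 (a r) * i2 (b r) = 0 -> forall r, b r = 0;
    cst_dense : norm_closure [set t | exists m (a : 'I_m -> A) (b : 'I_m -> B),
      t = \sum_r i1 (a r) * i2 (b r)]%classic = setT
  }.

(* The minimal tensor product carries the smallest C*-norm: it is a quotient
   of every other C*-completion. *)
Definition min_tensor A B T
    (i1 : {lrmorphism A -> T}) (i2 : {lrmorphism B -> T}) : Prop :=
  cstar_tensor i1 i2 /\
  forall (T' : cstarAlgType R)
      (j1 : {lrmorphism A -> T'}) (j2 : {lrmorphism B -> T'}),
    cstar_tensor j1 j2 ->
    exists f : {lrmorphism T' -> T},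
      [/\ star_preserving f, forall a, f (j1 a) = i1 a
        & forall b, f (j2 b) = i2 b].

Definition has_comultiplication A n (u : 'M[A]_n) : Prop :=
  forall T (i1 i2 : {lrmorphism A -> T}), min_tensor i1 i2 ->
  exists Delta : {lrmorphism A -> T}, star_preserving Delta /\
    forall i j, Delta (u i j) = \sum_k i1 (u i k) * i2 (u k j).

Definition has_counit A n (u : 'M[A]_n) : Prop :=
  exists epsilon : {lrmorphism A -> R[i]^o},
    star_character epsilon /\ forall i j, epsilon (u i j) = (i == j)%:R.

(* The antipode is a unital *-homomorphism to the opposite algebra. *)
Definition has_antipode A n (u : 'M[A]_n) : Prop :=
  exists S : {linear A -> A},
    [/\ S 1 = 1, forall x y, S (x * y) = S y * S x, star_preserving S
      & forall i j, S (u i j) = u j i].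

Record orthogonal_quantum_group A n (u : 'M[A]_n) : Prop :=
  OrthogonalQuantumGroup {
    oqg_orthogonal : rel_O u;
    oqg_generates : generates u;
    oqg_comultiplication : has_comultiplication u;
    oqg_counit : has_counit u;
    oqg_antipode : has_antipode u
  }.

(* A surjective *-homomorphism from [A] onto C(S_n), the algebra of functions
   on S_n with pointwise operations, mapping [u i j] to the coordinate function
   s |-> (i == s j); it is given by its evaluations [chi s]. *)
Definition contains_Sn A n (u : 'M[A]_n) : Prop :=
  exists chi : 'S_n -> {lrmorphism A -> R[i]^o},
    [/\ forall s, star_character (chi s),
        forall s i j, chi s (u i j) = (i == s j)%:R
      & forall g : 'S_n -> R[i], exists x, forall s, chi s x = g s].

(* The k-th tensor power of C^n, as coordinate functions on multi-indices. *)
Definition tpow (n k : nat) := {ffun k.-tuple 'I_n -> R[i]^o}.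

Definition tbasis n k (i : k.-tuple 'I_n) : tpow n k :=
  [ffun i' => (i' == i)%:R].

Definition matpow A n (u : 'M[A]_n) k (i i' : k.-tuple 'I_n) : A :=
  \prod_(r < k) u (tnth i r) (tnth i' r).

(* The (j, i) entry of the matrix identity T u^{(x)k} = u^{(x)l} T, where the
   (j, i) entry of T is the j-th coordinate of T e_i. *)
Definition intertwiner A n (u : 'M[A]_n) k l (T : 'Hom(tpow n k, tpow n l)) :
    Prop :=
  forall (i : k.-tuple 'I_n) (j : l.-tuple 'I_n),
    \sum_(i' : k.-tuple 'I_n) (T (tbasis i') j : R[i]) *: matpow u i' i =
    \sum_(j' : l.-tuple 'I_n) (T (tbasis i) j' : R[i]) *: matpow u j j'.

Definition point_index n k l (i : k.-tuple 'I_n) (j : l.-tuple 'I_n)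
    (x : 'I_k + 'I_l) : 'I_n :=
  match x with inl r => tnth i r | inr s => tnth j s end.

Definition delta_p n k l (p : diagram k l)
    (i : k.-tuple 'I_n) (j : l.-tuple 'I_n) : bool :=
  [forall b in p, forall x in b, forall y in b, point_index i j x == point_index i j y].

Definition partition_fun n k l (p : diagram k l) (v : tpow n k) : tpow n l :=
  \sum_(i : k.-tuple 'I_n) (v i : R[i]) *: \sum_(j | delta_p p i j) tbasis j.

Lemma partition_fun_is_linear n k l (p : diagram k l) :
  linear (@partition_fun n k l p).
Proof.
move=> a v w; rewrite /partition_fun scaler_sumr -big_split /=.
by apply: eq_bigr => i _; rewrite !ffunE scalerDl scalerA.
Qed.

HB.instance Definition _ n k l (p : diagram k l) :=
  GRing.isLinear.Build R[i] (tpow n k) (tpow n l) _ (@partition_fun n k l p)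
    (partition_fun_is_linear p).

Definition partition_map n k l (p : diagram k l) :
    'Hom(tpow n k, tpow n l) := linfun (@partition_fun n k l p).

Lemma partition_map_basis n k l (p : diagram k l) (i : k.-tuple 'I_n) :
  partition_map n p (tbasis i) = \sum_(j | delta_p p i j) tbasis j.
Proof.
rewrite lfunE /= /partition_fun (bigD1 i) //=.
have -> : \sum_(i' | i' != i) ((tbasis i) i' : R[i]) *:
    \sum_(j | delta_p p i' j) tbasis j = 0 :> tpow n l.
  by apply: big1 => i' /negPf ne; rewrite ffunE ne; exact: scale0r.
rewrite addr0 ffunE eqxx; exact: scale1r.
Qed.

Definition corresponds (X : collection) A n (u : 'M[A]_n) : Prop :=
  forall k l (T : 'Hom(tpow n k, tpow n l)),
    intertwiner u T <-> T \in <<[seq partition_map n p | p in X k l]>>%VS.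

(* The inclusion of the quantum group in O_n^+ is part of
   [orthogonal_quantum_group]: it is [rel_O u] together with [generates u]. *)
Definition easy A n (u : 'M[A]_n) : Prop :=
  [/\ orthogonal_quantum_group u, contains_Sn u &
   exists X : collection,
     [/\ forall k l, X k l \subset partitions k l,
         forall k l (p : diagram k l),
           noncrossing_pair_partition p -> p \in X k l
       & corresponds X u]].

End CStar.

(* Main.v *)
(* Each category is described by counting [oplus] and [ominus] points in blocks.
   Rotations, and the permutations of lower points of equal parity provided by
   [p_hl], bring a block of a given diagram to the front, so that the diagrams
   are obtained from one-block diagrams by tensor products; this gives the
   generation statements and shows that all the [T_p] are intertwiners.

   A *-homomorphism is contractive on small self-adjoint elements, so its kernel
   is closed; a representation with half-commuting entries thus factors through
   the half-liberated quotient, which provides comultiplication, counit, antipode,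
   evaluations at permutations, and the model used next.

   Conversely, if [v] is a scalar unitary matrix, the 2 x 2 matrices with
   off-diagonal entries [v i j] and its conjugate satisfy the half-commutation
   relations.  An intertwiner is thus a tensor on which [v] acts at the points of
   one colour and its conjugate at those of the other colour, and which is
   invariant when [v] is any unitary matrix (O), fixes the vector of ones (B), or
   is monomial (H).  For O, Schur-Weyl duality for the unitary group, obtained
   from the double commutant of the symmetric group, yields the pair partitions.
   For B, the same duality is applied on the orthogonal complement of the vector
   of ones, after splitting the tensor according to the decomposition
   [1 = E + J] at each point.  For H, diagonal matrices force the level sets
   of the index to be balanced, permutation matrices make the tensor depend
   only on the kernel of the index, and Moebius inversion on the lattice of
   partitions expresses the tensor through the [T_p]. *)
From HB Require Import structures.
Require Import Defs.
From mathcomp Require Import spectral.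
From mathcomp Require Import all_solvable all_field.
From mathcomp Require Import all_boot all_order all_algebra all_fingroup.
From mathcomp Require Import all_classical all_reals.
From mathcomp Require Import complex.
From mathcomp Require Import zify lra.
From mathcomp Require Import fintype finset.
Set Implicit Arguments.
Unset Strict Implicit.
Unset Printing Implicit Defensive.
Import Order.TTheory GRing.Theory Num.Theory.

(** * Diagrams and their colour-counting categories *)

(** Composition is the only operation that is not a relabelling: a block of a composite is the trace
    of a component of a glued graph. Balance of such a trace is an alternating sum in which every
    middle point cancels. Smallness comes from an edge count, a connected graph on [v] vertices
    having at least [v - 1] edges. The pair category is the intersection of the other two and needs
    no third argument. The generation argument is run for an arbitrary collection with a few closure
    properties, so that it also applies to the partitions whose maps are intertwiners. Schur-Weyl
    duality is proved relative to an orthogonal projection [E]. With [E = 1] it serves O; with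
    [E = 1 - J], where [J] projects onto the vector of ones, it serves B without a basis of the
    complement of that vector. Multiplicities (points of a colour, occurrences of an eigenvalue) are
    read off by scaling with a root of unity whose relevant powers are distinct, so that no density
    or continuity of the unitary group enters. *)

Section Partitions.
Variables S T : finType.
Implicit Types (p q : {set {set S}}) (f : S -> T).

Lemma eq_partition p q :
  finset.partition p [set: S] -> finset.partition q [set: S] ->
  (forall x y, (y \in pblock p x) = (y \in pblock q x)) -> p = q.
Proof.
move=> hp hq e; rewrite -(equivalence_partition_pblock hp).
rewrite -(equivalence_partition_pblock hq); apply: eq_in_imset => x _.
by apply/setP=> y; rewrite !inE e.
Qed.

Lemma pblockT_mem p x : finset.partition p [set: S] -> pblock p x \in p.
Proof. by move=> hp; rewrite pblock_mem // (cover_partition hp) inE. Qed.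

Lemma mem_pblockT p x : finset.partition p [set: S] -> x \in pblock p x.
Proof. by move=> hp; rewrite mem_pblock (cover_partition hp) inE. Qed.

Lemma pblockT_def p b x :
  finset.partition p [set: S] -> b \in p -> x \in b -> pblock p x = b.
Proof. by move=> /partition_trivIset; apply: def_pblock. Qed.

Lemma pblock_eqT p x y : finset.partition p [set: S] ->
  (pblock p x == pblock p y) = (y \in pblock p x).
Proof.
by move=> hp; rewrite eq_pblock ?(partition_trivIset hp) ?(cover_partition hp).
Qed.

Lemma pblock_sym p x y : finset.partition p [set: S] ->
  (y \in pblock p x) = (x \in pblock p y).
Proof. by move=> hp; rewrite -!pblock_eqT // eq_sym. Qed.

Lemma partition_block_inhab p b : finset.partition p [set: S] -> b \in p ->
  exists x, b = pblock p x.
Proof.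
move=> hp pb; have /set0Pn[x xb] := partition_neq0 hp pb.
by exists x; rewrite (pblockT_def hp pb).
Qed.

Lemma pblock_relabel f p x y : bijective f -> finset.partition p [set: S] ->
  (f y \in pblock (relabel f p) (f x)) = (y \in pblock p x).
Proof.
move=> bf hp; have fi := bij_inj bf.
rewrite (@def_pblock _ _ (f @: pblock p x)) ?(mem_imset _ _ fi) ?mem_pblockT //.
  by rewrite imset_trivIset // (partition_trivIset hp).
by apply: (imset_f (fun b : {set S} => f @: b)); apply: pblockT_mem.
Qed.

Lemma relabel_partition f p : bijective f -> finset.partition p [set: S] ->
  finset.partition (relabel f p) [set: T].
Proof.
move=> bf hp; have <- : f @: [set: S] = [set: T].
  by case: bf => g _ fK; apply/setP=> y; rewrite inE -[y]fK imset_f ?inE.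
by rewrite imset_partition //; apply: bij_inj.
Qed.

End Partitions.

Lemma relabel_comp (S T U : finType) (g : T -> U) (f : S -> T) p :
  relabel g (relabel f p) = relabel (g \o f) p.
Proof.
rewrite /relabel -imset_comp; apply: eq_imset => b.
exact: esym (imset_comp g f b).
Qed.

Lemma eq_relabel (S T : finType) (f g : S -> T) p :
  f =1 g -> relabel f p = relabel g p.
Proof. by move=> e; apply: eq_imset => b; exact: eq_imset e. Qed.

Lemma relabel_id (S : finType) (f : S -> S) p : f =1 id -> relabel f p = p.
Proof.
rewrite /relabel => e; rewrite -[RHS]imset_id; apply: eq_imset => b.
by rewrite -[RHS]imset_id; apply: eq_imset.
Qed.

Lemma imset_preimI (S T : finType) (f : S -> T) (b : {set S}) (D : {set T}) :
  (f @: b) :&: D = f @: (b :&: f @^-1: D).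
Proof.
apply/setP=> y; rewrite inE; apply/andP/imsetP.
  by case=> /imsetP[x xb ->] fD; exists x; rewrite // !inE xb.
by case=> x; rewrite !inE => /andP[xb fD] ->; rewrite imset_f.
Qed.

(** The argument [phi] judges a block by its two colour counts, so one set of closure proofs serves
    three categories. The parity of [k + l] encodes the even number of singletons in the third
    category, and it lets a cyclic shift of the points exchange the colours consistently. *)
Definition colour_cat (phi : nat -> nat -> bool) : collection := fun k l =>
  [set p in partitions k l | ~~ odd (k + l) &&
    [forall b in p, phi #|b :&: oplus k l| #|b :&: ominus k l|]].

Lemma colour_catP (phi : nat -> nat -> bool) k l (p : diagram k l) :
  reflect [/\ finset.partition p [set: _], ~~ odd (k + l) &
    forall b, b \in p -> phi #|b :&: oplus k l| #|b :&: ominus k l|]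
  (p \in colour_cat phi k l).
Proof.
rewrite 2!inE; apply: (iffP and3P) => -[h1 h2 h3]; split=> //.
  by move=> b pb; apply: (forall_inP h3).
by apply/forall_inP.
Qed.

(** The flag [e] tells whether [f] exchanges the two colours. The symmetry of [phi] absorbs such an
    exchange, which leaves a parity computation for each operation. *)
Lemma shift_count (phi : nat -> nat -> bool) k l k' l' (f : 'I_k + 'I_l -> 'I_k' + 'I_l') e
  (b : {set 'I_k + 'I_l}) :
  (forall a c, phi a c = phi c a) -> injective f ->
  (forall x, odd (position (f x)) = odd (position x) (+) e) ->
  phi #|(f @: b) :&: oplus k' l'| #|(f @: b) :&: ominus k' l'| =
  phi #|b :&: oplus k l| #|b :&: ominus k l|.
Proof.
move=> sym fi fe; rewrite !imset_preimI !card_imset //.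
case: e fe => fe; [rewrite sym|]; congr phi; apply: eq_card => x;
  by rewrite !inE fe ?addbT ?addbF ?negbK.
Qed.

Section RelabelCat.
Variables (phi : nat -> nat -> bool).
Hypothesis phi_sym : forall a b, phi a b = phi b a.

Lemma relabel_colour_cat k l k' l' (f : 'I_k + 'I_l -> 'I_k' + 'I_l') e p :
  bijective f -> odd (k + l) = odd (k' + l') ->
  (forall x, odd (position (f x)) = odd (position x) (+) e) ->
  p \in colour_cat phi k l -> relabel f p \in colour_cat phi k' l'.
Proof.
move=> bf okl fe /colour_catP[pP okl0 phiP]; apply/colour_catP; split.
- exact: relabel_partition.
- by rewrite -okl.
move=> _ /imsetP[b pb ->].
by rewrite (shift_count _ phi_sym (bij_inj bf) fe) phiP.
Qed.

End RelabelCat.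

Lemma partitionU (T : finType) (P Q : {set {set T}}) (D E : {set T}) :
  finset.partition P D -> finset.partition Q E -> [disjoint D & E] ->
  finset.partition (P :|: Q) (D :|: E).
Proof.
case/and3P=> /eqP cP tP P0 /and3P[/eqP cQ tQ Q0] dDE; apply/and3P; split.
- by rewrite /cover bigcup_setU -/(cover P) -/(cover Q) cP cQ.
- by apply: trivIsetU => //; rewrite cP cQ.
- by rewrite inE negb_or P0.
Qed.

Section Tensor.
Variables k l k' l' : nat.
Local Notation tl := (@tensor_left k l k' l').
Local Notation tr := (@tensor_right k l k' l').

Lemma tensor_left_inj : injective tl.
Proof. by case=> i [] j //= [] /(@ord_inj _ i j) ->. Qed.

Lemma tensor_right_inj : injective tr.
Proof. by case=> i [] j //= [] /addnI/(@ord_inj _ i j) ->. Qed.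

Lemma tensor_split x : (exists y, x = tl y) \/ (exists y, x = tr y).
Proof.
case: x => i; case: (split_ordP i) => j ->.
- by left; exists (inl j).
- by right; exists (inl j).
- by left; exists (inr j).
- by right; exists (inr j).
Qed.

Lemma tensor_left_neq_right x y : tl x <> tr y.
Proof.
by case: x => i; case: y => j //= [] e; have := ltn_ord i; rewrite e ltnNge leq_addr.
Qed.

Lemma tensor_partition p q :
  finset.partition p [set: _] -> finset.partition q [set: _] ->
  finset.partition (tensor p q) [set: 'I_(k + k') + 'I_(l + l')].
Proof.
move=> hp hq; have -> : [set: 'I_(k + k') + 'I_(l + l')] =
    tl @: [set: _] :|: tr @: [set: _].
  apply/setP=> x; rewrite !inE; case: (tensor_split x) => -[y ->].
    by rewrite imset_f.
  by rewrite [X in _ || X]imset_f ?orbT.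
apply: partitionU; rewrite ?imset_partition //.
- exact: tensor_left_inj.
- exact: tensor_right_inj.
rewrite -setI_eq0; apply/eqP/setP=> x; rewrite !inE.
apply/negP=> /andP[/imsetP[y _ ->] /imsetP[z _]].
exact: tensor_left_neq_right.
Qed.

Lemma position_tensor_left x : position (tl x) = position x + k'.
Proof. by case: x => i /=; [have := ltn_ord i|]; lia. Qed.

(** Upper points of the right factor keep their positions, while its lower points move by [k + l],
    which is even. *)
Lemma odd_position_tensor_right x : ~~ odd (k + l) ->
  odd (position (tr x)) = odd (position x).
Proof.
case: x => i /= h; first by have hi := ltn_ord i; congr odd; lia.
have -> : k + k' + (l + i) = (k + l) + (k' + i) by lia.
by rewrite oddD (negPf h).
Qed.

Lemma tensor_colour_cat phi p q : (forall a b, phi a b = phi b a) ->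
  p \in colour_cat phi k l -> q \in colour_cat phi k' l' ->
  tensor p q \in colour_cat phi (k + k') (l + l').
Proof.
move=> sym /colour_catP[pP oP fP] /colour_catP[qP oQ fQ]; apply/colour_catP; split.
- exact: tensor_partition.
- have -> : k + k' + (l + l') = (k + l) + (k' + l') by lia.
  by rewrite oddD (negPf oP) (negPf oQ).
move=> b /setUP[] /imsetP[c hc ->].
  rewrite (@shift_count _ _ _ _ _ _ (odd k')) ?fP //; first exact: tensor_left_inj.
  by move=> x; rewrite position_tensor_left oddD.
rewrite (@shift_count _ _ _ _ _ _ false) ?fQ //; first exact: tensor_right_inj.
by move=> x; rewrite odd_position_tensor_right ?addbF.
Qed.

End Tensor.

(** * Involution and rotations as shifts of the cyclic order *)

Section Rotations.
Variable phi : nat -> nat -> bool.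
Hypothesis phi_sym : forall a b, phi a b = phi b a.

(** Turning upside down reverses the cyclic order: position [t] becomes [k + l - 1 - t]. *)
Lemma involution_colour_cat k l (p : diagram k l) :
  p \in colour_cat phi k l -> involution p \in colour_cat phi l k.
Proof.
move=> pP; apply: (relabel_colour_cat phi_sym (e := ~~ odd (k + l))) pP.
- by exists (fun x => match x with inl i => inr i | inr j => inl j end); case.
- by rewrite addnC.
by case=> i /=; rewrite !oddD ?oddB ?ltn_ord //=; case: odd; case: odd; case: odd.
Qed.

Definition rot_down_map k l (a : 'I_k.+1) (b : 'I_l.+1) (x : 'I_k.+1 + 'I_l) :
    'I_k + 'I_l.+1 :=
  match x with
  | inl i => if unlift a i is Some i' then inl i' else inr b
  | inr j => inr (lift b j)
  end.

Definition rot_up_map k l (a : 'I_k.+1) (b : 'I_l.+1) (x : 'I_k + 'I_l.+1) :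
    'I_k.+1 + 'I_l :=
  match x with
  | inl i => inl (lift a i)
  | inr j => if unlift b j is Some j' then inr j' else inl a
  end.

Lemma rot_down_mapK k l a b :
  cancel (@rot_down_map k l a b) (@rot_up_map k l a b).
Proof.
case=> [i|j] /=; last by rewrite liftK.
by case: (unliftP a i) => [i' ->|->] //=; rewrite unlift_none.
Qed.

Lemma rot_up_mapK k l a b : cancel (@rot_up_map k l a b) (@rot_down_map k l a b).
Proof.
case=> [i|j] /=; first by rewrite liftK.
by case: (unliftP b j) => [j' ->|->] //=; rewrite unlift_none.
Qed.

Lemma rot_downK k l a b (p : diagram k.+1 l) : rot_up a b (rot_down a b p) = p.
Proof.
rewrite /rot_up /rot_down relabel_comp; apply: relabel_id.
exact: (@rot_down_mapK k l a b).
Qed.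

(** The leftmost points of the two rows are neighbours in the cyclic order, so a left rotation
    changes no position. *)
Lemma rot_down_left_colour_cat k l (p : diagram k.+1 l) :
  p \in colour_cat phi k.+1 l -> rot_down ord0 ord0 p \in colour_cat phi k l.+1.
Proof.
apply: (relabel_colour_cat phi_sym (e := false)) => [| |x]; last 1 first.
- rewrite addbF; congr odd; case: x => [i|j]; last by rewrite /= addSnnS.
  by case: (unliftP ord0 i) => [i' ->|->] /=; [rewrite subSS|lia].
- exact: (Bijective (@rot_down_mapK k l _ _) (@rot_up_mapK k l _ _)).
by rewrite addSnnS.
Qed.

Lemma rot_up_left_colour_cat k l (p : diagram k l.+1) :
  p \in colour_cat phi k l.+1 -> rot_up ord0 ord0 p \in colour_cat phi k.+1 l.
Proof.
apply: (relabel_colour_cat phi_sym (e := false)) => [| |x]; last 1 first.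
- rewrite addbF; congr odd; case: x => [i|j]; first by rewrite /= subSS.
  by case: (unliftP ord0 j) => [j' ->|->] /=; rewrite /bump /=; lia.
- exact: (Bijective (@rot_up_mapK k l _ _) (@rot_down_mapK k l _ _)).
by rewrite addSnnS.
Qed.

(** The rightmost upper point leaves position 0 for the last one and all others move back by one. As
    the number of points is even, the colours are exchanged everywhere, also at the moved point. *)
Lemma rot_down_right_colour_cat k l (p : diagram k.+1 l) :
  p \in colour_cat phi k.+1 l -> rot_down ord_max ord_max p \in colour_cat phi k l.+1.
Proof.
move=> pP; have okl : ~~ odd (k.+1 + l) by case/colour_catP: pP.
apply: (relabel_colour_cat phi_sym (e := true)) (pP) => [| |x]; last 1 first.
- case: x => [i|j]; last first.
    by rewrite /= /bump leqNgt ltn_ord /= add0n ?addSn /= addbT negbK.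
  case: (unliftP ord_max i) => [i' ->|->] /=.
    rewrite /bump leqNgt ltn_ord /= add0n.
    have -> : k.+1 - i'.+1 = (k - i'.+1).+1 by have := ltn_ord i'; lia.
    by rewrite /= addbT negbK.
  by rewrite subnn; move: okl; rewrite /= negbK.
- exact: (Bijective (@rot_down_mapK k l _ _) (@rot_up_mapK k l _ _)).
by rewrite addSnnS.
Qed.

Lemma rot_up_right_colour_cat k l (p : diagram k l.+1) :
  p \in colour_cat phi k l.+1 -> rot_up ord_max ord_max p \in colour_cat phi k.+1 l.
Proof.
move=> pP; have okl : ~~ odd (k + l.+1) by case/colour_catP: pP.
apply: (relabel_colour_cat phi_sym (e := true)) (pP) => [| |x]; last 1 first.
- case: x => [i|j].
    rewrite /= /bump leqNgt ltn_ord /= add0n.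
    have -> : k.+1 - i.+1 = (k - i.+1).+1 by have := ltn_ord i; lia.
    by rewrite /= addbT.
  case: (unliftP ord_max j) => [j' ->|->] /=.
    by rewrite /bump leqNgt ltn_ord /= add0n addbT.
  by rewrite subnn addbT; move: okl; rewrite addnS /= negbK => ->.
- exact: (Bijective (@rot_up_mapK k l _ _) (@rot_down_mapK k l _ _)).
by rewrite addSnnS.
Qed.

End Rotations.

(** * Composition of diagrams *)

Lemma sum_saturated (T : finType) (V : nmodType) (p : {set {set T}})
    (D : {set T}) (f : T -> V) :
  finset.partition p [set: T] ->
  (forall b x, b \in p -> x \in b -> x \in D -> b \subset D) ->
  (\sum_(x in D) f x = \sum_(b in p | b \subset D) \sum_(x in b) f x)%R.
Proof.
move=> hp sat; rewrite (partition_big (finset.pblock p) (mem p)) /=; last first.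
  by move=> x _; apply: pblockT_mem.
rewrite [RHS]big_mkcondr; apply: eq_bigr => b pb; case: ifP => bD.
  apply: eq_bigl => x; apply/andP/idP => [[_ /eqP <-]|xb].
    exact: mem_pblockT.
  by rewrite (subsetP bD) // (pblockT_def hp pb xb).
apply: big1 => x /andP[xD /eqP e]; move: bD; rewrite (sat b x) //.
by rewrite -e mem_pblockT.
Qed.

(** A connected graph on [v] vertices has at least [v - 1] edges; here the edges are the two-element
    members of [F]. A maximal set [D] around [x0] that satisfies the inequality is the whole
    component, since a path leaving [D] would add one vertex together with one new edge. *)
Lemma connected_card (T : finType) (F : {set {set T}}) (e : rel T) (x0 : T) :
  (forall b, b \in F -> #|b| <= 2) ->
  (forall x y, e x y -> exists2 b, b \in F & (x \in b) && (y \in b)) ->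
  #|[set z | connect e x0 z]| <=
    #|[set c in F | (c \subset [set z | connect e x0 z]) && (#|c| == 2)]|.+1.
Proof.
move=> F2 eF; set K := [set z | _].
pose E (D : {set T}) := [set c in F | (c \subset D) && (#|c| == 2)].
pose P (D : {set T}) := [&& x0 \in D, D \subset K & #|D| <= #|E D|.+1].
have P0 : P [set x0] by rewrite /P cards1 sub1set !inE eqxx connect0.
have [D /maxsetP[/and3P[x0D DK cD] maxD] _] := maxset_exists P0.
suff KD : K \subset D by have <- : D = K by apply/eqP; rewrite eqEsubset DK.
apply/negPn/negP=> /subsetPn[z zK zD]; move: zK; rewrite inE => /connectP[s].
(* The path is shortened from its end until its last edge leads from a point of [D] to a point
   outside. *)
elim/last_ind: s z zD => [|s w IHs] z zD /=.
  by move=> _ zx; rewrite zx x0D in zD.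
rewrite rcons_path last_rcons => /andP[ps es] zw; move: zD; rewrite {}zw => wD.
have [lD|lD] := boolP (last x0 s \in D); last exact: (IHs _ lD ps erefl).
have wK : w \in K.
  by rewrite inE; apply: connect_trans (connect1 es); apply/connectP; exists s.
have [b bF /andP[lb wb]] := eF _ _ es.
have lw : last x0 s != w by apply: contraNneq wD => <-.
have b2 : b = [set last x0 s; w].
  apply/esym/eqP; rewrite eqEcard cards2 lw F2 // andbT.
  by apply/subsetP=> y; rewrite !inE => /orP[] /eqP->.
have PU : P (w |: D).
  rewrite /P !inE x0D orbT subUset sub1set wK DK /= cardsU1 wD add1n ltnS.
  apply: leq_trans cD _; rewrite [leqRHS](cardsD1 b).
  have -> : b \in E (w |: D).
    rewrite inE bF {1 2}b2 cards2 lw eqxx andbT.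
    by apply/subsetP=> y; rewrite !inE => /orP[] /eqP->; rewrite ?lD ?eqxx ?orbT.
  rewrite add1n ltnS; apply: subset_leq_card; apply/subsetP=> c.
  rewrite !inE => /and3P[cF cDs c2]; rewrite cF c2 andbT /=.
  rewrite (subset_trans cDs (subsetUr _ _)) andbT.
  by apply: contraNneq wD => cb; rewrite (subsetP cDs) // cb.
by move: wD; rewrite -(maxD _ PU (subsetUr _ _)) !inE eqxx.
Qed.

Section Compose.
Variables (k l m : nat) (p : diagram k l) (q : diagram l m).
Hypotheses (hp : finset.partition p [set: _]) (hq : finset.partition q [set: _]).
Local Notation outer := (@glue_outer k l m).
Local Notation top := (@glue_top k l m).
Local Notation bot := (@glue_bot k l m).
Local Notation g := (glued p q).

Lemma glue_top_inj : injective top. Proof. by move=> x y []. Qed.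
Lemma glue_bot_inj : injective bot. Proof. by case=> x [] y //= [] ->. Qed.

Lemma glued_sym : symmetric g.
Proof.
move=> x y; rewrite /glued; congr orb; apply: eq_existsb => b;
by rewrite [X in _ && X]andbC.
Qed.

Lemma connect_glued_sym x y : connect g x y = connect g y x.
Proof. exact: (sym_connect_sym glued_sym _ _). Qed.

Lemma compose_equiv :
  {in [set: _] & &, equivalence_rel (fun x y => connect g (outer x) (outer y))}.
Proof.
move=> x y z _ _ _; split=> [|xy]; first exact: connect0.
by apply/idP/idP; apply: connect_trans; rewrite // connect_glued_sym.
Qed.

Lemma compose_partition : finset.partition (compose p q) [set: _].
Proof. exact: (equivalence_partitionP compose_equiv). Qed.

Lemma compose_pblock x y :
  (y \in finset.pblock (compose p q) x) = connect g (outer x) (outer y).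
Proof. by rewrite (pblock_equivalence_partition compose_equiv) ?inE. Qed.

Lemma glued_connect_inv (X : eqType) (h : 'I_k + 'I_l + 'I_m -> X) :
  (forall b x y, b \in p -> x \in b -> y \in b -> h (top x) = h (top y)) ->
  (forall b x y, b \in q -> x \in b -> y \in b -> h (bot x) = h (bot y)) ->
  forall x y, connect g x y -> h x = h y.
Proof.
move=> hP hQ x y /connectP[s]; elim: s x => [|z s IHs] x /=; first by move=> _ ->.
case/andP=> xz ps e; rewrite -(IHs _ ps e).
case/orP: xz => /exists_inP[b pb /andP[/imsetP[u ub ->] /imsetP[v vb ->]]].
  exact: hP pb ub vb.
exact: hQ pb ub vb.
Qed.

Lemma connect_top b x y : b \in p -> x \in b -> y \in b -> connect g (top x) (top y).
Proof.
move=> pb xb yb; apply: connect1; apply/orP; left; apply/exists_inP; exists b => //.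
by rewrite !imset_f.
Qed.

Lemma connect_bot b x y : b \in q -> x \in b -> y \in b -> connect g (bot x) (bot y).
Proof.
move=> pb xb yb; apply: connect1; apply/orP; right; apply/exists_inP; exists b => //.
by rewrite !imset_f.
Qed.


Local Notation K x := [set z | connect g (outer x) z].

Lemma top_saturated x b y :
  b \in p -> y \in b -> y \in top @^-1: K x -> b \subset top @^-1: K x.
Proof.
move=> pb yb; rewrite !inE => xy; apply/subsetP=> z zb; rewrite !inE.
exact: connect_trans xy (connect_top pb yb zb).
Qed.

Lemma bot_saturated x b y :
  b \in q -> y \in b -> y \in bot @^-1: K x -> b \subset bot @^-1: K x.
Proof.
move=> pb yb; rewrite !inE => xy; apply/subsetP=> z zb; rewrite !inE.
exact: connect_trans xy (connect_bot pb yb zb).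
Qed.

Local Open Scope ring_scope.

(** An outer point of a component belongs to one of the two diagrams, a middle point to both.
    Constant summands give the cardinality count, signs give the balance count. *)
Lemma component_sum (V : nmodType) x (f : 'I_k + 'I_l -> V) (h : 'I_l + 'I_m -> V)
    (r : 'I_k + 'I_m -> V) :
  (forall i, f (inl i) = r (inl i)) -> (forall j, h (inr j) = r (inr j)) ->
  \sum_(y in top @^-1: K x) f y + \sum_(y in bot @^-1: K x) h y =
  \sum_(y in outer @^-1: K x) r y +
  \sum_(j | inl (inr j) \in K x) (f (inr j) + h (inl j)).
Proof.
move=> ef eh; rewrite !big_sumType /= big_split /=.
rewrite (eq_bigr _ (fun i _ => ef i)) (eq_bigr _ (fun j _ => eh j)).
under eq_bigl do rewrite !inE.
under [X in _ + X + _]eq_bigl do rewrite !inE.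
under [X in _ + _ + (X + _)]eq_bigl do rewrite !inE.
under [X in _ + _ + (_ + X)]eq_bigl do rewrite !inE.
under [X in _ = X + _ + _]eq_bigl do rewrite !inE.
under [X in _ = _ + X + _]eq_bigl do rewrite !inE.
under [X in _ = _ + (X + _)]eq_bigl do rewrite !inE.
under [X in _ = _ + (_ + X)]eq_bigl do rewrite !inE.
by rewrite (addrC (\sum_(i < l | _) h _)) addrACA.
Qed.

Lemma component_card x :
  (#|top @^-1: K x| + #|bot @^-1: K x| = #|outer @^-1: K x| + 2 * #|[set j | inl (inr j) \in K x]|)%N.
Proof.
have := @component_sum nat x (fun=> 1%N) (fun=> 1%N) (fun=> 1%N) (fun=> erefl) (fun=> erefl).
rewrite /= !sum1_card => e; apply: etrans e _; congr (_ + _)%N.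
rewrite mulnC -sum_nat_const.
by apply: eq_bigl => j; rewrite !inE.
Qed.

Lemma card_component x :
  (#|K x| = #|outer @^-1: K x| + #|[set j | inl (inr j) \in K x]|)%N.
Proof.
rewrite -!sum1_card !big_sumType /= addnAC; congr (_ + _ + _)%N;
  by apply: eq_bigl => j; rewrite !inE.
Qed.

Lemma compose_block b : b \in compose p q -> exists x, x \in b /\ b = outer @^-1: K x.
Proof.
move=> bpq; have [x ->] := partition_block_inhab compose_partition bpq.
exists x; split; first by rewrite compose_pblock connect0.
by apply/setP=> y; rewrite compose_pblock !inE.
Qed.

Lemma sign_sum k' l' (b : {set 'I_k' + 'I_l'}) :
  \sum_(x in b) ((-1) ^+ position x : int) =
  #|b :&: oplus k' l'|%:Z - #|b :&: ominus k' l'|%:Z :> int.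
Proof.
rewrite (bigID (mem (oplus k' l'))) /=; congr (_ + _).
  rewrite (eq_bigr (fun=> (1 : int))) => [|x /andP[_]]; last first.
    by rewrite inE -signr_odd => /negPf->.
  rewrite sumr_const -mulr_natl mulr1 natz; congr Posz; apply: eq_card => x.
  by rewrite [LHS]unfold_in /= !inE.
rewrite (eq_bigr (fun=> (-1 : int))) => [|x /andP[_]]; last first.
  by rewrite inE negbK -signr_odd => ->.
rewrite sumr_const -mulr_natl mulrN1 natz; congr (- Posz _); apply: eq_card => x.
by rewrite [LHS]unfold_in /= !inE negbK.
Qed.

Lemma balancedP k' l' (b : {set 'I_k' + 'I_l'}) :
  reflect (\sum_(x in b) ((-1) ^+ position x : int) = 0 :> int)
    (#|b :&: oplus k' l'| == #|b :&: ominus k' l'|).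
Proof.
rewrite sign_sum; apply: (iffP eqP) => [->|]; first by rewrite subrr.
by move/eqP; rewrite subr_eq0 => /eqP[].
Qed.

(** The signs of [q] are multiplied by [(-1)^(k+l)], which makes them agree with the signs of the
    composite on the lower row. Each middle point then receives opposite signs from [p] and from [q]
    and drops out. *)
Lemma compose_balanced x :
  (forall b, b \in p -> b \subset top @^-1: K x ->
     #|b :&: oplus k l| = #|b :&: ominus k l|) ->
  (forall b, b \in q -> b \subset bot @^-1: K x ->
     #|b :&: oplus l m| = #|b :&: ominus l m|) ->
  #|outer @^-1: K x :&: oplus k m| = #|outer @^-1: K x :&: ominus k m|.
Proof.
move=> bp bq; apply/eqP/balancedP.
have := @component_sum int x (fun y => (-1) ^+ position y)
  (fun y => (-1) ^+ (k + l) * (-1) ^+ position y) (fun y => (-1) ^+ position y)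
  (fun=> erefl).
rewrite -big_distrr /= (sum_saturated _ hp (@top_saturated x)).
rewrite (sum_saturated _ hq (@bot_saturated x)).
rewrite big1 => [|b /andP[pb bK]]; last by apply/balancedP/eqP/bp.
rewrite big1 => [|b /andP[pb bK]]; last by apply/balancedP/eqP/bq.
rewrite mulr0 addr0 [X in _ = _ + X]big1 => [|j _].
  rewrite addr0 => <- // j /=; rewrite -exprD.
  have -> : (k + l + (l + j) = k + j + 2 * l)%N by lia.
  by rewrite [LHS]exprD exprM sqrrN !expr1n mulr1.
rewrite /= -exprD; apply/eqP; rewrite addr_eq0 -[eqbRHS]mulN1r -exprS.
have -> : ((k + l + (l - j.+1)).+1 = k + j + 2 * (l - j))%N by have := ltn_ord j; lia.
by rewrite [eqbRHS]exprD exprM sqrrN !expr1n mulr1.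
Qed.

Local Close Scope ring_scope.

(** A pair inside [D] accounts for two points and a singleton for one; the second conjunct is the
    case of equality, in which singletons are excluded. *)
Lemma pair_blocks_bound (T : finType) (r : {set {set T}}) (D : {set T}) :
  finset.partition r [set: T] -> (forall b, b \in r -> #|b| <= 2) ->
  (forall b x, b \in r -> x \in b -> x \in D -> b \subset D) ->
  2 * #|[set c in r | (c \subset D) && (#|c| == 2)]| <= #|D| /\
  (#|D| <= 2 * #|[set c in r | (c \subset D) && (#|c| == 2)]| ->
   forall b, b \in r -> b \subset D -> #|b| = 2).
Proof.
move=> hr r2 sat; have -> : #|D| = \sum_(b in r | b \subset D) #|b|.
  rewrite -sum1_card; have /= -> := @sum_saturated _ nat r D (fun=> 1) hr sat.
  by apply: eq_bigr => b _; rewrite -[RHS]sum1_card.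
have -> : 2 * #|[set c in r | (c \subset D) && (#|c| == 2)]| =
    \sum_(b in r | b \subset D) 2 * (#|b| == 2).
  rewrite -sum1_card big_distrr /= [RHS](bigID (fun b : {set T} => #|b| == 2)) /=.
  rewrite [X in _ = _ + X]big1 => [|b /andP[_ /negPf->]]; last by rewrite muln0.
  rewrite addn0; apply: eq_big => [b|b]; rewrite !inE ?andbA //.
  by case/andP=> _ ->.
have le b : b \in r -> 2 * (#|b| == 2) <= #|b|.
  by move=> rb; case: eqP => [->|]; lia.
split; first by apply: leq_sum => b /andP[rb _]; apply: le.
move=> ge b rb bD; move: ge; rewrite !(bigD1 (P := fun b => (b \in r) && (b \subset D)) b) /= ?rb ?bD //.
set s1 := \sum_(_ | _) _; set s2 := \sum_(_ | _) _ => ge.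
have s21 : s2 <= s1 by apply: leq_sum => c /andP[/andP[rc _] _]; apply: le.
have bpos : #|b| != 0 by rewrite cards_eq0 (partition_neq0 hr rb).
by have := r2 _ rb; move: ge; case: eqP => //; lia.
Qed.

(** With [o] outer and [M] middle points, the blocks in a component cover [o + 2M] points, so they
    contain at most [o/2 + M] pairs. Connectedness requires at least [o + M - 1] pairs, whence
    [o <= 2]; for [o = 2] every block involved is a pair. *)
Lemma compose_small x :
  (forall b, b \in p -> #|b| <= 2) -> (forall b, b \in q -> #|b| <= 2) ->
  #|outer @^-1: K x| <= 2 /\
  (#|outer @^-1: K x| = 2 ->
   (forall b, b \in p -> b \subset top @^-1: K x -> #|b| = 2) /\
   (forall b, b \in q -> b \subset bot @^-1: K x -> #|b| = 2)).
Proof.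
move=> p2 q2; have [tle teq] := pair_blocks_bound hp p2 (@top_saturated x).
have [ble beq] := pair_blocks_bound hq q2 (@bot_saturated x).
pose F := [set top @: b | b : {set _} in p] :|: [set bot @: b | b : {set _} in q].
have F2 b : b \in F -> #|b| <= 2.
  case/setUP=> /imsetP[c hc ->].
    by rewrite card_imset ?p2 //; apply: glue_top_inj.
  by rewrite card_imset ?q2 //; apply: glue_bot_inj.
have gF y z : g y z -> exists2 b, b \in F & (y \in b) && (z \in b).
  case/orP=> /exists_inP[b hb yz]; [exists (top @: b)|exists (bot @: b)] => //.
    by apply/setUP; left; apply: imset_f.
  by apply/setUP; right; apply: imset_f.
have := connected_card (outer x) F2 gF; rewrite card_component.
have eK := component_card x.
set nF := #|[set c in F | _]|; set nt := #|[set c in p | _]| in tle teq.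
set nb := #|[set c in q | _]| in ble beq.
have nF_le : nF <= nt + nb.
  rewrite /nt /nb -(card_imset _ (imset_inj glue_top_inj)).
  rewrite -(card_imset (mem [set c in q | _]) (imset_inj glue_bot_inj)).
  apply: leq_trans (leq_card_setU _ _).1; apply: subset_leq_card.
  apply/subsetP=> c; rewrite inE => /and3P[/setUP[] /imsetP[b hb ->] bK b2].
    apply/setUP; left; apply: (imset_f (fun b : {set _} => top @: b)).
    move: b2; rewrite inE hb card_imset; last exact: glue_top_inj.
    by move=> ->; rewrite andbT -sub_imset_pre.
  apply/setUP; right; apply: (imset_f (fun b : {set _} => bot @: b)).
  move: b2; rewrite inE hb card_imset; last exact: glue_bot_inj.
  by move=> ->; rewrite andbT -sub_imset_pre.
have arith o M t b e f h : t + b = o + 2 * M -> 2 * e <= t -> 2 * f <= b ->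
    h <= e + f -> o + M <= h.+1 -> o <= 2 /\ (o = 2 -> t <= 2 * e /\ b <= 2 * f).
  by lia.
move=> cK; have [o2 oeq] := arith _ _ _ _ _ _ _ eK tle ble nF_le cK.
by split=> // /oeq[/teq ? /beq].
Qed.

End Compose.

(** * The three counting conditions *)

Definition phiO (a b : nat) : bool := (a == 1) && (b == 1).
Definition phiH (a b : nat) : bool := a == b.
Definition phiB (a b : nat) : bool := phiO a b || (a + b == 1).

Lemma phiO_sym a b : phiO a b = phiO b a. Proof. exact: andbC. Qed.
Lemma phiH_sym a b : phiH a b = phiH b a. Proof. exact: eq_sym. Qed.
Lemma phiB_sym a b : phiB a b = phiB b a.
Proof. by rewrite /phiB phiO_sym addnC. Qed.

Lemma card_colours k l (b : {set 'I_k + 'I_l}) :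
  #|b| = #|b :&: oplus k l| + #|b :&: ominus k l|.
Proof.
rewrite -(cardsID (oplus k l) b); congr addn; apply: eq_card => x.
by rewrite !inE negbK andbC.
Qed.

Lemma even_points k l (p : diagram k l) :
  p \in partitions k l -> (forall b, b \in p -> ~~ odd #|b|) -> ~~ odd (k + l).
Proof.
rewrite inE => hp ev; have := card_partition hp.
rewrite cardsT card_sum !card_ord => ->.
by elim/big_ind: _ => // a b; rewrite oddD => /negPf-> /negPf->.
Qed.

Lemma cat_Ostar_count k l : cat_Ostar k l = colour_cat phiO k l.
Proof.
apply/setP=> p; apply/idP/colour_catP.
  rewrite inE => /andP[pP /forall_inP h]; split=> [| |b pb].
  - by rewrite inE in pP.
  - by apply: even_points pP _ => b /h /andP[/andP[/eqP-> _] _].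
  - by rewrite /phiO; have /andP[/andP[_ ->] ->] := h _ pb.
case=> hp _ h; rewrite 2!inE hp /=; apply/forall_inP=> b pb.
by have /andP[/eqP e1 /eqP e2] := h _ pb; rewrite /one_oplus_one_ominus card_colours e1 e2.
Qed.

Lemma cat_Hstar_count k l : cat_Hstar k l = colour_cat phiH k l.
Proof.
apply/setP=> p; apply/idP/colour_catP.
  rewrite inE => /andP[pP /forall_inP h]; split=> [| |b pb].
  - by rewrite inE in pP.
  - by apply: even_points pP _ => b /h /andP[].
  - by have /andP[] := h _ pb.
case=> hp _ h; rewrite 2!inE hp /=; apply/forall_inP=> b pb.
by have /eqP e := h _ pb; rewrite card_colours e addnn odd_double eqxx.
Qed.

(** Blocks other than singletons have two points, so the number of singletons has the parity of
    [k + l]. This replaces a condition on all singletons together by the parity in [colour_cat]. *)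
Lemma cat_Bstar_count k l : cat_Bstar k l = colour_cat phiB k l.
Proof.
have par (p : diagram k l) : p \in partitions k l ->
    (forall b, b \in p -> #|b| = 2 \/ #|b| = 1) ->
    odd (k + l) = odd #|[set b in p | #|b| == 1]|.
  rewrite inE => hp h; have := card_partition hp.
  rewrite cardsT card_sum !card_ord => ->.
  rewrite (bigID (fun b : {set _} => #|b| == 1)) /= oddD.
  rewrite [X in _ (+) odd X](_ : _ = 2 * \sum_(b in p | #|b| != 1) 1); last first.
    rewrite big_distrr; apply: eq_bigr => b /andP[pb b1] /=.
    by case: (h b pb) b1 => ->.
  rewrite oddM addbF; congr odd; rewrite -sum1_card.
  by apply: eq_big => [b|b /andP[_ /eqP]//]; rewrite inE.
apply/setP=> p; apply/idP/colour_catP.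
  rewrite inE => /andP[pP /andP[/forall_inP h ev]]; split=> [| |b pb].
  - by rewrite inE in pP.
  - rewrite (par p) // => b /h /orP[/andP[/andP[/eqP-> _] _]|/eqP->]; by [left|right].
  - rewrite /phiB /phiO -[X in _ || (X == 1)](card_colours b).
    by have /orP[/andP[/andP[_ -> ->]]|->] := h _ pb; rewrite ?orbT.
case=> hp ev h.
have h' b : b \in p -> one_oplus_one_ominus b || (#|b| == 1).
  move=> /h; rewrite /one_oplus_one_ominus (card_colours b).
  by case/orP=> [/andP[/eqP-> /eqP->]|->]; rewrite ?orbT.
rewrite 2!inE hp /=; apply/andP; split; first by apply/forall_inP=> b /h'.
rewrite -(par p) // ?inE // => b /h' /orP[/andP[/andP[/eqP-> _] _]|/eqP->]; by [left|right].
Qed.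

Section ComposeCat.
Variables (k l m : nat) (p : diagram k l) (q : diagram l m).

Lemma compose_colour_H : p \in colour_cat phiH k l -> q \in colour_cat phiH l m ->
  compose p q \in colour_cat phiH k m.
Proof.
move=> /colour_catP[pP pe pH] /colour_catP[qP qe qH]; apply/colour_catP; split.
- exact: compose_partition.
- by move: pe qe; rewrite !oddD; do 3!case: odd.
move=> b /compose_block[x [_ ->]]; apply/eqP/(compose_balanced pP qP).
  by move=> c /pH /eqP.
by move=> c /qH /eqP.
Qed.

Lemma compose_colour_B : p \in colour_cat phiB k l -> q \in colour_cat phiB l m ->
  compose p q \in colour_cat phiB k m.
Proof.
move=> /colour_catP[pP pe pB] /colour_catP[qP qe qB]; apply/colour_catP; split.
- exact: compose_partition.
- by move: pe qe; rewrite !oddD; do 3!case: odd.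
have small a b : phiB a b -> a + b <= 2 by case/orP=> [/andP[/eqP-> /eqP->]|/eqP->].
have pair a b : phiB a b -> a + b = 2 -> a = b.
  by case/orP=> [/andP[/eqP-> /eqP->]//|/eqP->].
move=> b /compose_block[x [xb eb]].
have [|c /qB|b2 beq] := compose_small pP qP x.
- by move=> c /pB; rewrite (card_colours c); apply: small.
- by rewrite (card_colours c); apply: small.
have bpos : 0 < #|b| by apply/card_gt0P; exists x.
rewrite -eb in b2 beq; have [e2|b1] := eqVneq #|b| 2; last first.
  rewrite /phiB -card_colours; apply/orP; right.
  by move: bpos b2 b1; case: #|b| => [|[|[|]]].
have [p2 q2] := beq e2.
have e : #|b :&: oplus k m| = #|b :&: ominus k m|.
  rewrite eb; apply: (compose_balanced pP qP) => c hc cK; apply: pair.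
  - exact: pB.
  - by rewrite -card_colours p2.
  - exact: qB.
  - by rewrite -card_colours q2.
have a1 : #|b :&: oplus k m| = 1 by move: e2; rewrite (card_colours b) -e; lia.
by rewrite /phiB /phiO -e a1.
Qed.

(** A nonempty balanced block with at most two points is a pair with both colours. The pair category
    is therefore an intersection and inherits closure under composition. *)
Lemma phiO_HB a b : phiO a b = phiH a b && phiB a b && (a != 0).
Proof.
rewrite /phiO /phiB /phiO /phiH; case: (eqVneq a b) => [->|ab] /=; last first.
  by apply/negP=> /andP[/eqP a1 /eqP b1]; rewrite a1 b1 in ab.
by rewrite !andbb addnn; case: b => [|[|b]].
Qed.

Lemma colour_cat_O k' l' (r : diagram k' l') : (r \in colour_cat phiO k' l') =
  (r \in colour_cat phiH k' l') && (r \in colour_cat phiB k' l').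
Proof.
apply/idP/andP.
  case/colour_catP=> rP re rO; split; apply/colour_catP; split=> // b /rO;
    by rewrite phiO_HB => /andP[/andP[]].
case=> /colour_catP[rP re rH] /colour_catP[_ _ rB]; apply/colour_catP; split=> // b rb.
rewrite phiO_HB rH // rB //=; apply: contraNneq (partition_neq0 rP rb) => b0.
by rewrite -cards_eq0 card_colours -(eqP (rH _ rb)) b0.
Qed.

Lemma compose_colour_O : p \in colour_cat phiO k l -> q \in colour_cat phiO l m ->
  compose p q \in colour_cat phiO k m.
Proof.
rewrite !colour_cat_O => /andP[pH pB] /andP[qH qB].
by rewrite compose_colour_H ?compose_colour_B.
Qed.

End ComposeCat.

Lemma setT1_partition (T : finType) : 0 < #|T| ->
  finset.partition [set [set: T]] [set: T].
Proof.
move=> T0; apply/and3P; split; rewrite ?trivIset1 ?cover1 //.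
by rewrite inE eq_sym -card_gt0 cardsT.
Qed.

Lemma setT1_colour_cat (phi : nat -> nat -> bool) k l :
  0 < k + l -> ~~ odd (k + l) -> phi #|oplus k l| #|ominus k l| ->
  [set [set: 'I_k + 'I_l]] \in colour_cat phi k l.
Proof.
move=> kl0 okl h; apply/colour_catP; split=> //.
  by apply: setT1_partition; rewrite card_sum !card_ord.
by move=> b /set1P->; rewrite !setTI.
Qed.

Lemma card_oplus k l :
  #|oplus k l| = \sum_(i < k) ~~ odd (k - i.+1) + \sum_(j < l) ~~ odd (k + j).
Proof.
rewrite cardsE -sum1_card big_mkcond big_sumType /=.
by congr addn; apply: eq_bigr => i _; rewrite unfold_in /=; case: odd.
Qed.

Lemma card_ominus k l :
  #|ominus k l| = \sum_(i < k) odd (k - i.+1) + \sum_(j < l) odd (k + j).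
Proof.
rewrite cardsE -sum1_card big_mkcond big_sumType /=.
by congr addn; apply: eq_bigr => i _; rewrite unfold_in /=; case: odd.
Qed.

Lemma full_colour_cat (phi : nat -> nat -> bool) :
  (forall a b, phi a b = phi b a) -> phi 1 1 ->
  (forall k l m (p : diagram k l) (q : diagram l m), p \in colour_cat phi k l ->
    q \in colour_cat phi l m -> compose p q \in colour_cat phi k m) ->
  full_category (colour_cat phi).
Proof.
move=> sym phi11 comp; split=> //.
- by move=> k l; apply/subsetP=> p /colour_catP[pP _ _]; rewrite inE.
- by move=> k l k' l' p q; apply: tensor_colour_cat.
- by move=> k l p; apply: involution_colour_cat.
- by move=> k l p; apply: rot_down_left_colour_cat.
- by move=> k l p; apply: rot_down_right_colour_cat.
- by move=> k l p; apply: rot_up_left_colour_cat.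
- by move=> k l p; apply: rot_up_right_colour_cat.
- by apply: setT1_colour_cat; rewrite // card_oplus card_ominus !big_ord_recl !big_ord0.
- by apply: setT1_colour_cat; rewrite // card_oplus card_ominus !big_ord_recl !big_ord0.
Qed.

Lemma eq_full_category (X Y : collection) :
  (forall k l, X k l = Y k l) -> full_category Y -> full_category X.
Proof.
move=> e; suff -> : X = Y by [].
by do 2!apply: functional_extensionality_dep => ?; apply: e.
Qed.

Lemma full_cat_Ostar : full_category cat_Ostar.
Proof.
apply: (eq_full_category cat_Ostar_count); apply: full_colour_cat => //.
  exact: phiO_sym.
exact: compose_colour_O.
Qed.

Lemma full_cat_Hstar : full_category cat_Hstar.
Proof.
apply: (eq_full_category cat_Hstar_count); apply: full_colour_cat => //.
  exact: phiH_sym.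
exact: compose_colour_H.
Qed.

Lemma full_cat_Bstar : full_category cat_Bstar.
Proof.
apply: (eq_full_category cat_Bstar_count); apply: full_colour_cat => //.
  exact: phiB_sym.
exact: compose_colour_B.
Qed.

(** * Generation *)

Definition map_lower k l m (f : 'I_l -> 'I_m) (x : 'I_k + 'I_l) : 'I_k + 'I_m :=
  match x with inl i => inl i | inr j => inr (f j) end.

Lemma map_lower_bij k l m (f : 'I_l -> 'I_m) :
  bijective f -> bijective (@map_lower k l m f).
Proof.
by case=> g fK gK; exists (map_lower g); case=> i //=; rewrite ?fK ?gK.
Qed.

Section TensorBlocks.
Variables (k l k' l' : nat) (p : diagram k l) (q : diagram k' l').
Hypotheses (hp : finset.partition p [set: _]) (hq : finset.partition q [set: _]).
Local Notation tl := (@tensor_left k l k' l').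
Local Notation tr := (@tensor_right k l k' l').

Lemma pblock_tensor_left x : finset.pblock (tensor p q) (tl x) = tl @: finset.pblock p x.
Proof.
apply: (pblockT_def (tensor_partition hp hq)); last by rewrite imset_f ?mem_pblockT.
apply/setUP; left; apply: (imset_f (fun b : {set _} => tl @: b)).
exact: pblockT_mem.
Qed.

Lemma pblock_tensor_right x : finset.pblock (tensor p q) (tr x) = tr @: finset.pblock q x.
Proof.
apply: (pblockT_def (tensor_partition hp hq)); last by rewrite imset_f ?mem_pblockT.
apply/setUP; right; apply: (imset_f (fun b : {set _} => tr @: b)).
exact: pblockT_mem.
Qed.

End TensorBlocks.

Lemma tuple_perm_fibres (m : nat) (L : eqType) (f1 f2 : 'I_m -> L) :
  (forall z, #|[set i | f1 i == z]| = #|[set i | f2 i == z]|) ->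
  exists s : 'S_m, forall i, f1 i = f2 (s i).
Proof.
move=> h; have cnt (f : 'I_m -> L) z :
    count_mem z [tuple f i | i < m] = #|[set i | f i == z]|.
  rewrite cardE /enum_mem size_filter /= count_map enumT.
  by apply: eq_count => i; rewrite /= inE.
have : perm_eq [tuple f1 i | i < m] [tuple f2 i | i < m].
  by apply/allP => z _ /=; apply/eqP; rewrite !cnt h.
case/tuple_permP=> s e; exists s => i.
have : tnth [tuple f1 i | i < m] i = tnth [tuple tnth [tuple f2 i | i < m] (s i) | i < m] i.
  by congr tnth; apply: val_inj.
by rewrite !tnth_mktuple.
Qed.

Section Split.
Variables (phi : nat -> nat -> bool) (n m : nat) (q : diagram 0 (n + m)).
Hypothesis phi_sym : forall a b, phi a b = phi b a.
Hypothesis qP : q \in colour_cat phi 0 (n + m).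
Hypothesis n_even : ~~ odd n.
Hypothesis n_gt0 : 0 < n.
Local Notation tl := (@tensor_left 0 n 0 m).
Local Notation tr := (@tensor_right 0 n 0 m).

(** The remaining factor is the partition induced on the points behind the front block; none of its
    blocks reaches the front, which is a block by itself. Evenness of [n] keeps the colours of the
    remaining points. *)
Lemma split_front_block : tl @: [set: _] \in q ->
  exists2 p, p \in colour_cat phi 0 m & q = tensor [set [set: 'I_0 + 'I_n]] p.
Proof.
move=> Bq; have /colour_catP[hq okl hphi] := qP.
have nB x : tr x \notin tl @: [set: 'I_0 + 'I_n].
  by apply/imsetP=> -[y _ /esym]; apply: tensor_left_neq_right.
pose p := preim_partition (fun x => finset.pblock q (tr x)) [set: 'I_0 + 'I_m].
have hp : finset.partition p [set: _] by apply: preim_partitionP.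
have pE x y : (y \in finset.pblock p x) = (tr y \in finset.pblock q (tr x)).
  rewrite pblock_equivalence_partition ?inE ?pblock_eqT //.
  by move=> ? ? ? _ _ _; split=> // /eqP->.
have trp x : tr @: finset.pblock p x = finset.pblock q (tr x).
  apply/setP=> y; apply/imsetP/idP => [[z zp ->]|yq]; first by rewrite -pE.
  case: (tensor_split y) => -[z e]; last by exists z; rewrite // pE -e.
  have yB : y \in tl @: [set: 'I_0 + 'I_n] by rewrite e imset_f.
  have := nB x; rewrite -(pblockT_def hq Bq yB) pblock_sym //.
  by rewrite yq.
exists p.
  apply/colour_catP; split=> //.
    by move: okl; rewrite !add0n oddD (negPf n_even).
  move=> b pb; have [x ->] := partition_block_inhab hp pb.
  rewrite -(@shift_count phi _ _ _ _ tr false) //.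
  - by rewrite trp hphi // pblockT_mem.
  - exact: tensor_right_inj.
  - by move=> y; rewrite odd_position_tensor_right ?addbF.
have h1 : finset.partition [set [set: 'I_0 + 'I_n]] [set: _].
  by apply: setT1_partition; rewrite card_sum !card_ord.
apply: eq_partition => // [|x y]; first exact: (tensor_partition h1 hp).
case: (@tensor_split 0 n 0 m x) => -[x' ->].
  rewrite (pblock_tensor_left h1 hp) (pblockT_def hq Bq) ?imset_f //.
  by rewrite (pblockT_def h1 (set11 _)) ?inE.
by rewrite (pblock_tensor_right h1 hp) trp.
Qed.

End Split.

Lemma card_parity_front (n m : nat) (c : bool) :
  #|[set i : 'I_(n.*2 + m) | (i < n.*2) && (odd i == c)]| = n.
Proof.
rewrite -sum1dep_card big_split_ord /= [X in _ + X]big_pred0 ?addn0 => [|i]; last first.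
  by rewrite ltnNge leq_addr.
under eq_bigl => i do rewrite ltn_ord /=.
rewrite big_mkcond /=; elim: n => [|n IHn]; first by rewrite big_ord0.
rewrite !big_ord_recr /= IHn odd_double /=.
by case: c {IHn}; rewrite /= ?addn0 ?addn1.
Qed.

(** The labels [f1] and [f2] combine the parity of a point with membership in [b] and in the front
    segment, respectively. Both take each value equally often, since a segment of length [2n] has
    [n] points of each parity. A permutation carrying one label to the other moves [b] to the front
    and preserves colours. *)
Lemma front_block_perm (n m : nat) (b : {set 'I_0 + 'I_(n.*2 + m)}) :
  #|b :&: oplus _ _| = n -> #|b :&: ominus _ _| = n ->
  exists s : 'S_(n.*2 + m), (forall i, odd (s i) = odd i) /\
    map_lower s @: b = @tensor_left 0 n.*2 0 m @: [set: _].
Proof.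
move=> bp bm.
pose f1 (i : 'I_(n.*2 + m)) := (inr i \in b, odd i).
pose f2 (i : 'I_(n.*2 + m)) := (i < n.*2, odd i).
have cardT (f : 'I_(n.*2 + m) -> bool) c :
    #|[set i | (f i, odd i) == (false, c)]| =
    #|[set i : 'I_(n.*2 + m) | odd i == c]| - #|[set i | (f i, odd i) == (true, c)]|.
  rewrite -(cardsID [set i | f i] [set i : 'I_(n.*2 + m) | odd i == c]).
  rewrite (_ : #|_ :&: _| = #|[set i | (f i, odd i) == (true, c)]|); last first.
    by apply: eq_card => i; rewrite !inE xpair_eqE andbC eqb_id.
  by rewrite addKn; apply: eq_card => i; rewrite !inE xpair_eqE eqbF_neg.
have cT c : #|[set i | f1 i == (true, c)]| = n.
  rewrite -(@card_imset _ _ (fun i => inr i : 'I_0 + _)); last by move=> ? ? [].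
  case: c; [rewrite -[RHS]bm|rewrite -[RHS]bp]; apply: eq_card => -[[]//|i];
    rewrite mem_imset ?inE ?xpair_eqE /= ?eqb_id ?eqbF_neg //; by move=> ? ? [].
have cT2 c : #|[set i | f2 i == (true, c)]| = n.
  by rewrite -[RHS](card_parity_front n m c); apply: eq_card => i; rewrite !inE xpair_eqE eqb_id.
have [|s hs] := @tuple_perm_fibres _ _ f1 f2.
  by case=> -[] c; rewrite ?cT ?cT2 // !cardT cT cT2.
have bs i : (inr i \in b) = (s i < n.*2) by have [] := hs i.
exists s; split; first by move=> i; have [] := hs i.
apply/setP=> -[[]//|j]; apply/imsetP/imsetP => [[[[]//|i] ib [->]]|[[[]//|i] _ [->]]].
  have lt : s i < n.*2 by rewrite -bs.
  by exists (inr (Ordinal lt)) => //; congr inr; apply: val_inj.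
exists (inr (s^-1%g (lshift m i))); last by rewrite /= permKV.
by rewrite bs permKV /= ltn_ord.
Qed.

Lemma map_lower_comp k l m n (f : 'I_m -> 'I_n) (g : 'I_l -> 'I_m) (p : diagram k l) :
  relabel (map_lower f) (relabel (map_lower g) p) = relabel (map_lower (f \o g)) p.
Proof. by rewrite relabel_comp; apply: eq_relabel; case. Qed.

Lemma map_lower1 k l (p : diagram k l) : relabel (map_lower (1%g : 'S_l)) p = p.
Proof. by apply: relabel_id; case=> i //=; rewrite perm1. Qed.

(** * Generation from swaps, rotations and tensor products *)

Section Generation.
Variables (C : collection).
Hypothesis C_rot : forall k l (p : diagram k l.+1),
  p \in C k l.+1 -> rot_up ord0 ord0 p \in C k.+1 l.
Hypothesis C_swap : forall m (a b : 'I_m) (p : diagram 0 m),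
  val b = (val a).+2 -> p \in partitions 0 m ->
  p \in C 0 m -> relabel (map_lower (tperm a b)) p \in C 0 m.

(** Induction on the distance through [(a b) = (a c)(c b)(a c)], with [c] two places before [b]. The
    section assumes of [C] only upward left rotation, this swap, tensor products of lower diagrams
    and the empty diagram, so that [C] may be a category containing [p_hl] or the collection
    [intertwining]. *)
Lemma closed_tperm m (a b : 'I_m) (p : diagram 0 m) :
  odd a = odd b -> p \in partitions 0 m -> p \in C 0 m ->
  relabel (map_lower (tperm a b)) p \in C 0 m.
Proof.
wlog ab : a b p / a <= b => [hw|].
  case: (leqP a b) => [h|/ltnW h]; first exact: hw h.
  by rewrite tpermC => e; apply: hw h _.
move=> oab; have [d bE] : exists d, val b = a + d.*2.
  exists (b - a)./2; have : odd (b - a) = false by rewrite oddB // oab addbb.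
  by move=> h; rewrite even_halfK ?h // subnKC.
elim: d b bE p {ab oab} => [|d IHd] b bE p pP pC.
  have -> : b = a by apply: val_inj; rewrite /= bE addn0.
  by rewrite tperm1 map_lower1.
case: d => [|d] in IHd bE *; first by apply: C_swap => //; rewrite bE /=; lia.
have clt : a + d.+1.*2 < m by have := ltn_ord b; rewrite bE; lia.
pose c := Ordinal clt.
have ca : c != a by rewrite -val_eqE /=; lia.
have cb : c != b by rewrite -val_eqE /= bE; lia.
have ba : b != a by rewrite -val_eqE /= bE; lia.
have hpart (s : 'S_m) (r : diagram 0 m) : r \in partitions 0 m ->
    relabel (map_lower s) r \in partitions 0 m.
  by rewrite !inE; apply/relabel_partition/map_lower_bij/injF_bij/perm_inj.
have C1 : relabel (map_lower (tperm a c)) p \in C 0 m by apply: IHd.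
have C2 := @C_swap _ c b _ _ (hpart _ _ pP) C1.
have C3 : relabel (map_lower (tperm a c)) (relabel (map_lower (tperm c b))
   (relabel (map_lower (tperm a c)) p)) \in C 0 m.
  apply: IHd; first by [].
    by apply: (hpart); apply: (hpart).
  by apply: C2; rewrite /= bE; lia.
rewrite !map_lower_comp in C3; suff <- : relabel (map_lower (tperm a c \o (tperm c b \o tperm a c))) p = relabel (map_lower (tperm a b)) p by [].
apply: eq_relabel; case=> //= x; congr inr.
have [ac bc ab] : [/\ a != c, b != c & a != b] by split; rewrite eq_sym.
have [->|xa] := eqVneq x a.
  by rewrite tpermL tpermL (tpermD ab cb) tpermL.
have [->|xc] := eqVneq x c.
  by rewrite tpermR (tpermD ca ba) tpermL (tpermD ac bc).
have [->|xb] := eqVneq x b; first by rewrite (tpermD ab cb) tpermR tpermR tpermR.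
have [ax cx bx] : [/\ a != x, c != x & b != x] by split; rewrite eq_sym.
by rewrite (tpermD ax cx) (tpermD cx bx) (tpermD ax cx) (tpermD ax bx).
Qed.

(** Multiplying [s] by the transposition of [x] and [s x] makes [x] a fixed point and moves no new
    point. Both have the same parity, so this transposition is available. *)
Lemma closed_perm m (s : 'S_m) (p : diagram 0 m) :
  (forall i, odd (s i) = odd i) -> p \in partitions 0 m -> p \in C 0 m ->
  relabel (map_lower s) p \in C 0 m.
Proof.
have [n] := ubnP #|[set x | s x != x]|; elim: n s => // n IHn s.
rewrite ltnS => sn hs pP pC.
have [/existsP[x sx]|/existsPn hid] := boolP [exists x, s x != x]; last first.
  rewrite (eq_relabel (g := map_lower (1%g : 'S_m))) ?map_lower1 // => -[]//= i.
  by rewrite perm1; congr inr; apply/eqP; have := hid i; rewrite negbK.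
pose t := (s * tperm x (s x))%g.
have tx : t x = x by rewrite permM tpermR.
have ts y : t y != y -> s y != y.
  apply: contraNneq => sy; rewrite permM sy tpermD //.
    by apply: contraNneq sx => ->; rewrite sy.
  by apply: contraNneq sx => e; rewrite -(inj_eq (@perm_inj _ s)) e sy.
have tC : relabel (map_lower t) p \in C 0 m.
  apply: IHn => //.
    apply: leq_trans sn; apply: proper_card; apply/properP; split.
      by apply/subsetP=> y; rewrite !inE; apply: ts.
    by exists x; rewrite !inE ?tx ?eqxx.
  by move=> i; rewrite permM -[RHS]hs; case: tpermP => [->|->|//]; rewrite hs.
have pt : relabel (map_lower t) p \in partitions 0 m.
  by move: pP; rewrite !inE; apply/relabel_partition/map_lower_bij/injF_bij/perm_inj.
have := closed_tperm (esym (hs x)) pt tC.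
rewrite map_lower_comp (eq_relabel (g := map_lower s)) //.
by case=> //= i; rewrite permM tpermK.
Qed.

Variables (phi : nat -> nat -> bool).
Hypothesis phi_sym : forall a b, phi a b = phi b a.

Lemma colour_cat_perm m (s : 'S_m) (p : diagram 0 m) :
  (forall i, odd (s i) = odd i) -> p \in colour_cat phi 0 m ->
  relabel (map_lower s) p \in colour_cat phi 0 m.
Proof.
move=> hs; apply: (relabel_colour_cat phi_sym (e := false)) => //.
  exact/map_lower_bij/injF_bij/perm_inj.
by case=> //= i; rewrite addbF !add0n hs.
Qed.

(** Rotating the upper points down one by one leaves a diagram with lower points only, and each
    rotation is undone inside [C]. *)
Lemma generation_rot :
  (forall m, colour_cat phi 0 m \subset C 0 m) ->
  forall k l, colour_cat phi k l \subset C k l.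
Proof.
move=> h0; elim=> [|k IHk] l //; apply/subsetP=> p pP.
rewrite -(rot_downK ord0 ord0 p); apply: C_rot.
exact/(subsetP (IHk _))/rot_down_left_colour_cat.
Qed.

Hypothesis C_tensor : forall s m (p : diagram 0 s) (q : diagram 0 m),
  p \in C 0 s -> q \in C 0 m -> tensor p q \in C 0 (s + m).

(* A balanced block can be moved to the front by a colour-preserving permutation. *)
Lemma generation_step n m (p : diagram 0 m) b :
  (forall m', m' < m -> colour_cat phi 0 m' \subset C 0 m') ->
  [set [set: 'I_0 + 'I_n.+1.*2]] \in C 0 n.+1.*2 ->
  p \in colour_cat phi 0 m -> b \in p ->
  #|b :&: oplus 0 m| = n.+1 -> #|b :&: ominus 0 m| = n.+1 -> p \in C 0 m.
Proof.
move=> IH base pP pb bp bm.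
have hm : n.+1.*2 <= m.
  rewrite -addnn -{1}bp -{}bm -card_colours.
  by apply: leq_trans (max_card _) _; rewrite card_sum !card_ord.
have [m' em] : exists m', m = n.+1.*2 + m' by exists (m - n.+1.*2); rewrite subnKC.
subst m; have [s [hs sb]] := front_block_perm bp bm.
have sP := colour_cat_perm hs pP.
have [|//||p' p'P e] := split_front_block phi_sym sP.
- by rewrite odd_double.
- rewrite -sb; exact: (imset_f (fun b : {set _} => map_lower s @: b)).
have -> : p = relabel (map_lower (s^-1)%g) (relabel (map_lower s) p).
  by rewrite map_lower_comp relabel_id //; case=> //= i; rewrite permK.
apply: closed_perm.
- by move=> i; rewrite -{2}(permKV s i) hs.
- by have /colour_catP[] := sP; rewrite inE.
rewrite e; apply: C_tensor => //; apply: (subsetP (IH m' _)) => //; lia.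
Qed.

Hypothesis C_nil : finset.set0 \in C 0 0.

Lemma generation_nil : colour_cat phi 0 0 \subset C 0 0.
Proof.
apply/subsetP=> p /colour_catP[pP _ _]; suff -> : p = finset.set0 by [].
apply/setP=> b; rewrite in_set0; apply/negP=> pb.
by have /set0Pn[[[]|[]]] := partition_neq0 pP pb.
Qed.

End Generation.

Section GenerationCases.
Variables (C : collection).
Hypothesis C_rot : forall k l (p : diagram k l.+1),
  p \in C k l.+1 -> rot_up ord0 ord0 p \in C k.+1 l.
Hypothesis C_swap : forall m (a b : 'I_m) (p : diagram 0 m),
  val b = (val a).+2 -> p \in partitions 0 m ->
  p \in C 0 m -> relabel (map_lower (tperm a b)) p \in C 0 m.
Hypothesis C_tensor : forall s m (p : diagram 0 s) (q : diagram 0 m),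
  p \in C 0 s -> q \in C 0 m -> tensor p q \in C 0 (s + m).
Hypothesis C_nil : finset.set0 \in C 0 0.

Lemma generation_H :
  (forall n, [set [set: 'I_0 + 'I_n.+1.*2]] \in C 0 n.+1.*2) ->
  forall k l, colour_cat phiH k l \subset C k l.
Proof.
move=> base; apply: generation_rot => //; first exact: phiH_sym.
move=> m; have [n] := ubnP m; elim: n m => // n IHn m; rewrite ltnS => mn.
case: m mn => [|m] mn; first exact: generation_nil.
apply/subsetP=> p pP; have /colour_catP[hp _ hH] := pP.
pose b := finset.pblock p (inr ord0); have pb : b \in p by apply: pblockT_mem.
have e := eqP (hH _ pb).
have b0 : #|b :&: oplus 0 m.+1| != 0.
  apply: contraNneq (partition_neq0 hp pb) => b0.
  by rewrite -cards_eq0 card_colours -e b0.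
case er : #|b :&: oplus 0 m.+1| b0 e => [//|r] _ e.
apply: (@generation_step C C_swap phiH phiH_sym C_tensor r) pP pb er _ => //.
by move=> m' lt; apply: IHn; lia.
Qed.

Lemma generation_O : p_pair \in C 0 2 ->
  forall k l, colour_cat phiO k l \subset C k l.
Proof.
move=> base; apply: generation_rot => //; first exact: phiO_sym.
move=> m; have [n] := ubnP m; elim: n m => // n IHn m; rewrite ltnS => mn.
case: m mn => [|m] mn; first exact: generation_nil.
apply/subsetP=> p pP; have /colour_catP[hp _ hO] := pP.
pose b := finset.pblock p (inr ord0); have pb : b \in p by apply: pblockT_mem.
have /andP[/eqP e1 /eqP e2] := hO _ pb.
apply: (@generation_step C C_swap phiO phiO_sym C_tensor 0) pP pb e1 e2 => //.
by move=> m' lt; apply: IHn; lia.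
Qed.

Lemma singletons_tensor k l k' l' :
  tensor [set [set x] | x : 'I_k + 'I_l] [set [set x] | x : 'I_k' + 'I_l'] =
  [set [set x] | x : 'I_(k + k') + 'I_(l + l')].
Proof.
apply/setP=> b; apply/setUP/imsetP.
  case=> /imsetP[_ /imsetP[x _ ->] ->].
    by exists (tensor_left _ _ x); rewrite ?imset_set1.
  by exists (tensor_right _ _ x); rewrite ?imset_set1.
case=> x _ ->; case: (tensor_split x) => -[y ->]; [left|right];
  by rewrite -imset_set1; apply: (imset_f (fun b : {set _} => _ @: b)); rewrite imset_f.
Qed.

(** As long as a pair with both colours occurs, it is split off. Otherwise only singletons remain,
    in even number, and these form a tensor power of [p_upup]. *)
Lemma generation_B : p_pair \in C 0 2 -> p_upup \in C 0 2 ->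
  forall k l, colour_cat phiB k l \subset C k l.
Proof.
move=> base up; apply: generation_rot => //; first exact: phiB_sym.
have singles n : [set [set x] | x : 'I_0 + 'I_n.*2] \in C 0 n.*2.
  elim: n => [|n IHn].
    rewrite (_ : [set _ | x : _] = finset.set0) //.
    by apply/setP=> b; rewrite in_set0; apply/imsetP=> -[[[]|[]]].
  by rewrite doubleS -(singletons_tensor 0 2 0 n.*2); exact: (@C_tensor 2 n.*2 _ _ up IHn).
move=> m; have [n] := ubnP m; elim: n m => // n IHn m; rewrite ltnS => mn.
apply/subsetP=> p pP; have /colour_catP[hp ev hB] := pP.
have [/exists_inP[b pb b2]|/exists_inPn none] := boolP [exists b in p, phiO #|b :&: oplus 0 m| #|b :&: ominus 0 m|].
  have /andP[/eqP e1 /eqP e2] := b2.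
  apply: (@generation_step C C_swap phiB phiB_sym C_tensor 0) pP pb e1 e2 => //.
  by move=> m' lt; apply: IHn; lia.
have p1 b : b \in p -> #|b| = 1.
  move=> pb; have := hB _ pb; rewrite /phiB (negPf (none _ pb)) /= -card_colours.
  by move/eqP.
have em : m = m./2.*2 by rewrite even_halfK //; move: ev; rewrite add0n.
suff -> : p = [set [set x] | x : 'I_0 + 'I_m] by have := singles m./2; rewrite -em.
apply/setP=> b; apply/idP/imsetP => [pb|[x _ ->]].
  by have /eqP/cards1P[x ->] := p1 _ pb; exists x.
have /eqP/cards1P[y e] := p1 _ (pblockT_mem x hp).
have := mem_pblockT x hp; rewrite e => /set1P xy.
by rewrite xy -e pblockT_mem.
Qed.

End GenerationCases.

(** * Permutation diagrams in full categories *)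

Definition perm_diagram l m (f : 'I_l -> 'I_m) : diagram l m :=
  [set [set inl i; inr (f i)] | i : 'I_l].

Definition ord_sum_map k l k' l' (f : 'I_k -> 'I_l) (g : 'I_k' -> 'I_l')
    (x : 'I_(k + k')) : 'I_(l + l') :=
  match split x with inl i => lshift l' (f i) | inr j => rshift l (g j) end.

Lemma eq_perm_diagram l m (f g : 'I_l -> 'I_m) :
  f =1 g -> perm_diagram f = perm_diagram g.
Proof. by move=> e; apply: eq_imset => i; rewrite e. Qed.

Lemma mem_perm_diagram l m (f : 'I_l -> 'I_m) i :
  [set inl i; inr (f i)] \in perm_diagram f.
Proof. by apply/imsetP; exists i. Qed.

Lemma tensor_perm_diagram k l k' l' (f : 'I_k -> 'I_l) (g : 'I_k' -> 'I_l') :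
  tensor (perm_diagram f) (perm_diagram g) = perm_diagram (ord_sum_map f g).
Proof.
apply/setP=> b; apply/setUP/imsetP.
  case=> /imsetP[_ /imsetP[i _ ->] ->]; rewrite imsetU !imset_set1.
    by exists (lshift k' i); rewrite // /ord_sum_map (unsplitK (inl i)).
  by exists (rshift k i); rewrite // /ord_sum_map (unsplitK (inr i)).
case=> i _ ->; rewrite /ord_sum_map; case: (split_ordP i) => j ->;
  rewrite ?(unsplitK (inl j)) ?(unsplitK (inr j)); [left|right].
  apply/imsetP; exists [set inl j; inr (f j)]; first exact: mem_perm_diagram.
  by rewrite /= imsetU !imset_set1.
apply/imsetP; exists [set inl j; inr (g j)]; first exact: mem_perm_diagram.
by rewrite /= imsetU !imset_set1.
Qed.

Lemma perm_diagram_partition l m (f : 'I_l -> 'I_m) :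
  bijective f -> finset.partition (perm_diagram f) [set: _].
Proof.
case=> g fK gK; pose h (x : 'I_l + 'I_m) := match x with inl i => f i | inr j => j end.
have -> : perm_diagram f = preim_partition h [set: _]; last exact: preim_partitionP.
have e i : [set inl i; inr (f i)] = [set y in [set: 'I_l + 'I_m] | h (inl i) == h y].
  apply/setP=> -[j|j]; rewrite !inE /=; last by rewrite eq_sym.
  rewrite orbF (inj_eq (can_inj fK)) [RHS]eq_sym.
  by apply/eqP/eqP => [[]|->].
apply/setP=> b; apply/imsetP/imsetP => [[i _ ->]|[x _ ->]].
  by exists (inl i); rewrite ?inE.
case: x => [i|j]; first by exists i.
by exists (g j); rewrite // e /= gK.
Qed.

Lemma compose_perm_diagram k l m (p : diagram k l) (f : 'I_l -> 'I_m) :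
  bijective f -> finset.partition p [set: _] ->
  compose p (perm_diagram f) = relabel (map_lower f) p.
Proof.
move=> bf hp; have [g fK gK] := bf; have bF := map_lower_bij k bf.
apply: eq_partition; [exact: compose_partition|exact: relabel_partition|].
move=> x y; rewrite compose_pblock.
(* The map [r] contracts the glued graph onto the points of [p] by following each strand of the
   permutation backwards, so it is constant on the strands. *)
pose r (z : 'I_k + 'I_l + 'I_m) : 'I_k + 'I_l :=
  match z with inl u => u | inr j => inr (g j) end.
have ro z : z = map_lower f (r (glue_outer l z)) by case: z => //= j; rewrite gK.
rewrite [in RHS](ro x) [in RHS](ro y) pblock_relabel //.
have co z : connect (glued p (perm_diagram f)) (glue_outer l z) (glue_top m (r (glue_outer l z))).
  case: z => [i|j] /=; first exact: connect0.
  apply: (@connect_bot _ _ _ _ _ [set inl (g j); inr (f (g j))] (inr j) (inl (g j)));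
    by rewrite ?mem_perm_diagram ?inE ?gK ?eqxx ?orbT.
apply/idP/idP => [xy|xy].
  rewrite -pblock_eqT //.
  apply/eqP; apply: (glued_connect_inv (h := fun z => finset.pblock p (r z))) xy.
    by move=> b u v pb ub vb /=; rewrite !(pblockT_def hp pb).
  move=> _ u v /imsetP[i _ ->].
  by rewrite !inE => /orP[] /eqP-> /orP[] /eqP->; rewrite /= ?fK.
apply: connect_trans (co x) _; rewrite connect_glued_sym.
apply: connect_trans (co y) _; apply: connect_top (pblockT_mem (r (glue_outer l x)) hp) _ _ => //.
exact: mem_pblockT.
Qed.

Lemma p_unit_perm : p_unit = perm_diagram id.
Proof.
apply/setP=> b; rewrite inE; apply/eqP/imsetP => [->|[i _ ->]].
  by exists ord0 => //; apply/setP=> -[] i; rewrite !inE ord1 eqxx ?orbT.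
by apply/setP=> -[] j; rewrite !inE !ord1 eqxx ?orbT.
Qed.

Lemma compose_one_block n m (q : diagram n m) : 0 < n -> 0 < m ->
  finset.partition q [set: _] ->
  (forall j, exists i, inl i \in finset.pblock q (inr j)) ->
  compose [set [set: 'I_0 + 'I_n]] q = [set [set: 'I_0 + 'I_m]].
Proof.
move=> n0 m0 hq h; apply: eq_partition.
- exact: compose_partition.
- by apply: setT1_partition; rewrite card_sum !card_ord.
case=> [[]//|i] [[]//|j]; rewrite compose_pblock.
rewrite (pblockT_def (setT1_partition _) (set11 _)) ?inE //; last first.
  by rewrite card_sum !card_ord.
have [i' hi] := h i; have [j' hj] := h j.
set p := [set _]; have ci : connect (glued p q) (glue_outer n (inr i)) (glue_top m (inr i')).
  exact: (@connect_bot 0 n m p q _ (inr i) (inl i') (pblockT_mem (inr i) hq)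
    (mem_pblockT _ hq) hi).
have cj : connect (glued p q) (glue_outer n (inr j)) (glue_top m (inr j')).
  exact: (@connect_bot 0 n m p q _ (inr j) (inl j') (pblockT_mem (inr j) hq)
    (mem_pblockT _ hq) hj).
apply: connect_trans ci _; rewrite connect_glued_sym; apply: connect_trans cj _.
exact: (@connect_top 0 n m p q _ (inr j') (inr i') (set11 _) (finset.in_setT _) (finset.in_setT _)).
Qed.

Lemma relabel_setT (S T : finType) (f : S -> T) :
  bijective f -> relabel f [set [set: S]] = [set [set: T]].
Proof.
case=> g _ gK; rewrite /relabel imset_set1; congr [set _].
by apply/setP=> y; rewrite inE -[y]gK imset_f ?inE.
Qed.

Section Full.
Variable X : collection.
Hypothesis fX : full_category X.

Lemma full_partition k l p : p \in X k l -> finset.partition p [set: _].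
Proof. by move/(subsetP (cat_sub fX k l)); rewrite inE. Qed.

(** A pair closed by its mirror image is a loop without outer points, which composition discards. *)
Lemma full_nil : finset.set0 \in X 0 0.
Proof.
have h := cat_compose fX (cat_pair fX) (cat_involution fX (cat_pair fX)).
suff <- : compose p_pair (involution p_pair) = finset.set0 by [].
apply/setP=> b; rewrite in_set0; apply/negP=> pb.
by have /set0Pn[[[]|[]]] := partition_neq0 (full_partition h) pb.
Qed.

Lemma full_id n : perm_diagram (fun i : 'I_n => i) \in X n n.
Proof.
elim: n => [|n IHn].
  rewrite (_ : perm_diagram _ = finset.set0) ?full_nil //.
  by apply/setP=> b; rewrite in_set0; apply/imsetP=> -[[]].
have := cat_tensor fX (cat_unit fX) IHn; rewrite p_unit_perm tensor_perm_diagram.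
rewrite (eq_perm_diagram (g := fun i : 'I_n.+1 => i)) // => i.
by rewrite /ord_sum_map; case: (split_ordP (i : 'I_(1 + n))) => j ->;
  rewrite ?(unsplitK (inl j)) ?(unsplitK (inr j)).
Qed.

Hypothesis hl : p_hl \in X 3 3.

(** Padding [p_hl] with identity strands gives the permutation diagram of the transposition of [a]
    and [a + 2]; composing with it permutes the lower points. *)
Lemma full_swap m (a b : 'I_m) (p : diagram 0 m) :
  val b = (val a).+2 -> p \in partitions 0 m -> p \in X 0 m ->
  relabel (map_lower (tperm a b)) p \in X 0 m.
Proof.
move=> ab _ pX; have [c [a0 [ea em]]] : exists c a0, val a = a0 /\ m = a0 + 3 + c.
  have hb : val b < m := ltn_ord b; exists (m - (a + 3)), (val a).
  by rewrite ab /= in hb *; lia.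
have := cat_tensor fX (cat_tensor fX (full_id a0) hl) (full_id c).
rewrite /p_hl !tensor_perm_diagram; subst m.
rewrite (eq_perm_diagram (g := tperm a b)) => [sX|i].
  have := cat_compose fX pX sX; rewrite compose_perm_diagram ?full_partition //.
  exact/injF_bij/perm_inj.
have va : nat_of_ord a = a0 := ea.
have vb : nat_of_ord b = a0.+2 by have := ab; rewrite /= va.
apply: val_inj; rewrite /ord_sum_map.
case: (split_ordP i) => j ->; rewrite ?(unsplitK (inl j)) ?(unsplitK (inr j)) /=; last first.
  by case: tpermP => [/(congr1 val)|/(congr1 val)|_ _] /=; rewrite ?va ?vb; lia.
case: (split_ordP j) => u ->; rewrite ?(unsplitK (inl u)) ?(unsplitK (inr u)) /=.
  have hu := ltn_ord u.
  by case: tpermP => [/(congr1 val)|/(congr1 val)|_ _] /=; rewrite ?va ?vb; lia.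
have hu := ltn_ord u.
case: tpermP => [/(congr1 val)|/(congr1 val)|/eqP + /eqP +] /=;
  rewrite -?val_eqE /= ?va ?vb; lia.
Qed.

Lemma full_tensor0 s m (p : diagram 0 s) (q : diagram 0 m) :
  p \in X 0 s -> q \in X 0 m -> tensor p q \in X 0 (s + m).
Proof. exact: (@cat_tensor _ fX 0 s 0 m). Qed.

(** Rotated into [P(1,3)], the four block replaces one point of a block by three. Applied at the
    first point of an even block, it lengthens the block by two; the induction starts at
    [p_pair]. *)
Lemma full_even_block : p_four \in X 0 4 ->
  forall n, [set [set: 'I_0 + 'I_n.+1.*2]] \in X 0 n.+1.*2.
Proof.
move=> four; have h13 : [set [set: 'I_1 + 'I_3]] \in X 1 3.
  have := cat_rot_up_left fX four; rewrite /rot_up relabel_setT //.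
  exact: (Bijective (@rot_up_mapK 0 3 _ _) (@rot_down_mapK 0 3 _ _)).
elim=> [|n IHn]; first exact: cat_pair.
have qX := cat_tensor fX h13 (full_id n.*2.+1).
have := cat_compose fX IHn qX; rewrite compose_one_block //.
  exact: full_partition qX.
have h1 : finset.partition [set [set: 'I_1 + 'I_3]] [set: _] := full_partition h13.
have h2 : finset.partition (perm_diagram (fun i : 'I_n.*2.+1 => i)) [set: _].
  exact: full_partition (full_id _).
move=> j; case: (@split_ordP 3 n.*2.+1 j) => i ->.
  exists (lshift _ (ord0 : 'I_1)).
  have := pblock_tensor_left h1 h2 (inr i) => /= ->.
  rewrite (pblockT_def h1 (set11 _)) ?inE //.
  by apply/imsetP; exists (inl ord0); rewrite ?inE.
exists (rshift 1 i); have := pblock_tensor_right h1 h2 (inr i) => /= ->.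
rewrite (@pblockT_def _ _ [set inl i; inr i] _ h2) ?mem_perm_diagram ?inE ?eqxx ?orbT //.
by apply/imsetP; exists (inl i); rewrite ?inE ?eqxx.
Qed.

End Full.

Lemma generated_category_eq (gs : seq sized_diagram) (X : collection) :
  full_category X -> all (contains X) gs ->
  (forall Y, full_category Y -> all (contains Y) gs -> forall k l, X k l \subset Y k l) ->
  forall k l, generated_category gs k l = X k l.
Proof.
move=> fX gX min k l; apply/setP=> p; rewrite inE; apply/asboolP/idP => [h|pX Y fY gY].
  exact: h.
exact: (subsetP (min Y fY gY k l)).
Qed.

Lemma p_hl_colour (phi : nat -> nat -> bool) : phi 1 1 -> p_hl \in colour_cat phi 3 3.
Proof.
move=> phi11; apply/colour_catP; split=> //.
  exact: (perm_diagram_partition (inv_bij (@rev_ordK 3))).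
move=> _ /imsetP[i _ ->].
have card1 (D : {set 'I_3 + 'I_3}) : (inl i \in D) = ~~ (inr (rev_ord i) \in D) ->
    #|[set inl i; inr (rev_ord i)] :&: D| = 1.
  move=> e; apply/eqP/cards1P; exists (if inl i \in D then inl i else inr (rev_ord i)).
  apply/setP=> x; rewrite !inE; case: ifP => iD.
    have [->|] := eqVneq x (inl i); first by rewrite iD.
    case: (eqVneq x (inr (rev_ord i))) => [->|//] _ /=.
    by move: e; rewrite iD => /esym/negPf.
  have [->|_] := eqVneq x (inl i); first by rewrite iD.
  by case: eqVneq => [->|//] /=; rewrite -[_ \in D]negbK -e iD.
by rewrite !card1 //; rewrite !inE /= ?negbK; case: (i) => -[|[|[|]]].
Qed.

Lemma generated_Ostar k l : generated_category [:: Sized p_hl] k l = cat_Ostar k l.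
Proof.
apply: generated_category_eq; first exact: full_cat_Ostar.
  by rewrite /= andbT /contains /= cat_Ostar_count p_hl_colour.
move=> Y fY; rewrite /= andbT => hl {}k {}l; rewrite cat_Ostar_count.
apply: generation_O; [exact: cat_rot_up_left|exact: full_swap|exact: full_tensor0|
  exact: full_nil|exact: cat_pair].
Qed.

Lemma generated_Hstar k l :
  generated_category [:: Sized p_hl; Sized p_four] k l = cat_Hstar k l.
Proof.
apply: generated_category_eq; first exact: full_cat_Hstar.
  rewrite /= andbT /contains /= !cat_Hstar_count p_hl_colour //=.
  by apply: setT1_colour_cat; rewrite // card_oplus card_ominus !big_ord_recl !big_ord0.
move=> Y fY; rewrite /= andbT => /andP[hl four] {}k {}l; rewrite cat_Hstar_count.
apply: generation_H; [exact: cat_rot_up_left|exact: full_swap|exact: full_tensor0|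
  exact: full_nil|exact: full_even_block].
Qed.

Lemma generated_Bstar k l :
  generated_category [:: Sized p_hl; Sized p_upup] k l = cat_Bstar k l.
Proof.
apply: generated_category_eq; first exact: full_cat_Bstar.
  rewrite /= andbT /contains /= !cat_Bstar_count p_hl_colour //=.
  apply/colour_catP; split=> //.
    have -> : p_upup = preim_partition id [set: _].
      by apply/setP=> b; apply/imsetP/imsetP => -[x _ ->]; exists x; rewrite ?inE //;
        apply/setP=> y; rewrite !inE eq_sym.
    exact: preim_partitionP.
  by move=> _ /imsetP[x _ ->]; rewrite /phiB -card_colours cards1 orbT.
move=> Y fY; rewrite /= andbT => /andP[hl upup] {}k {}l; rewrite cat_Bstar_count.
apply: generation_B; [exact: cat_rot_up_left|exact: full_swap|exact: full_tensor0|
  exact: full_nil|exact: cat_pair|exact: upup].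
Qed.

Lemma position_lt k l (x : 'I_k + 'I_l) : position x < k + l.
Proof. by case: x => i /=; have := ltn_ord i; lia. Qed.

Lemma position_inj k l : injective (@position k l).
Proof.
case=> i [] j /=; have := ltn_ord i; have := ltn_ord j => hi hj e.
- by congr inl; apply: val_inj => /=; lia.
- by exfalso; lia.
- by exfalso; lia.
- by congr inr; apply: val_inj => /=; lia.
Qed.

Lemma card_ord_lt N b : b <= N -> #|[set i : 'I_N | i < b]| = b.
Proof.
move=> bN; have inj : injective (widen_ord bN).
  by move=> x y /(congr1 val)/= e; apply: val_inj.
rewrite -[RHS]card_ord -cardsT -(card_imset _ inj); apply: eq_card => i.
rewrite inE; apply/idP/imsetP => [ib|[j _ ->]]; last exact: (ltn_ord j).
by exists (Ordinal ib); rewrite ?inE //; apply: val_inj.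
Qed.

Lemma card_between k l (x y : 'I_k + 'I_l) : position x < position y ->
  #|[set z : 'I_k + 'I_l | position x < position z < position y]| =
  position y - (position x).+1.
Proof.
move=> xy; pose f (z : 'I_k + 'I_l) := Ordinal (position_lt z).
have fi : injective f by move=> u v /(congr1 val)/position_inj.
have [g fK gK] : bijective f by apply: inj_card_bij; rewrite // card_sum !card_ord.
rewrite -(card_imset _ fi).
have -> : f @: [set z | position x < position z < position y] =
    [set i : 'I_(k + l) | i < position y] :\: [set i : 'I_(k + l) | i < (position x).+1].
  apply/setP=> i; rewrite -(gK i) mem_imset // !inE /= -leqNgt.
  by case: (g i).
rewrite cardsD card_ord_lt; last exact/ltnW/position_lt.
rewrite (_ : _ :&: _ = [set i : 'I_(k + l) | i < (position x).+1]).
  by rewrite card_ord_lt //; apply: position_lt.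
by apply/setP=> i; rewrite !inE andbC; case: ltnP => //= ix; lia.
Qed.

(** Since nothing crosses, the points strictly between the ends of a pair form a union of pairs.
    Their number is even, so the ends have positions of opposite parity. *)
Lemma noncrossing_pair_Ostar k l (p : diagram k l) :
  noncrossing_pair_partition p -> p \in cat_Ostar k l.
Proof.
case=> pP p2 nc; rewrite inE pP /=; apply/forall_inP => b pb.
have hp : finset.partition p [set: _] by rewrite inE in pP.
have [x [y [xy bxy]]] : exists x y, position x < position y /\ b = [set x; y].
  have /cards2P[x [y [xy ->]]] := introT eqP (p2 _ pb).
  have [h|h|/position_inj e] := ltngtP (position x) (position y).
  - by exists x, y.
  - by exists y, x; split=> //; apply/setP=> z; rewrite !inE orbC.
  - by rewrite e eqxx in xy.
have xb : x \in b by rewrite bxy !inE eqxx.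
have yb : y \in b by rewrite bxy !inE eqxx orbT.
pose D := [set z : 'I_k + 'I_l | position x < position z < position y].
have sat c z : c \in p -> z \in c -> z \in D -> c \subset D.
  move=> pc zc; rewrite inE => zD; apply/subsetP=> w wc.
  have bc : b <> c.
    move=> e; move: zc zD; rewrite -e bxy !inE => /orP[] /eqP->; lia.
  have wx : position w <> position x.
    by move=> /position_inj e; apply: bc; rewrite -(pblockT_def hp pb xb) -e (pblockT_def hp pc wc).
  have wy : position w <> position y.
    by move=> /position_inj e; apply: bc; rewrite -(pblockT_def hp pb yb) -e (pblockT_def hp pc wc).
  rewrite inE; apply/andP; split; rewrite ltnNge; apply/negP=> le.
    apply: bc; apply/esym; apply: (nc c b pc pb w x z y) => //; last by case/andP: zD.
    by apply/andP; split; [lia|case/andP: zD].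
  by apply: bc; apply: (nc b c pb pc x z y w) => //; lia.
have evenD : ~~ odd #|D|.
  rewrite -sum1_card (@sum_saturated _ nat p D (fun=> 1) hp sat) /=.
  elim/big_ind: _ => // [u v hu hv|c /andP[pc _]].
    by rewrite oddD (negPf hu) (negPf hv).
  by rewrite sum1_card p2.
have opp : odd (position x) = ~~ odd (position y).
  by move: evenD; rewrite card_between //; lia.
have bx (E : {set 'I_k + 'I_l}) : (x \in E) = ~~ (y \in E) -> #|b :&: E| = 1.
  move=> e; apply/eqP/cards1P; exists (if x \in E then x else y).
  apply/setP=> z; rewrite bxy !inE; case: ifP => xE.
    have [->|] := eqVneq z x; first by rewrite xE.
    case: (eqVneq z y) => [->|//] _ /=.
    by move: e; rewrite xE => /esym/negPf.
  have [->|_] := eqVneq z x; first by rewrite xE; case: eqP xy => // ->; rewrite ltnn.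
  by case: eqVneq => [->|//] /=; rewrite -[_ \in E]negbK -e xE.
by rewrite /one_oplus_one_ominus p2 // !bx //; rewrite !inE opp ?negbK.
Qed.

(** * Adjoint matrices and C*-algebras *)

Local Open Scope ring_scope.

Section Adjoint.
Variable C : numClosedFieldType.

Definition adjmx m p (a : 'M[C]_(m, p)) : 'M[C]_(p, m) := (map_mx Num.conj a)^T.

Lemma adjmxD m p (a b : 'M[C]_(m, p)) : adjmx (a + b) = adjmx a + adjmx b.
Proof. by rewrite /adjmx map_mxD linearD. Qed.

Lemma adjmxZ m p (c : C) (a : 'M[C]_(m, p)) : adjmx (c *: a) = Num.conj c *: adjmx a.
Proof. by rewrite /adjmx map_mxZ linearZ. Qed.

Lemma adjmxM m p q (a : 'M[C]_(m, p)) (b : 'M[C]_(p, q)) :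
  adjmx (a *m b) = adjmx b *m adjmx a.
Proof. by rewrite /adjmx map_mxM trmx_mul. Qed.

Lemma adjmxK m p : cancel (@adjmx m p) (@adjmx p m).
Proof. by move=> a; apply/matrixP=> i j; rewrite !mxE conjCK. Qed.

Lemma adjmx1 m : adjmx 1%:M = 1%:M :> 'M[C]_m.
Proof. by rewrite /adjmx map_mx1 trmx1. Qed.

End Adjoint.

Section CStarBasics.
Variables (R : realType) (A : cstarAlgType R).
Implicit Types x y z h : A.

Lemma star0 : star (0 : A) = 0.
Proof. by apply: (addrI (star 0)); rewrite -starD !addr0. Qed.

Lemma starN x : star (- x) = - star x.
Proof. by apply/eqP; rewrite -subr_eq0 opprK -starD addNr star0. Qed.

Lemma starB x y : star (x - y) = star x - star y.
Proof. by rewrite starD starN. Qed.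

Lemma star1 : star (1 : A) = 1.
Proof. by rewrite -[LHS]mul1r -{1}[1 in LHS]starK -starM mul1r starK. Qed.

Lemma star_sum (I : Type) (r : seq I) (P : pred I) (F : I -> A) :
  star (\sum_(i <- r | P i) F i) = \sum_(i <- r | P i) star (F i).
Proof. by apply: (big_morph (@star R A) (@starD R A) star0). Qed.

Lemma starR (r : R) x : star (r%:C%C *: x) = r%:C%C *: star x.
Proof. by rewrite starZ; congr (_ *: _); apply: conjc_real. Qed.

Lemma cnormR (r : R) x : cnorm (r%:C%C *: x) = `|r| * cnorm x.
Proof. by rewrite cnormZ normc_def /= expr0n addr0 sqrtr_sqr. Qed.

Lemma cnorm0 : cnorm (0 : A) = 0.
Proof. by rewrite -(scale0r 0) -[0 in LHS]/(0%:C%C) cnormR normr0 mul0r. Qed.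

Lemma cnormN x : cnorm (- x) = cnorm x.
Proof.
have -> : - x = (-1)%:C%C *: x by rewrite rmorphN1 scaleN1r.
by rewrite cnormR normrN1 mul1r.
Qed.

Lemma cnorm_ge0 x : 0 <= cnorm x.
Proof. by have := cnormD x (- x); rewrite subrr cnorm0 cnormN; lra. Qed.

Lemma cnormB_sym x y : cnorm (x - y) = cnorm (y - x).
Proof. by rewrite -opprB cnormN. Qed.

Lemma cnorm_starE x : cnorm (star x) = cnorm x.
Proof.
suff le y : cnorm y <= cnorm (star y).
  by apply/eqP; rewrite eq_le le andbT -{2}(starK x).
have [->|/eqP y0] := eqVneq (cnorm y) 0; first exact: cnorm_ge0.
have y1 : 0 < cnorm y by rewrite lt_neqAle eq_sym (introN eqP y0) cnorm_ge0.
have := cnormM (star y) y; rewrite cnorm_star expr2.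
by rewrite ler_pM2r.
Qed.

Lemma cnorm1_le : cnorm (1 : A) <= 1.
Proof.
have := cnorm_star (1 : A); rewrite star1 mulr1 expr2 => e.
by have := cnorm_ge0 (1 : A); nra.
Qed.

Lemma cnorm_small x (K : R) : (forall e, 0 < e -> cnorm x <= K * e) -> x = 0.
Proof.
move=> h; apply: cnorm_eq0; apply/eqP; rewrite eq_le cnorm_ge0 andbT.
have K0 : 0 < `|K| + 1 by have := normr_ge0 K; lra.
apply: contraT; rewrite -ltNge => x0.
have := h (cnorm x / (`|K| + 1) / 2) (divr_gt0 (divr_gt0 x0 K0) (ltr0Sn _ 1)).
move=> le; have : cnorm x <= `|K| * (cnorm x / (`|K| + 1) / 2).
  apply: le_trans le _; apply: ler_wpM2r; last exact: ler_norm.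
  by rewrite !divr_ge0 ?cnorm_ge0 // ltW.
set t := cnorm x / (`|K| + 1) => le2.
have tE : cnorm x = t * (`|K| + 1) by rewrite /t mulfVK // gt_eqF.
have t0 : 0 < t by rewrite /t divr_gt0.
by rewrite {1}tE in le2; nra.
Qed.

Lemma half_pow_small (e : R) : 0 < e -> exists N, 2 * 2^-1 ^+ N < e.
Proof.
move=> e0; have [N hN] : exists N : nat, 2 / e < N%:R.
  exists (Num.bound (2 / e)); apply: archi_boundP.
  by rewrite divr_ge0 // ltW.
exists N; rewrite exprVn ltr_pdivrMr ?exprn_gt0 //.
rewrite mulrC -ltr_pdivrMr //; apply: lt_trans hN _.
by rewrite -natrX ltr_nat ltn_expl.
Qed.

Lemma cnorm_geometric (w : nat -> A) :
  (forall n, cnorm (w n.+1 - w n) <= 2^-1 ^+ n) ->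
  exists x, forall e, 0 < e -> exists N, forall p, (N <= p)%N -> cnorm (w p - x) < e.
Proof.
move=> h; apply: cnorm_complete.
have step n k : cnorm (w (n + k)%N - w n) <= 2 * 2^-1 ^+ n - 2 * 2^-1 ^+ (n + k).
  elim: k => [|k IHk]; first by rewrite addn0 !subrr cnorm0.
  rewrite addnS; have := cnormD (w (n + k).+1 - w (n + k)%N) (w (n + k)%N - w n).
  rewrite addrA subrK => /le_trans; apply.
  by have := h (n + k)%N; rewrite exprS; lra.
have bound N p : (N <= p)%N -> cnorm (w p - w N) <= 2 * 2^-1 ^+ N.
  move=> le; have := step N (p - N)%N; rewrite subnKC //.
  have : 0 <= 2^-1 ^+ p :> R by rewrite exprn_ge0 // invr_ge0 ler0n.
  lra.
move=> e e0; have [|N hN] := @half_pow_small (e / 2); first by rewrite divr_gt0.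
exists N => p q Np Nq; have := cnormD (w p - w N) (w N - w q).
rewrite addrA subrK => /le_lt_trans; apply.
by rewrite (cnormB_sym (w N)); have := bound _ _ Np; have := bound _ _ Nq; lra.
Qed.

(* A square root of [1 - h^2] is [1 - x] where [x] is the fixed point of the
   contraction [r |-> (h^2 + r^2) / 2] of the ball of radius [1/2]. *)
Lemma selfadjoint_sqrt h : star h = h -> cnorm h <= 2^-1 ->
  exists b, [/\ star b = b, b * h = h * b & b * b = 1 - h * h].
Proof.
move=> hs hn; pose c : R[i] := (2^-1)%:C%C.
have cc : c + c = 1.
  rewrite /c -rmorphD (_ : 2^-1 + 2^-1 = 1); first by rewrite rmorph1.
  lra.
pose g r : A := c *: (h * h + r * r); pose w n := iter n g 0.
(* The radius is preserved because [1/2 (1/4 + 1/4) <= 1/2], and on this ball [g] has Lipschitz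
   constant [1/2 (1/2 + 1/2) = 1/2], which yields geometric steps. *)
have yn : cnorm (h * h) <= 2^-1 * 2^-1.
  by apply: le_trans (cnormM _ _) _; have := cnorm_ge0 h; nra.
have gn z : cnorm (c *: z) = 2^-1 * cnorm z.
  by rewrite cnormR ger0_norm // invr_ge0 ler0n.
have wS n : w n.+1 = g (w n) by [].
have wn n : cnorm (w n) <= 2^-1.
  elim: n => [|n IHn]; first by rewrite /w /= cnorm0 invr_ge0 ler0n.
  rewrite wS gn; have := cnormD (h * h) (w n * w n).
  by have := cnormM (w n) (w n); have := cnorm_ge0 (w n); nra.
have gB x y : g x - g y = c *: (x * (x - y) + (x - y) * y).
  by rewrite /g -scalerBr; congr (_ *: _); rewrite mulrBr mulrBl addrA subrK opprD addrACA subrr add0r.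
have gBn x y : cnorm (g x - g y) <= 2^-1 * ((cnorm x + cnorm y) * cnorm (x - y)).
  rewrite gB gn; have := cnormD (x * (x - y)) ((x - y) * y).
  by have := cnormM x (x - y); have := cnormM (x - y) y; nra.
have wB n : cnorm (w n.+1 - w n) <= 2^-1 ^+ n.
  elim: n => [|n IHn].
    by have := wn 1%N; rewrite expr0 [w 0%N]/(0) subr0; lra.
  rewrite [w n.+1]wS [w n.+2]wS; apply: le_trans (gBn _ _) _.
  rewrite exprS; have := cnorm_ge0 (w n.+1 - w n).
  by have := wn n; have := wn n.+1; nra.
have [x wx] := cnorm_geometric wB.
have close e : 0 < e -> exists N, cnorm (w N - x) < e /\ cnorm (w N.+1 - x) < e.
  by move=> /wx[N hN]; exists N; split; apply: hN.
have xh : x * h = h * x.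
  have wh n : w n * h = h * w n.
    elim: n => [|n IHn]; first by rewrite mul0r mulr0.
    by rewrite wS /g -scalerAl -scalerAr mulrDl mulrDr !mulrA -IHn -!mulrA IHn.
  apply/eqP; rewrite -subr_eq0; apply/eqP; apply: (@cnorm_small _ (2 * cnorm h)) => e /close[N [hN _]].
  have -> : x * h - h * x = h * (w N - x) - (w N - x) * h.
    by rewrite mulrBl mulrBr wh opprB [RHS]addrC addrA subrK.
  have := cnormD (h * (w N - x)) (- ((w N - x) * h)); rewrite cnormN.
  by have := cnormM h (w N - x); have := cnormM (w N - x) h; have := cnorm_ge0 h; nra.
have xs : star x = x.
  have ws n : star (w n) = w n.
    elim: n => [|n IHn]; first exact: star0.
    by rewrite wS /g starR starD !starM hs IHn.
  apply/eqP; rewrite -subr_eq0; apply/eqP; apply: (@cnorm_small _ 2) => e /close[N [hN _]].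
  have -> : star x - x = (w N - x) - star (w N - x).
    by rewrite starB ws opprB [RHS]addrC addrA subrK.
  by have := cnormD (w N - x) (- star (w N - x)); rewrite cnormN cnorm_starE; lra.
have xg : x = g x.
  apply/eqP; rewrite -subr_eq0; apply/eqP.
  apply: (@cnorm_small _ (1 + 2^-1 * (2^-1 + cnorm x))) => e /close[N [hN hN1]].
  have -> : x - g x = (g (w N) - g x) - (w N.+1 - x).
    by rewrite wS opprB [RHS]addrC addrA subrK.
  have := cnormD (g (w N) - g x) (- (w N.+1 - x)); rewrite cnormN.
  have := gBn (w N) x; have := wn N; have := cnorm_ge0 x; have := cnorm_ge0 (w N).
  by have := cnorm_ge0 (w N - x); nra.
have x2 : x + x = h * h + x * x.
  by rewrite {1 2}xg /g -scalerDl cc scale1r.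
exists (1 - x); split.
- by rewrite starB star1 xs.
- by rewrite mulrBl mulrBr mul1r mulr1 xh.
have -> : (1 - x) * (1 - x) = 1 - (x + x) + x * x.
  by rewrite mulrBl mul1r mulrBr mulr1 opprB opprD [x * x - x]addrC !addrA.
by rewrite x2 opprD addrA subrK.
Qed.

End CStarBasics.

(** * Automatic continuity of star-preserving morphisms *)

Section Morphism.
Variables (R : realType) (A B : cstarAlgType R) (f : {lrmorphism A -> B}).
Hypothesis fs : star_preserving f.

(* [h] is the real part of the unitary [h + i sqrt (1 - h^2)]. *)
Lemma morph_selfadjoint_small h : star h = h -> cnorm h <= 2^-1 -> cnorm (f h) <= 1.
Proof.
move=> hs hn; have [b [bs bh bb]] := selfadjoint_sqrt hs hn.
pose c : A := h + 'i%C *: b.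
have cs : star c = h - 'i%C *: b.
  rewrite /c starD hs starZ bs; congr (_ + _).
  by rewrite -scaleNr; congr (_ *: _); apply/eqP; rewrite eq_complex /= oppr0 !eqxx.
have cc : star c * c = 1.
  rewrite cs /c mulrBl !mulrDr -!scalerAl -!scalerAr scalerA bh.
  have -> : 'i%C * 'i%C = -1 :> R[i] by rewrite -expr2 sqr_i.
  by rewrite scaleN1r opprD opprK addrA addrK bb addrC subrK.
have fc : cnorm (f c) <= 1.
  have := cnorm_star (f c); rewrite -fs -rmorphM cc rmorph1 => e.
  by have := cnorm1_le B; have := cnorm_ge0 (f c); nra.
have e2 : f h + f h = f c + star (f c).
  rewrite -fs -!rmorphD /=; congr (f _).
  by rewrite cs /c addrACA subrr addr0.
have -> : f h = (2^-1)%:C%C *: (f h + f h).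
  rewrite scalerDr -scalerDl -rmorphD (_ : 2^-1 + 2^-1 = 1); last lra.
  by rewrite rmorph1 scale1r.
rewrite cnormR ger0_norm ?invr_ge0 ?ler0n // e2.
by have := cnormD (f c) (star (f c)); rewrite cnorm_starE; lra.
Qed.

(** Rescaling to norm [1/2] reduces to the previous bound; the factor 2 is the inverse of that
    radius. Continuity is what is sought, so the constant is not optimised. *)
Lemma morph_selfadjoint_bound h : star h = h -> cnorm (f h) <= 2 * cnorm h.
Proof.
move=> hs; have [/cnorm_eq0 -> |h0] := eqVneq (cnorm h) 0.
  by rewrite rmorph0 !cnorm0 mulr0.
have hp : 0 < cnorm h by rewrite lt_neqAle eq_sym h0 cnorm_ge0.
pose t := (2 * cnorm h)^-1; have t0 : 0 < t by rewrite invr_gt0 mulr_gt0.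
have := @morph_selfadjoint_small (t%:C%C *: h); rewrite starR hs cnormR gtr0_norm //.
rewrite linearZ cnormR gtr0_norm // => H.
have tn : t * cnorm h = 2^-1 by rewrite /t invfM mulfVK.
have := H erefl; rewrite tn lexx => /(_ isT).
rewrite -ler_pdivlMl // /t invrK mulr1; exact.
Qed.

Lemma morph_bound x : cnorm (f x) ^+ 2 <= 2 * cnorm x ^+ 2.
Proof.
rewrite -!cnorm_star -fs -rmorphM; apply: morph_selfadjoint_bound.
by rewrite starM starK.
Qed.

Lemma morph_continuous x e : 0 < e -> cnorm x < e / 2 -> cnorm (f x) < e.
Proof.
move=> e0 xe; have := morph_bound x; have := cnorm_ge0 x; have := cnorm_ge0 (f x).
by rewrite !expr2; nra.
Qed.

Lemma kernel_closed_ideal : closed_ideal (fun x => f x = 0).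
Proof.
split=> [x xcl||x y fx fy|a x fx|a x fx].
- apply: (@cnorm_small _ _ _ 1) => e e0; rewrite mul1r.
  have [|y fy xy] := xcl (e / 2); first by rewrite divr_gt0.
  have -> : f x = f (x - y) by rewrite rmorphB /= fy subr0.
  exact/ltW/morph_continuous.
- exact: rmorph0.
- by rewrite rmorphD /= fx fy addr0.
- by rewrite rmorphM /= fx mulr0.
- by rewrite rmorphM /= fx mul0r.
Qed.

Lemma preimage_closed_star_subalgebra (S : classical_sets.set B) :
  closed_star_subalgebra S -> closed_star_subalgebra (fun x : A => S (f x)).
Proof.
case=> Scl S1 Slin SM Ss; split=> [x xcl||a x y|x y|x].
- apply: Scl => e e0; have [|y Sy xy] := xcl (e / 2); first by rewrite divr_gt0.
  by exists (f y) => //; rewrite -rmorphB; apply: morph_continuous.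
- by rewrite rmorph1.
- by rewrite linearP; apply: Slin.
- by rewrite rmorphM; apply: SM.
- by rewrite fs; apply: Ss.
Qed.

End Morphism.

(** * Quotients and the universal property of half-liberations *)

Section Quotient.
Variables (R : realType) (A0 A : cstarAlgType R) (pi : {lrmorphism A0 -> A}).
Variable rels : classical_sets.set A0.
Hypothesis q : is_quotient pi rels.

(** The kernel of [f] is a closed ideal containing the relations, hence it contains the kernel of
    [pi]. So [f] is constant on the fibres of [pi], and [g] can be read off from chosen
    preimages. *)
Lemma quotient_factor (B : cstarAlgType R) (f : {lrmorphism A0 -> B}) :
  star_preserving f -> (forall x, rels x -> f x = 0) ->
  exists2 g : {lrmorphism A -> B}, star_preserving g & forall x, g (pi x) = f x.
Proof.
case: q => ps psurj pker fs frel.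
have kf x : pi x = 0 -> f x = 0.
  by move/pker => h; apply: (h _ (kernel_closed_ideal fs)) => y; apply: frel.
pose s a := projT1 (cid (psurj a)).
have sE a : pi (s a) = a by rewrite /s; case: cid.
have fE x y : pi x = pi y -> f x = f y.
  by move=> e; apply/eqP; rewrite -subr_eq0 -rmorphB /= kf // rmorphB /= e subrr.
pose g a := f (s a).
have gE x : g (pi x) = f x by apply: fE; rewrite sE.
have glin : linear g.
  by move=> a x y; rewrite -(sE x) -(sE y) -linearP !gE linearP.
have gmul : monoid_morphism g.
  split; first by rewrite -(rmorph1 pi) gE rmorph1.
  by move=> x y; rewrite -(sE x) -(sE y) -rmorphM !gE rmorphM.
pose gl := GRing.isLinear.Build R[i] A B _ g glin.
pose gm := GRing.isMonoidMorphism.Build A B g gmul.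
pose G : {lrmorphism A -> B} := HB.pack_for {lrmorphism A -> B} g gl gm.
exists G => //= x; rewrite -(sE x) -[LHS]/(g _) -ps !gE; exact: fs.
Qed.

(** By continuity of [pi], the preimage of a closed star-subalgebra is again one, so generation is
    tested in [A0]. *)
Lemma quotient_generates n (u0 : 'M[A0]_n) :
  generates u0 -> generates (map_mx pi u0).
Proof.
case: q => ps psurj _ gen S cS hS; apply/funext => a; apply/propext.
split=> // _; have [x <-] := psurj a.
have e : (fun x => S (pi x)) = classical_sets.setT.
  apply: gen => [|i j]; first exact: preimage_closed_star_subalgebra.
  by have := hS i j; rewrite mxE.
by have /= -> := congr1 (fun Z : classical_sets.set A0 => Z x) e.
Qed.

End Quotient.

Definition half_commuting (A : pzRingType) n (v : 'M[A]_n) : Prop :=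
  forall i j k l p q, v i j * v k l * v p q = v p q * v k l * v i j.

Section HalfLiberated.
Variables (R : realType) (n : nat) (rel : relation_family R n).
Hypothesis rel_image : forall (A B : cstarAlgType R) (f : {lrmorphism A -> B}) u,
  star_preserving f -> rel u -> rel (map_mx f u).
Variables (A : cstarAlgType R) (u : 'M[A]_n).
Hypothesis hu : half_liberated rel u.

Lemma half_liberated_half_commuting : half_commuting u.
Proof.
have [A0 [u0 [pi [_ [_ _ ker] ue]]]] := hu => i j k l p q.
apply/eqP; rewrite -subr_eq0 !ue -!rmorphM -rmorphB; apply/eqP/ker => I _.
by apply; exists i, j, k, l, p, q.
Qed.

Lemma half_liberated_map :
  exists (A0 : cstarAlgType R) (u0 : 'M[A0]_n) (pi : {lrmorphism A0 -> A}),
    [/\ universal rel u0, is_quotient pi (half_commutators u0) & u = map_mx pi u0].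
Proof.
have [A0 [u0 [pi [h1 h2 h3]]]] := hu; exists A0, u0, pi; split=> //.
by apply/matrixP=> i j; rewrite mxE.
Qed.

Lemma half_liberated_rel : rel u.
Proof.
have [A0 [u0 [pi [[r0 _ _] [ps _ _] ->]]]] := half_liberated_map.
exact: rel_image.
Qed.

Lemma half_liberated_generates : generates u.
Proof.
have [A0 [u0 [pi [[_ g _] qu ->]]]] := half_liberated_map.
exact: (quotient_generates qu g).
Qed.

Lemma half_liberated_universal (B : cstarAlgType R) (v : 'M[B]_n) :
  rel v -> half_commuting v ->
  exists2 f : {lrmorphism A -> B}, star_preserving f & forall i j, f (u i j) = v i j.
Proof.
have [A0 [u0 [pi [[_ _ univ] qu ->]]]] := half_liberated_map => rv hv.
have [f [fs fe]] := univ _ _ rv.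
have [|g gs ge] := quotient_factor qu fs.
  move=> _ [i [j [k [l [p [r ->]]]]]].
  by rewrite rmorphB !rmorphM /= !fe hv subrr.
by exists g => // i j; rewrite mxE ge fe.
Qed.

End HalfLiberated.

Section Complete.
Variable R : realType.

(** The limit is the lower limit of the sequence, taken as the supremum of its eventual lower
    bounds. *)
Lemma real_complete (w : nat -> R) :
  (forall e, 0 < e -> exists N, forall p q, (N <= p)%N -> (N <= q)%N ->
     `|w p - w q| < e) ->
  exists x, forall e, 0 < e -> exists N, forall p, (N <= p)%N -> `|w p - x| < e.
Proof.
move=> cw; pose S : classical_sets.set R :=
  fun t => exists N, forall p, (N <= p)%N -> t <= w p.
have key e : 0 < e -> exists N, [/\ S (w N - e),
    (forall t, S t -> t <= w N + e) & forall p, (N <= p)%N -> `|w p - w N| < e].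
  move=> /cw[N hN]; exists N; split; last by move=> p Np; apply: hN.
    exists N => p Np; have := hN _ _ Np (leqnn N).
    by rewrite ltr_norml; lra.
  move=> t [M hM]; have := hN _ _ (leq_maxl N M) (leqnn N).
  by have := hM _ (leq_maxr N M); rewrite ltr_norml; lra.
have Sub N e : (forall t, S t -> t <= w N + e) -> has_ubound S.
  by move=> h; exists (w N + e).
exists (sup S) => e e0; have [|N [SN ub hN]] := key (e / 2); first by rewrite divr_gt0.
exists N => p /hN; have := ub_le_sup (Sub _ _ ub) SN.
have : sup S <= w N + e / 2 by apply: ge_sup; [exists (w N - e / 2)|].
by rewrite !ltr_norml; lra.
Qed.

Definition cmod (z : R[i]) : R := complex.Re `|z|.

Lemma cmodE z : cmod z = Num.sqrt (complex.Re z ^+ 2 + complex.Im z ^+ 2).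
Proof. by rewrite /cmod normc_def. Qed.

Lemma cmod0 : cmod 0 = 0. Proof. by rewrite /cmod normr0. Qed.
Lemma cmod1 : cmod 1 = 1. Proof. by rewrite /cmod normr1. Qed.

Lemma cmodM x y : cmod (x * y) = cmod x * cmod y.
Proof.
by rewrite /cmod normrM !normc_def /= !mulr0 subr0.
Qed.

Lemma cmodD x y : cmod (x + y) <= cmod x + cmod y.
Proof. by have := ler_normD x y; rewrite lecE => /andP[_]; rewrite /cmod raddfD. Qed.

Lemma cmod_ge0 x : 0 <= cmod x. Proof. by rewrite cmodE sqrtr_ge0. Qed.

Lemma cmod_conj x : cmod (Num.conj x) = cmod x.
Proof. by rewrite /cmod norm_conjC. Qed.

Lemma cmod_eq0 x : cmod x = 0 -> x = 0.
Proof.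
move=> e; apply/eqP; rewrite -normr_eq0 eq_complex; move: e; rewrite /cmod normc_def /= => ->.
by rewrite !eqxx.
Qed.

Lemma cmod_sqr x : cmod x ^+ 2 = complex.Re x ^+ 2 + complex.Im x ^+ 2.
Proof. by rewrite cmodE sqr_sqrtr // addr_ge0 // sqr_ge0. Qed.

Lemma Re_le_cmod x : `|complex.Re x| <= cmod x.
Proof.
rewrite -[leLHS]sqrtr_sqr cmodE ler_sqrt ?addr_ge0 ?sqr_ge0 //.
by rewrite lerDl sqr_ge0.
Qed.

Lemma Im_le_cmod x : `|complex.Im x| <= cmod x.
Proof.
rewrite -[leLHS]sqrtr_sqr cmodE ler_sqrt ?addr_ge0 ?sqr_ge0 //.
by rewrite lerDr sqr_ge0.
Qed.

Lemma cmod_le x : cmod x <= `|complex.Re x| + `|complex.Im x|.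
Proof.
rewrite -(ler_pXn2r (n := 2)) ?nnegrE ?cmod_ge0 ?addr_ge0 ?normr_ge0 //.
rewrite cmod_sqr sqrrD !real_normK ?num_real //.
by rewrite addrAC lerDl mulrn_wge0 // mulr_ge0 ?normr_ge0.
Qed.

Lemma complex_complete (w : nat -> R[i]) :
  (forall e, 0 < e -> exists N, forall p q, (N <= p)%N -> (N <= q)%N ->
     cmod (w p - w q) < e) ->
  exists x, forall e, 0 < e -> exists N, forall p, (N <= p)%N -> cmod (w p - x) < e.
Proof.
move=> cw; have [a ha] : exists x, forall e, 0 < e -> exists N, forall p, (N <= p)%N ->
    `|complex.Re (w p) - x| < e.
  apply: real_complete => e /cw[N hN]; exists N => p q Np Nq.
  rewrite -raddfB; apply: le_lt_trans (hN _ _ Np Nq); exact: Re_le_cmod.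
have [b hb] : exists x, forall e, 0 < e -> exists N, forall p, (N <= p)%N ->
    `|complex.Im (w p) - x| < e.
  apply: real_complete => e /cw[N hN]; exists N => p q Np Nq.
  rewrite -raddfB; apply: le_lt_trans (hN _ _ Np Nq); exact: Im_le_cmod.
exists (a +i* b)%C => e e0; have e2 : 0 < e / 2 by rewrite divr_gt0.
have [N hN] := ha _ e2; have [M hM] := hb _ e2; exists (maxn N M) => p.
rewrite geq_max => /andP[/hN h1 /hM h2]; apply: le_lt_trans (cmod_le _) _.
by rewrite !raddfB /=; lra.
Qed.

End Complete.

Section Scalars.
Variable R : realType.
Let C := R[i]^o.

Let sD (x y : C) : Num.conj (x + y : R[i]) = Num.conj (x : R[i]) + Num.conj (y : R[i]) :> C.
Proof. exact: rmorphD. Qed.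
Let sZ (a : R[i]) (x : C) : Num.conj (a *: x : R[i]) = Num.conj a *: (Num.conj (x : R[i]) : C) :> C.
Proof. exact: rmorphM. Qed.
Let sM (x y : C) : Num.conj (x * y : R[i]) = Num.conj (y : R[i]) * Num.conj (x : R[i]) :> C.
Proof. by rewrite mulrC; apply: rmorphM. Qed.
Let sK : involutive (Num.conj : C -> C). Proof. exact: conjCK. Qed.
Let nZ (a : R[i]) (x : C) : cmod (a *: x : R[i]) = complex.Re `|a| * cmod (x : R[i]).
Proof. exact: cmodM. Qed.
Let nM (x y : C) : cmod (x * y : R[i]) <= cmod (x : R[i]) * cmod (y : R[i]).
Proof. by rewrite cmodM. Qed.
Let nS (x : C) : cmod (Num.conj (x : R[i]) * x : R[i]) = cmod (x : R[i]) ^+ 2.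
Proof. by rewrite cmodM cmod_conj expr2. Qed.

(** With the scalars as a target algebra, the counit and the evaluations at permutations become
    instances of the universal property. *)
HB.instance Definition _ := isCStarAlgebra.Build R R[i]^o
  sD sZ sM sK (@cmod_eq0 R) (@cmodD R) nZ nM nS (@complex_complete R).

End Scalars.

Section Opposite.
Variables (R : realType).

(** The antipode reverses products, so it is a morphism into this copy of [A], where the universal
    property applies. Star, norm and linear structure are those of [A]; only the multiplication is
    reversed. *)
Definition opposite (A : Type) : Type := A.

Section Structure.
Variable A : cstarAlgType R.
HB.instance Definition _ := GRing.Lmodule.on (opposite A).
Let mul (x y : opposite A) : opposite A := (y : A) * (x : A).
Let mA : associative mul. Proof. by move=> x y z; rewrite /mul mulrA. Qed.
Let m1 : left_id (1 : A) mul. Proof. by move=> x; rewrite /mul mulr1. Qed.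
Let m1r : right_id (1 : A) mul. Proof. by move=> x; rewrite /mul mul1r. Qed.
Let mDl : left_distributive mul +%R. Proof. by move=> x y z; rewrite /mul mulrDr. Qed.
Let mDr : right_distributive mul +%R. Proof. by move=> x y z; rewrite /mul mulrDl. Qed.
Let n10 : (1 : A) != 0 :> opposite A. Proof. exact: oner_neq0. Qed.
HB.instance Definition _ := GRing.Zmodule_isNzRing.Build (opposite A) mA m1 m1r mDl mDr n10.
Let sAl (a : R[i]) (x y : opposite A) : a *: mul x y = mul (a *: x) y.
Proof. exact: (@scalerAr _ A a y x). Qed.
HB.instance Definition _ := GRing.Lmodule_isLalgebra.Build R[i] (opposite A) sAl.
Let sAr (a : R[i]) (x y : opposite A) : a *: mul x y = mul x (a *: y).
Proof. exact: (@scalerAl _ A a y x). Qed.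
HB.instance Definition _ := GRing.Lalgebra_isAlgebra.Build R[i] (opposite A) sAr.
HB.instance Definition _ := isCStarAlgebra.Build R (opposite A)
  (@starD R A) (@starZ R A) (fun x y => @starM R A y x) (@starK R A) (@cnorm_eq0 R A)
  (@cnormD R A) (@cnormZ R A)
  (fun x y => eq_ind_r (fun t => _ <= t) (@cnormM R A y x) (mulrC _ _))
  (fun x => etrans (eq_ind_r (fun t => cnorm (t * _) = _) (@cnorm_star R A (star x)) (esym (starK x))) (congr1 (fun t => t ^+ 2) (cnorm_starE x)))
  (@cnorm_complete R A).
End Structure.
End Opposite.

(** * The C*-algebra of square matrices *)

Section OperatorNorm.
Variables (R : realType) (n : nat).
Local Notation C := R[i].
Local Notation M := 'M[C]_n.+1.
Local Notation V := 'cV[C]_n.+1.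
Implicit Types (a b : M) (x y : V).

(** Only the real part of the Hermitian product is kept: it gives the same norm, and the
    Cauchy-Schwarz inequality for it involves no phase factor. *)
Definition ip x y : R := complex.Re ((adjmx y *m x) 0 0).

Lemma Re_conj (z : C) : complex.Re (Num.conj z) = complex.Re z.
Proof. by case: z. Qed.

Lemma ip_sym x y : ip x y = ip y x.
Proof.
rewrite /ip -[in LHS](adjmxK (adjmx y *m x)) adjmxM adjmxK.
by rewrite [in LHS]/adjmx 2![in LHS]mxE Re_conj.
Qed.

Lemma ipDl x y z : ip (x + y) z = ip x z + ip y z.
Proof. by rewrite /ip mulmxDr mxE raddfD. Qed.

Lemma ipDr x y z : ip z (x + y) = ip z x + ip z y.
Proof. by rewrite !(ip_sym z) ipDl. Qed.

Lemma ipZl (r : R) x y : ip (r%:C%C *: x) y = r * ip x y.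
Proof.
rewrite /ip -scalemxAr mxE; case: ((adjmx y *m x) 0 0) => u v /=.
by rewrite mul0r subr0.
Qed.

Lemma ipZr (r : R) x y : ip x (r%:C%C *: y) = r * ip x y.
Proof. by rewrite !(ip_sym x) ipZl. Qed.

Lemma ip_adj a x y : ip (a *m x) y = ip x (adjmx a *m y).
Proof. by rewrite /ip adjmxM adjmxK mulmxA. Qed.

Lemma nsqE x : ip x x = \sum_i cmod (x i 0) ^+ 2.
Proof.
rewrite /ip mxE raddf_sum; apply: eq_bigr => i _; rewrite !mxE cmod_sqr.
by case: (x i 0) => u v /=; rewrite mulNr opprK !expr2.
Qed.

Lemma nsq_ge0 x : 0 <= ip x x.
Proof. by rewrite nsqE; apply: sumr_ge0 => i _; rewrite exprn_ge0 // cmod_ge0. Qed.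

Lemma nsq_eq0 x : ip x x = 0 -> x = 0.
Proof.
rewrite nsqE => e; apply/colP=> i; rewrite mxE; apply: cmod_eq0; apply/eqP.
rewrite -sqrf_eq0; move/eqP: e; rewrite psumr_eq0; last first.
  by move=> j _; rewrite exprn_ge0 // cmod_ge0.
by move/allP/(_ i); rewrite mem_index_enum => /(_ isT).
Qed.

Definition hn x : R := Num.sqrt (ip x x).

Lemma hn_sqr x : hn x ^+ 2 = ip x x. Proof. by rewrite sqr_sqrtr // nsq_ge0. Qed.
Lemma hn_ge0 x : 0 <= hn x. Proof. exact: sqrtr_ge0. Qed.

Lemma hn_eq0 x : hn x = 0 -> x = 0.
Proof. by move=> e; apply: nsq_eq0; rewrite -hn_sqr e expr0n. Qed.

Lemma hn0 : hn 0 = 0.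
Proof. by rewrite /hn nsqE big1 ?sqrtr0 // => i _; rewrite mxE cmod0 expr0n. Qed.

Lemma cauchy_schwarz x y : ip x y <= hn x * hn y.
Proof.
have [e|ny] := eqVneq (hn y) 0.
  rewrite (hn_eq0 e) hn0 mulr0 -(scale0r 0) -[0 in leLHS]/((0 : R)%:C%C).
  by rewrite ipZr mul0r.
have y0 : 0 < hn y by rewrite lt_neqAle eq_sym ny hn_ge0.
(* The coefficient of the orthogonal projection of [x] on [y]; the inequality says that the residual
   has nonnegative square norm. *)
pose t := ip x y / hn y ^+ 2.
have := nsq_ge0 (x + (- t)%:C%C *: y).
rewrite !ipDl !ipDr !ipZl !ipZr (ip_sym y x) -!hn_sqr.
have tE : t * hn y ^+ 2 = ip x y by rewrite /t divfK // sqrf_eq0.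
have x0 := hn_ge0 x; rewrite -tE => h.
have t2 : (t * hn y) ^+ 2 <= hn x ^+ 2 by rewrite exprMn; nra.
have tx : t * hn y <= hn x.
  by apply: contraTT t2; rewrite -!ltNge => lt; rewrite ltr_pXn2r // nnegrE; lra.
by rewrite expr2 mulrA ler_pM2r.
Qed.

Lemma hnD x y : hn (x + y) <= hn x + hn y.
Proof.
rewrite -(ler_pXn2r (n := 2)) ?nnegrE ?addr_ge0 ?hn_ge0 //.
rewrite hn_sqr !ipDl !ipDr (ip_sym y x) sqrrD !hn_sqr.
by have := cauchy_schwarz x y; rewrite mulr2n; lra.
Qed.

Lemma hnZ (c : C) x : hn (c *: x) = cmod c * hn x.
Proof.
apply/eqP; rewrite -(eqrXn2 (n := 2)) ?mulr_ge0 ?cmod_ge0 ?hn_ge0 //.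
rewrite exprMn !hn_sqr !nsqE big_distrr /=; apply/eqP/eq_bigr => i _.
by rewrite mxE cmodM exprMn.
Qed.

Lemma hn_sum (I : Type) (r : seq I) (F : I -> V) :
  hn (\sum_(i <- r) F i) <= \sum_(i <- r) hn (F i).
Proof.
elim: r => [|i r IHr]; first by rewrite !big_nil hn0.
by rewrite !big_cons; apply: le_trans (hnD _ _) _; rewrite lerD2l.
Qed.

Lemma hn_delta i j x : hn (delta_mx i j *m x) <= cmod (x j 0).
Proof.
rewrite -(ler_pXn2r (n := 2)) ?nnegrE ?cmod_ge0 ?hn_ge0 // hn_sqr nsqE.
rewrite (bigD1 i) //= big1 => [|k ki].
  rewrite addr0 mxE (bigD1 j) //= big1 => [|l lj]; rewrite !mxE ?eqxx ?mul1r ?addr0 //.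
  by rewrite (negPf lj) andbF mul0r.
rewrite mxE big1 ?cmod0 ?expr0n // => l _.
by rewrite mxE (negPf ki) mul0r.
Qed.

Lemma cmod_hn x j : cmod (x j 0) <= hn x.
Proof.
rewrite -(ler_pXn2r (n := 2)) ?nnegrE ?cmod_ge0 ?hn_ge0 // hn_sqr nsqE (bigD1 j) //=.
by rewrite lerDl; apply: sumr_ge0 => i _; rewrite exprn_ge0 // cmod_ge0.
Qed.

Lemma hn_bound a x : hn (a *m x) <= (\sum_i \sum_j cmod (a i j)) * hn x.
Proof.
rewrite {1}(matrix_sum_delta a) mulmx_suml; apply: le_trans (hn_sum _ _) _.
rewrite mulr_suml; apply: ler_sum => i _; rewrite mulmx_suml.
apply: le_trans (hn_sum _ _) _; rewrite mulr_suml; apply: ler_sum => j _.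
rewrite -scalemxAl hnZ; apply: ler_wpM2l; first exact: cmod_ge0.
exact: le_trans (hn_delta _ _ _) (cmod_hn _ _).
Qed.

(** The operator norm is an infimum of admissible constants, so that upper bounds follow directly
    from pointwise estimates. The sum of the moduli of the entries shows that the set is
    inhabited. *)
Definition opset a : classical_sets.set R :=
  fun c => 0 <= c /\ forall x, hn (a *m x) <= c * hn x.
Definition opnorm a : R := inf (opset a).

Lemma opset_lbound a : has_lbound (opset a).
Proof. by exists 0 => c []. Qed.

Lemma opnorm_le a c : 0 <= c -> (forall x, hn (a *m x) <= c * hn x) -> opnorm a <= c.
Proof. by move=> c0 h; apply: (ge_inf (opset_lbound a)). Qed.

Lemma opset_entries a : opset a (\sum_i \sum_j cmod (a i j)).
Proof.
split; last exact: hn_bound.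
by apply: sumr_ge0 => i _; apply: sumr_ge0 => j _; apply: cmod_ge0.
Qed.

Lemma opnorm_ge0 a : 0 <= opnorm a.
Proof. by apply: lb_le_inf => [|c []//]; eexists; apply: opset_entries. Qed.

Lemma opnormP a x : hn (a *m x) <= opnorm a * hn x.
Proof.
have [e|nx] := eqVneq (hn x) 0; first by rewrite (hn_eq0 e) mulmx0 hn0 mulr0.
have x0 : 0 < hn x by rewrite lt_neqAle eq_sym nx hn_ge0.
rewrite -ler_pdivrMr //; apply: lb_le_inf => [|c [_ hc]].
  by eexists; apply: opset_entries.
by rewrite ler_pdivrMr.
Qed.

Lemma opnorm_entry a i j : cmod (a i j) <= opnorm a.
Proof.
have := opnormP a (delta_mx j 0); have -> : hn (delta_mx j 0) = 1.
  rewrite /hn nsqE (bigD1 j) //= big1 => [|k kj].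
    by rewrite mxE !eqxx cmod1 expr1n addr0 sqrtr1.
  by rewrite mxE (negPf kj) cmod0 expr0n.
rewrite mulr1; apply: le_trans; apply: le_trans (cmod_hn _ i).
by rewrite -colE mxE.
Qed.

Lemma opnorm_entries a : opnorm a <= \sum_i \sum_j cmod (a i j).
Proof. by have [h1 h2] := opset_entries a; apply: opnorm_le. Qed.

Lemma opnorm_eq0 a : opnorm a = 0 -> a = 0.
Proof.
move=> e; apply/matrixP=> i j; rewrite mxE; apply: cmod_eq0; apply/eqP.
by rewrite eq_le cmod_ge0 andbT -e opnorm_entry.
Qed.

Lemma opnormD a b : opnorm (a + b) <= opnorm a + opnorm b.
Proof.
apply: opnorm_le => [|x]; first by rewrite addr_ge0 ?opnorm_ge0.
rewrite mulmxDl mulrDl; apply: le_trans (hnD _ _) _.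
by apply: lerD; apply: opnormP.
Qed.

Lemma opnormM a b : opnorm (a *m b) <= opnorm a * opnorm b.
Proof.
apply: opnorm_le => [|x]; first by rewrite mulr_ge0 ?opnorm_ge0.
rewrite -mulmxA; apply: le_trans (opnormP _ _) _; rewrite -mulrA.
by apply: ler_wpM2l; rewrite ?opnorm_ge0 ?opnormP.
Qed.

Lemma opnormZ_le (c : C) a : opnorm (c *: a) <= cmod c * opnorm a.
Proof.
apply: opnorm_le => [|x]; first by rewrite mulr_ge0 ?opnorm_ge0 ?cmod_ge0.
rewrite -scalemxAl hnZ -mulrA; apply: ler_wpM2l; rewrite ?cmod_ge0 //.
exact: opnormP.
Qed.

Lemma opnormZ (c : C) a : opnorm (c *: a) = complex.Re `|c| * opnorm a.
Proof.
apply/eqP; rewrite eq_le; apply/andP; split; first exact: opnormZ_le.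
have [->|c0] := eqVneq c 0; first by rewrite normr0 mul0r opnorm_ge0.
have cp : 0 < cmod c.
  rewrite lt_neqAle cmod_ge0 andbT; apply: contraNneq c0 => e.
  by apply/eqP/cmod_eq0.
have := opnormZ_le c^-1 (c *: a); rewrite scalerA mulVf // scale1r.
have -> : cmod c^-1 = (cmod c)^-1.
  apply: (mulIf (lt0r_neq0 cp)).
  rewrite mulVf ?gt_eqF // -cmodM mulVf //.
  by rewrite cmod1.
by rewrite ler_pdivlMl.
Qed.

(** With [y] the image of [x] under the adjoint, the square norm of [y] is the product of [a y] with
    [x], at most [|a| |y| |x|]; then divide by [|y|]. *)
Lemma opnorm_adj_le a : opnorm (adjmx a) <= opnorm a.
Proof.
apply: opnorm_le => [|x]; first exact: opnorm_ge0.
have [->|ny] := eqVneq (hn (adjmx a *m x)) 0.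
  by rewrite mulr_ge0 ?opnorm_ge0 ?hn_ge0.
have y0 : 0 < hn (adjmx a *m x) by rewrite lt_neqAle eq_sym ny hn_ge0.
rewrite -(ler_pM2r y0) -expr2 hn_sqr -ip_adj.
apply: le_trans (cauchy_schwarz _ _) _.
have := opnormP a (adjmx a *m x); have := hn_ge0 x; nra.
Qed.

Lemma opnorm_star a : opnorm (adjmx a *m a) = opnorm a ^+ 2.
Proof.
apply/eqP; rewrite eq_le; apply/andP; split.
  apply: le_trans (opnormM _ _) _; rewrite expr2.
  by apply: ler_wpM2r; rewrite ?opnorm_ge0 ?opnorm_adj_le.
set K := opnorm (adjmx a *m a); have K0 : 0 <= K by apply: opnorm_ge0.
have : opnorm a <= Num.sqrt K.
  apply: opnorm_le => [|x]; first exact: sqrtr_ge0.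
  rewrite -(ler_pXn2r (n := 2)) ?nnegrE ?mulr_ge0 ?sqrtr_ge0 ?hn_ge0 //.
  rewrite exprMn (sqr_sqrtr K0) hn_sqr -[X in ip _ (X *m _)]adjmxK -ip_adj mulmxA.
  apply: le_trans (cauchy_schwarz _ _) _; rewrite expr2 mulrA.
  apply: ler_wpM2r; first exact: hn_ge0.
  exact: opnormP.
rewrite -(ler_pXn2r (n := 2)) ?nnegrE ?opnorm_ge0 ?sqrtr_ge0 //.
by rewrite sqr_sqrtr.
Qed.

(** The norm dominates each entry and is dominated by the sum of their moduli, so the limit is taken
    entry by entry. The tolerance [d] is [e] divided by twice the number of entries, which makes the
    final bound strict. *)
Lemma opnorm_complete (w : nat -> M) :
  (forall e, 0 < e -> exists N, forall p q, (N <= p)%N -> (N <= q)%N ->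
     opnorm (w p - w q) < e) ->
  exists a, forall e, 0 < e -> exists N, forall p, (N <= p)%N -> opnorm (w p - a) < e.
Proof.
move=> cw; have h i j : exists z : C, forall e, 0 < e -> exists N, forall p, (N <= p)%N ->
    cmod (w p i j - z) < e.
  apply: complex_complete => e /cw[N hN]; exists N => p q Np Nq.
  by apply: le_lt_trans (hN _ _ Np Nq); have := opnorm_entry (w p - w q) i j; rewrite !mxE.
exists (\matrix_(i, j) projT1 (cid (h i j))) => e e0.
pose d := e / (2 * (n.+1 * n.+1)%:R); have d0 : 0 < d.
  by rewrite divr_gt0 // mulr_gt0 // ltr0n.
have hN i j : exists N, forall p, (N <= p)%N -> cmod (w p i j - projT1 (cid (h i j))) < d.
  by case: (cid (h i j)) => z hz /=; apply: hz.
exists (\max_i \max_j projT1 (cid (hN i j))) => p hp.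
apply: le_lt_trans (opnorm_entries _) _.
apply: (@le_lt_trans _ _ (\sum_(i < n.+1) \sum_(j < n.+1) d)).
  apply: ler_sum => i _; apply: ler_sum => j _; rewrite !mxE.
  move: (leq_trans (leq_trans (leq_bigmax j) (@leq_bigmax _ (fun i => \max_j projT1 (cid (hN i j))) i)) hp).
  by case: (cid (hN i j)) => N hN' /= /hN' /ltW.
rewrite !sumr_const !card_ord -mulrnA -mulr_natr /d.
rewrite -mulrA invfM -mulrA mulVf ?pnatr_eq0 //; lra.
Qed.

HB.instance Definition _ := isCStarAlgebra.Build R M
  (@adjmxD _ n.+1 n.+1) (@adjmxZ _ n.+1 n.+1) (@adjmxM _ n.+1 n.+1 n.+1)
  (@adjmxK _ n.+1 n.+1) opnorm_eq0 opnormD opnormZ opnormM opnorm_star opnorm_complete.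

End OperatorNorm.

(** * The quantum group structure *)

Section Coproduct.
Variables (R : realType) (A T : cstarAlgType R) (n : nat) (u : 'M[A]_n).
Variables (i1 i2 : {lrmorphism A -> T}).
Hypotheses (s1 : star_preserving i1) (s2 : star_preserving i2).
Hypothesis comm : forall a b, i1 a * i2 b = i2 b * i1 a.

Definition coproduct : 'M[T]_n := \matrix_(i, j) \sum_k i1 (u i k) * i2 (u k j).

Lemma coproduct_mul i j k l : coproduct i j * coproduct k l =
  \sum_a \sum_b i1 (u i a * u k b) * i2 (u a j * u b l).
Proof.
rewrite !mxE mulr_suml; apply: eq_bigr => a _; rewrite mulr_sumr.
apply: eq_bigr => b _; rewrite !rmorphM -!mulrA; congr (_ * _).
by rewrite !mulrA comm.
Qed.

(** A triple product splits into triple products in the two legs. Reversing both amounts to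
    exchanging the outer summation indices [a] and [c]. *)
Lemma coproduct_half_commuting : half_commuting u -> half_commuting coproduct.
Proof.
move=> hu; have E i j k l p q : coproduct i j * coproduct k l * coproduct p q =
    \sum_a \sum_b \sum_c i1 (u i a * u k b * u p c) * i2 (u a j * u b l * u c q).
  rewrite coproduct_mul mxE mulr_suml; apply: eq_bigr => a _; rewrite mulr_suml.
  apply: eq_bigr => b _; rewrite mulr_sumr; apply: eq_bigr => c _.
  rewrite [i1 (_ * u p c)]rmorphM [i2 (_ * u c q)]rmorphM -!mulrA; congr (_ * _).
  by rewrite !mulrA comm.
move=> i j k l p q; rewrite !E exchange_big /= [RHS]exchange_big /=.
apply: eq_bigr => b _; rewrite exchange_big /=; apply: eq_bigr => c _.
by apply: eq_bigr => a _; rewrite hu [X in i2 X]hu.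
Qed.

Lemma coproduct_O : rel_O u -> rel_O coproduct.
Proof.
case=> us ur uc; split=> [i j|i j|i j].
- rewrite !mxE star_sum; apply: eq_bigr => k _.
  by rewrite starM -s1 -s2 !us comm.
- under eq_bigr => k _ do rewrite coproduct_mul.
  rewrite exchange_big /=.
  under eq_bigr => a _.
    rewrite exchange_big /=.
    under eq_bigr => b _ do rewrite -mulr_sumr -rmorph_sum /= ur.
    rewrite (bigD1 a) //= eqxx rmorph1 mulr1 big1 ?addr0 => [|b ba]; last first.
      by rewrite eq_sym (negPf ba) rmorph0 mulr0.
    over.
  by rewrite -rmorph_sum /= ur rmorph_nat.
- under eq_bigr => k _ do rewrite coproduct_mul.
  rewrite exchange_big /=.
  under eq_bigr => a _.
    rewrite exchange_big /=.
    under eq_bigr => b _ do rewrite -mulr_suml -rmorph_sum /= uc.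
    rewrite (bigD1 a) //= eqxx rmorph1 mul1r big1 ?addr0 => [|b ba]; last first.
      by rewrite eq_sym (negPf ba) rmorph0 mul0r.
    over.
  by rewrite -rmorph_sum /= uc rmorph_nat.
Qed.

Lemma coproduct_H : rel_H u -> rel_H coproduct.
Proof.
case=> uO uH; split=> [|i j k ij]; first exact: coproduct_O.
rewrite !coproduct_mul; split; rewrite big1 // => a _; rewrite big1 // => b _.
  have [<-|ab] := eqVneq a b; first by rewrite (uH _ _ a ij).1 rmorph0 mul0r.
  by rewrite (uH _ _ k ab).1 rmorph0 mulr0.
have [<-|ab] := eqVneq a b; first by rewrite (uH _ _ a ij).2 rmorph0 mulr0.
by rewrite (uH _ _ k ab).2 rmorph0 mul0r.
Qed.

(** All row and column sums of [u] coincide, so each row or column sum of the coproduct factors into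
    the common sums of the two legs. *)
Lemma coproduct_Bsharp : rel_Bsharp u -> rel_Bsharp coproduct.
Proof.
case=> uO uB; split=> [|i j]; first exact: coproduct_O.
have -> : \sum_k coproduct i k = i1 (\sum_k u i k) * i2 (\sum_k u k j).
  under eq_bigr do rewrite mxE; rewrite exchange_big rmorph_sum mulr_suml.
  by apply: eq_bigr => a _; rewrite -mulr_sumr -rmorph_sum /= (uB a j).
have -> : \sum_k coproduct k j = i1 (\sum_k u i k) * i2 (\sum_k u k j).
  under eq_bigr do rewrite mxE; rewrite exchange_big [i2 _]rmorph_sum mulr_sumr.
  by apply: eq_bigr => a _; rewrite -mulr_suml -rmorph_sum /= -(uB i a).
by [].
Qed.

End Coproduct.

Section Image.
Variables (R : realType) (A B : cstarAlgType R) (n : nat) (f : {lrmorphism A -> B}).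
Variable u : 'M[A]_n.
Hypothesis fs : star_preserving f.

Lemma image_O : rel_O u -> rel_O (map_mx f u).
Proof.
case=> us ur uc; split=> i j; first by rewrite !mxE -fs us.
  rewrite -(rmorph_nat f) -ur rmorph_sum; apply: eq_bigr => k _.
  by rewrite !mxE -rmorphM.
rewrite -(rmorph_nat f) -uc rmorph_sum; apply: eq_bigr => k _.
by rewrite !mxE -rmorphM.
Qed.

Lemma image_H : rel_H u -> rel_H (map_mx f u).
Proof.
case=> uO uH; split=> [|i j k ij]; first exact: image_O.
by rewrite !mxE -!rmorphM /= (uH _ _ k ij).1 (uH _ _ k ij).2 rmorph0.
Qed.

Lemma image_Bsharp : rel_Bsharp u -> rel_Bsharp (map_mx f u).
Proof.
case=> uO uB; split=> [|i j]; first exact: image_O.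
under eq_bigr do rewrite mxE; under [RHS]eq_bigr do rewrite mxE.
by rewrite -!rmorph_sum /= (uB i j).
Qed.

End Image.

Section Transpose.
Variables (R : realType) (A : cstarAlgType R) (n : nat) (u : 'M[A]_n).

Definition transpose : 'M[opposite A]_n := \matrix_(i, j) (u j i : opposite A).

Lemma transpose_O : rel_O u -> rel_O transpose.
Proof.
case=> us ur uc; split=> i j; first by rewrite !mxE; apply: us.
  rewrite eq_sym; apply: etrans (uc j i); apply: eq_bigr => k _.
  by rewrite !mxE.
rewrite eq_sym; apply: etrans (ur j i); apply: eq_bigr => k _.
by rewrite !mxE.
Qed.

Lemma transpose_H : rel_H u -> rel_H transpose.
Proof.
case=> uO uH; split=> [|i j k ij]; first exact: transpose_O.
by rewrite eq_sym in ij; have [h1 h2] := uH _ _ k ij; rewrite !mxE; split.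
Qed.

Lemma transpose_Bsharp : rel_Bsharp u -> rel_Bsharp transpose.
Proof.
case=> uO uB; split=> [|i j]; first exact: transpose_O.
transitivity (\sum_k (u k i : opposite A)); first by apply: eq_bigr => k _; rewrite mxE.
apply: etrans (esym (uB j i)) _.
by apply: eq_bigr => k _; rewrite mxE.
Qed.

Lemma transpose_half_commuting : half_commuting u -> half_commuting transpose.
Proof.
move=> hu i j k l p q; rewrite !mxE.
have h := hu q p l k j i; rewrite -!mulrA in h; exact: h.
Qed.

End Transpose.

Section Permutation.
Variables (R : realType) (n : nat) (s : 'S_n).

Definition perm_matrix : 'M[R[i]^o]_n := \matrix_(i, j) (i == s j)%:R.

Lemma perm_matrix_O : rel_O perm_matrix.
Proof.
split=> i j; first by rewrite mxE; apply: rmorph_nat.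
  rewrite (bigD1 (s^-1%g i)) //= !mxE permKV eqxx mul1r big1 ?addr0 ?[j == i]eq_sym // => k ki.
  by rewrite !mxE; case: eqP => [e|]; rewrite ?mul0r //; rewrite e permK eqxx in ki.
rewrite (bigD1 (s i)) //= !mxE eqxx mul1r big1 ?addr0 ?(inj_eq perm_inj) // => k ki.
by rewrite !mxE (negPf ki) mul0r.
Qed.

Lemma perm_matrix_H : rel_H perm_matrix.
Proof.
split=> [|i j k ij]; first exact: perm_matrix_O.
rewrite !mxE; split.
  by case: (eqVneq i) => [e|]; rewrite ?mul0r // -e [j == i]eq_sym (negPf ij) mulr0.
case: (eqVneq k) => [->|]; rewrite ?mul0r // (inj_eq perm_inj) (negPf ij).
by rewrite mulr0.
Qed.

Lemma perm_matrix_Bsharp : rel_Bsharp perm_matrix.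
Proof.
split=> [|i j]; first exact: perm_matrix_O.
rewrite (bigD1 (s^-1%g i)) //= mxE permKV eqxx big1 ?addr0 => [|k ki].
  rewrite (bigD1 (s j)) //= mxE eqxx big1 ?addr0 // => k kj.
  by rewrite mxE (negPf kj).
by rewrite mxE; case: eqP => // e; rewrite e permK eqxx in ki.
Qed.

Lemma perm_matrix_half_commuting : half_commuting perm_matrix.
Proof.
move=> i j k l p q; have e (a b c : R[i]) : a * b * c = c * b * a.
  by rewrite mulrC (mulrC a) mulrA.
exact: e.
Qed.

End Permutation.

Section QuantumGroup.
Variables (R : realType) (n : nat) (rel : relation_family R n).
Hypothesis rel_orth : forall (A : cstarAlgType R) (u : 'M[A]_n), rel u -> rel_O u.
Hypothesis rel_image : forall (A B : cstarAlgType R) (f : {lrmorphism A -> B}) u,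
  star_preserving f -> rel u -> rel (map_mx f u).
Hypothesis rel_coproduct : forall (A T : cstarAlgType R) (i1 i2 : {lrmorphism A -> T}) u,
  star_preserving i1 -> star_preserving i2 ->
  (forall a b, i1 a * i2 b = i2 b * i1 a) ->
  rel u -> rel (coproduct u i1 i2).
Hypothesis rel_transpose : forall (A : cstarAlgType R) (u : 'M[A]_n), rel u -> rel (transpose u).
Hypothesis rel_perm : forall s, rel (perm_matrix R s).
Variables (A : cstarAlgType R) (u : 'M[A]_n).
Hypothesis hu : half_liberated rel u.

Let ru : rel u := half_liberated_rel rel_image hu.
Let hc : half_commuting u := half_liberated_half_commuting hu.

Lemma half_liberated_character (s : 'S_n) : exists chi : {lrmorphism A -> R[i]^o},
  star_character chi /\ forall i j, chi (u i j) = (i == s j)%:R.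
Proof.
have [f fs fe] := half_liberated_universal hu (rel_perm s) (perm_matrix_half_commuting R s).
by exists f; split=> // i j; rewrite fe mxE.
Qed.

Lemma half_liberated_oqg : orthogonal_quantum_group u.
Proof.
split.
- exact: rel_orth.
- exact: half_liberated_generates hu.
- move=> T i1 i2 [[s1 s2 comm _ _] _].
  have [f fs fe] := half_liberated_universal hu (rel_coproduct s1 s2 comm ru)
    (coproduct_half_commuting comm hc).
  by exists f; split=> // i j; rewrite fe mxE.
- have [chi [cs ce]] := half_liberated_character 1%g.
  by exists chi; split=> // i j; rewrite ce perm1.
have [f fs fe] := half_liberated_universal hu (rel_transpose ru) (transpose_half_commuting hc).
(* The morphism into the opposite algebra has the same underlying linear map; its multiplicativity
   is read as reversal of products in [A]. *)
have flin : linear (f : A -> A) by move=> a x y; apply: (linearP f).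
pose gl := GRing.isLinear.Build R[i] A A _ (f : A -> A) flin.
pose G : {linear A -> A} := HB.pack_for {linear A -> A} (f : A -> A) gl.
exists G; split=> //=.
- exact: (rmorph1 f).
- by move=> x y; apply: (rmorphM f).
- by move=> i j; rewrite -[LHS]/(f _) fe mxE.
Qed.

Lemma half_liberated_Sn : contains_Sn u.
Proof.
pose chi s := projT1 (cid (half_liberated_character s)).
have chiP s : star_character (chi s) /\ forall i j, chi s (u i j) = (i == s j)%:R.
  by rewrite /chi; case: cid.
exists chi; split=> [s|s i j|g]; [exact: (chiP s).1|exact: (chiP s).2|].
(* The character of [t] sends the product attached to [s] to the indicator of [s = t], so these
   products lift the delta functions on permutations. *)
exists (\sum_(s : 'S_n) g s *: \prod_j u (s j) j) => t.
rewrite rmorph_sum /= (bigD1 t) //= linearZ rmorph_prod /= big1 => [|j _]; last first.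
  by rewrite (chiP t).2 eqxx.
rewrite big1 => [|s st]; first by rewrite addr0; apply: mulr1.
rewrite linearZ rmorph_prod /=; have /existsP[j sj] : [exists j, s j != t j].
  rewrite -negb_forall; apply: contraNN st => /forallP h.
  by apply/eqP/permP=> j; apply/eqP/h.
by rewrite (bigD1 j) //= (chiP t).2 (negPf sj) mul0r; apply: mulr0.
Qed.

End QuantumGroup.

(** * Partition maps as intertwiners *)

Section Delta.
Variable n : nat.

Lemma delta_pP k l (p : diagram k l) (i : k.-tuple 'I_n) (j : l.-tuple 'I_n) :
  reflect (forall b x y, b \in p -> x \in b -> y \in b ->
             point_index i j x = point_index i j y) (delta_p p i j).
Proof.
apply: (iffP forall_inP) => [h b x y pb xb yb|h b pb].
  by apply/eqP; have /forall_inP/(_ x xb)/forall_inP/(_ y yb) := h b pb.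
by apply/forall_inP=> x xb; apply/forall_inP=> y yb; apply/eqP/(h b).
Qed.

Lemma delta_relabel k l k' l' (f : 'I_k + 'I_l -> 'I_k' + 'I_l') (p : diagram k l)
    (i : k.-tuple 'I_n) (j : l.-tuple 'I_n) (i' : k'.-tuple 'I_n) (j' : l'.-tuple 'I_n) :
  (forall x, point_index i' j' (f x) = point_index i j x) ->
  delta_p (relabel f p) i' j' = delta_p p i j.
Proof.
move=> h; apply/delta_pP/delta_pP => d b x y.
  move=> pb xb yb; rewrite -!h; apply: (d (f @: b)); [|exact: imset_f..].
  by apply/imsetP; exists b.
case/imsetP=> c pc -> /imsetP[x' xc ->] /imsetP[y' yc ->].
by rewrite !h; apply: (d c).
Qed.

Lemma delta_setU k l (p q : diagram k l) (i : k.-tuple 'I_n) (j : l.-tuple 'I_n) :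
  delta_p (p :|: q) i j = delta_p p i j && delta_p q i j.
Proof.
apply/delta_pP/andP => [d|[/delta_pP dp /delta_pP dq] b x y].
  split; apply/delta_pP=> b x y pb; apply: (d b); rewrite inE pb ?orbT //.
by case/setUP=> pb; [apply: (dp b)|apply: (dq b)].
Qed.

End Delta.

Lemma tuple_consP (T : Type) k (t : k.+1.-tuple T) :
  exists a (t' : k.-tuple T), t = [tuple of a :: t'].
Proof. by exists (thead t), [tuple of behead t]; apply: tuple_eta. Qed.

Section TupleSums.
Variables (n : nat) (V : nmodType).

Lemma sum_tuple_cons k (F : k.+1.-tuple 'I_n -> V) :
  \sum_t F t = \sum_a \sum_(t : k.-tuple 'I_n) F [tuple of a :: t].
Proof.
rewrite pair_big /= (reindex (fun x : 'I_n * k.-tuple 'I_n => [tuple of x.1 :: x.2])) //.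
exists (fun t => (thead t, [tuple of behead t])) => [[a t] _|t _] /=.
  by rewrite theadE; congr pair; apply: val_inj.
by rewrite -tuple_eta.
Qed.

Lemma sum_tuple_cat k l (F : (k + l).-tuple 'I_n -> V) :
  \sum_t F t =
  \sum_(t1 : k.-tuple 'I_n) \sum_(t2 : l.-tuple 'I_n) F [tuple of t1 ++ t2].
Proof.
rewrite pair_big /= (reindex (fun x : k.-tuple 'I_n * l.-tuple 'I_n => [tuple of x.1 ++ x.2])) //.
have inj : injective (fun x : k.-tuple 'I_n * l.-tuple 'I_n => [tuple of x.1 ++ x.2]).
  move=> [a b] [c d] /= /(congr1 val)/= /eqP; rewrite eqseq_cat ?size_tuple //.
  by case/andP=> /eqP/val_inj-> /eqP/val_inj->.
apply: onW_bij; apply: inj_card_bij inj _.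
by rewrite card_prod !card_tuple expnD.
Qed.

End TupleSums.

Section Intertwiners.
Variables (R : realType) (A : cstarAlgType R) (n : nat) (u : 'M[A]_n).
Implicit Types T : cstarAlgType R.

Lemma partition_map_entry k l (p : diagram k l) (i : k.-tuple 'I_n) (j : l.-tuple 'I_n) :
  (partition_map R n p (tbasis R i) j : R[i]) = (delta_p p i j)%:R.
Proof.
rewrite partition_map_basis sum_ffunE; under eq_bigr do rewrite ffunE.
case: (boolP (delta_p p i j)) => d; last first.
  by apply: big1 => j' d'; case: eqP => // e; rewrite e d' in d.
rewrite (bigD1 j) //= eqxx big1 ?addr0 // => j' /andP[_ jj'].
by rewrite eq_sym (negPf jj').
Qed.

Lemma partition_intertwinerP k l (p : diagram k l) :
  intertwiner u (partition_map R n p) <->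
  forall (i : k.-tuple 'I_n) (j : l.-tuple 'I_n),
    \sum_(i' | delta_p p i' j) matpow u i' i = \sum_(j' | delta_p p i j') matpow u j j'.
Proof.
have E (I : finType) (P : pred I) (F : I -> A) :
    \sum_(x | P x) F x = \sum_x ((P x)%:R : R[i]) *: F x.
  by rewrite big_mkcond; apply: eq_bigr => x _; case: (P x); rewrite ?scale1r ?scale0r.
split=> h i j.
  rewrite [LHS]E [RHS]E; have := h i j.
  under eq_bigr do rewrite partition_map_entry.
  by under [X in _ = X -> _]eq_bigr do rewrite partition_map_entry.
have := h i j; rewrite [X in X = _ -> _]E [X in _ = X -> _]E.
under [X in _ -> X = _]eq_bigr do rewrite partition_map_entry.
by under [X in _ -> _ = X]eq_bigr do rewrite partition_map_entry.
Qed.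

Lemma matpow_cons k a b (i i' : k.-tuple 'I_n) :
  matpow u [tuple of a :: i] [tuple of b :: i'] = u a b * matpow u i i'.
Proof.
rewrite /matpow big_ord_recl !tnth0; congr (_ * _); apply: eq_bigr => r _.
by rewrite !tnthS.
Qed.

Lemma matpow_cat k l (i1 j1 : k.-tuple 'I_n) (i2 j2 : l.-tuple 'I_n) :
  matpow u [tuple of i1 ++ i2] [tuple of j1 ++ j2] = matpow u i1 j1 * matpow u i2 j2.
Proof.
rewrite /matpow big_split_ord /=; congr (_ * _); apply: eq_bigr => r _.
  by rewrite !tnth_lshift.
by rewrite !tnth_rshift.
Qed.

Lemma matpow0 (i j : 0.-tuple 'I_n) : matpow u i j = 1.
Proof. by rewrite /matpow big_ord0. Qed.

(** A map out of the zeroth tensor power is a vector, and intertwining means that the tensor power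
    of [u] fixes it. *)
Lemma fixed_vectorP m (p : diagram 0 m) :
  intertwiner u (partition_map R n p) <->
  forall j : m.-tuple 'I_n,
    \sum_(j' | delta_p p [tuple] j') matpow u j j' = (delta_p p [tuple] j)%:R.
Proof.
have E (i : 0.-tuple 'I_n) j : \sum_(i' | delta_p p i' j) matpow u i' i = (delta_p p [tuple] j)%:R.
  rewrite big_mkcond (bigD1 [tuple]) //= big1 => [|t].
    by rewrite addr0 matpow0; case: delta_p.
  by case/eqP; apply: tuple0.
split=> [/partition_intertwinerP h j|h].
  by rewrite -h E.
by apply/partition_intertwinerP=> i j; rewrite E (tuple0 i) h.
Qed.

Definition intertwining : collection := fun k l =>
  [set p in partitions k l | `[< intertwiner u (partition_map R n p) >]].

Lemma intertwiningP k l (p : diagram k l) :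
  reflect (finset.partition p [set: _] /\ intertwiner u (partition_map R n p))
    (p \in intertwining k l).
Proof.
by rewrite 2!inE; apply: (iffP andP) => -[h1 /asboolP h2]; split=> //; apply/asboolP.
Qed.

Hypothesis uO : rel_O u.

(** Frobenius reciprocity for one point: the lower index moved up is contracted with [u], and column
    orthogonality removes the resulting factors [u a c * u a d]. *)
Lemma intertwining_rot k l (p : diagram k l.+1) :
  p \in intertwining k l.+1 -> rot_up ord0 ord0 p \in intertwining k.+1 l.
Proof.
case/intertwiningP=> hp /partition_intertwinerP h; apply/intertwiningP; split.
  apply: relabel_partition hp.
  exact: (Bijective (@rot_up_mapK k l _ _) (@rot_down_mapK k l _ _)).
have D a (i : k.-tuple 'I_n) (j : l.-tuple 'I_n) :
    delta_p (rot_up ord0 ord0 p) [tuple of a :: i] j = delta_p p i [tuple of a :: j].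
  apply: delta_relabel; case=> [r|r] /=; first by rewrite tnthS.
  by case: (unliftP ord0 r) => [r' ->|->]; rewrite /= ?tnth0 ?tnthS.
apply/partition_intertwinerP=> i0 j; have [c [i ->]] := tuple_consP i0.
transitivity (\sum_a u a c * \sum_(i' | delta_p p i' [tuple of a :: j]) matpow u i' i).
  rewrite big_mkcond sum_tuple_cons; apply: eq_bigr => a _.
  rewrite -big_mkcond mulr_sumr; apply: eq_big => [t|t _]; first exact: D.
  exact: matpow_cons.
transitivity (\sum_a \sum_d u a c * u a d *
    \sum_(t : l.-tuple 'I_n | delta_p p i [tuple of d :: t]) matpow u j t).
  apply: eq_bigr => a _; rewrite h big_mkcond sum_tuple_cons mulr_sumr.
  apply: eq_bigr => d _; rewrite -big_mkcond -mulrA; congr (_ * _); rewrite mulr_sumr.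
  by apply: eq_bigr => t _; apply: matpow_cons.
rewrite exchange_big /=; under eq_bigr do rewrite -mulr_suml.
have [_ _ uc] := uO; rewrite (bigD1 c) //= uc eqxx mul1r [X in _ + X]big1 ?addr0 => [|d dc].
  by apply: eq_bigl => t; rewrite D.
by rewrite uc eq_sym (negPf dc) mul0r.
Qed.

Lemma intertwining_nil : finset.set0 \in intertwining 0 0.
Proof.
apply/intertwiningP; split; first by rewrite (_ : [set: _] = finset.set0) ?partition_set0 //; apply/setP=> -[[]|[]].
apply/fixed_vectorP=> j; have d t : delta_p finset.set0 [tuple] t = true :> bool.
  by apply/delta_pP=> b; rewrite inE.
rewrite d (bigD1 [tuple]) ?d //= matpow0 big1 ?addr0 // => t.
by case/andP=> _ /eqP[]; apply: tuple0.
Qed.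

Lemma intertwining_tensor s m (p : diagram 0 s) (q : diagram 0 m) :
  p \in intertwining 0 s -> q \in intertwining 0 m -> tensor p q \in intertwining 0 (s + m).
Proof.
case/intertwiningP=> hp /fixed_vectorP fp /intertwiningP[hq /fixed_vectorP fq].
apply/intertwiningP; split; first exact: (tensor_partition hp hq).
have D (j1 : s.-tuple 'I_n) (j2 : m.-tuple 'I_n) : delta_p (tensor p q : diagram 0 (s + m)) [tuple] [tuple of j1 ++ j2] =
    delta_p p [tuple] j1 && delta_p q [tuple] j2.
  rewrite /tensor delta_setU; congr andb; apply: delta_relabel; case=> [[]//|r] /=.
    by rewrite tnth_lshift.
  by rewrite tnth_rshift.
apply/fixed_vectorP=> j.
have [j1 [j2 ->]] : exists (j1 : s.-tuple 'I_n) (j2 : m.-tuple 'I_n), j = [tuple of j1 ++ j2].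
  exists [tuple tnth j (lshift m r) | r < s], [tuple tnth j (rshift s r) | r < m].
  apply: eq_from_tnth => r; case: (split_ordP r) => r' ->.
    by rewrite tnth_lshift tnth_mktuple.
  by rewrite tnth_rshift tnth_mktuple.
rewrite big_mkcond sum_tuple_cat D -mulnb natrM -fp -fq big_distrlr /= [RHS]big_mkcond /=.
apply: eq_bigr => t1 _; rewrite [in RHS]big_mkcond /=.
case: ifP => d1; last by apply: big1 => t2 _; rewrite D d1.
by apply: eq_bigr => t2 _; rewrite D d1 matpow_cat.
Qed.

(** The three consecutive factors from [a] to [a + 2] are reversed and all others stay; the index
    set is cut as [a0 + 3 + c] to isolate them. *)
Lemma prod_tperm m (a b : 'I_m) (F : 'I_m -> A) :
  val b = (val a).+2 -> (forall x y z, F x * F y * F z = F z * F y * F x) ->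
  \prod_r F (tperm a b r) = \prod_r F r.
Proof.
move=> ab hF; have [c [a0 [ea em]]] : exists c a0, val a = a0 /\ m = (a0 + 3 + c)%N.
  have hb : (val b < m)%N := ltn_ord b; exists (m - (a + 3))%N, (val a).
  by rewrite ab /= in hb *; lia.
subst m; have va : nat_of_ord a = a0 := ea.
have vb : nat_of_ord b = a0.+2 by have := ab; rewrite /= va.
have eqF x y : nat_of_ord x = nat_of_ord y -> F x = F y by move=> /ord_inj->.
rewrite !big_split_ord /=; congr (_ * _ * _); last first.
- apply: eq_bigr => r _; congr F.
  by case: tpermP => [/(congr1 val)|/(congr1 val)|//] /=; rewrite ?va ?vb; lia.
- rewrite !big_ord_recl !big_ord0 !mulr1 /= !mulrA.
  set x0 := lshift c (rshift a0 ord0).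
  set x1 := lshift c (rshift a0 (lift ord0 ord0)).
  set x2 := lshift c (rshift a0 (lift ord0 (lift ord0 ord0))).
  have e0 : x0 = a by apply: val_inj; rewrite /= va addn0.
  have e2 : x2 = b by apply: val_inj; rewrite /= vb /bump /=; lia.
  have x1a : a != x1 by apply/eqP => /(congr1 val); rewrite /= va /bump /=; lia.
  have x1b : b != x1 by apply/eqP => /(congr1 val); rewrite /= vb /bump /=; lia.
  by rewrite e0 e2 tpermL tpermR (tpermD x1a x1b) hF.
apply: eq_bigr => r _; congr F; have hr := ltn_ord r.
by case: tpermP => [/(congr1 val)|/(congr1 val)|//] /=; rewrite ?va ?vb; lia.
Qed.

Hypothesis hc : half_commuting u.

Lemma intertwining_swap m (a b : 'I_m) (p : diagram 0 m) :
  val b = (val a).+2 -> p \in partitions 0 m ->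
  p \in intertwining 0 m -> relabel (map_lower (tperm a b)) p \in intertwining 0 m.
Proof.
move=> ab _ /intertwiningP[hp /fixed_vectorP fp]; apply/intertwiningP; split.
  by apply/relabel_partition/hp/map_lower_bij/injF_bij/perm_inj.
pose tw (j : m.-tuple 'I_n) : m.-tuple 'I_n := [tuple tnth j (tperm a b r) | r < m].
have twK : involutive tw.
  by move=> j; apply: eq_from_tnth => r; rewrite !tnth_mktuple tpermK.
have D j : delta_p (relabel (map_lower (tperm a b)) p) [tuple] j = delta_p p [tuple] (tw j).
  by apply: delta_relabel; case=> [[]//|r] /=; rewrite tnth_mktuple.
apply/fixed_vectorP=> j; rewrite D -fp (reindex_inj (inv_inj twK)) /=.
apply: eq_big => [j'|j' _]; first by rewrite D twK.
rewrite /matpow -[RHS](@prod_tperm _ a b) //.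
by apply: eq_bigr => r _; rewrite !tnth_mktuple tpermK.
Qed.

Lemma delta_setT m (j : m.+1.-tuple 'I_n) :
  delta_p [set [set: 'I_0 + 'I_m.+1]] [tuple] j = (j == [tuple of nseq m.+1 (thead j)]).
Proof.
apply/delta_pP/eqP => [h|-> b x y _ _ _].
  apply: eq_from_tnth => r; rewrite tnth_nseq.
  by apply: (h _ (inr r) (inr ord0) (set11 _)); rewrite inE.
by case: x => [[]//|x]; case: y => [[]//|y] /=; rewrite !tnth_nseq.
Qed.

Lemma sum_delta_setT m (F : m.+1.-tuple 'I_n -> A) :
  \sum_(j | delta_p [set [set: 'I_0 + 'I_m.+1]] [tuple] j) F j =
  \sum_a F [tuple of nseq m.+1 a].
Proof.
rewrite (reindex_onto (fun a => [tuple of nseq m.+1 a]) (fun j => thead j)) /=; last first.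
  by move=> j; rewrite delta_setT => /eqP/esym.
apply: eq_bigl => a; rewrite delta_setT.
have -> : thead [tuple of nseq m.+1 a] = a by rewrite /thead tnth_nseq.
by rewrite !eqxx.
Qed.

Lemma intertwining_pair : p_pair \in intertwining 0 2.
Proof.
apply/intertwiningP; split; first by apply: setT1_partition; rewrite card_sum !card_ord.
apply/fixed_vectorP=> j; rewrite sum_delta_setT delta_setT.
have [_ ur _] := uO; have [x [j1 ->]] := tuple_consP j; have [y [j2 ->]] := tuple_consP j1.
rewrite theadE (tuple0 j2).
have -> : ([tuple of x :: [tuple of y :: [tuple]]] == [tuple of nseq 2 x]) = (x == y).
  by rewrite -val_eqE /= !eqseq_cons eqxx andbT eq_sym.
rewrite -ur; apply: eq_bigr => a _.
by rewrite /matpow !big_ord_recl big_ord0 mulr1 !(tnth_nth x).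
Qed.

End Intertwiners.

(** * Even blocks and singletons as intertwiners *)

Section Generators.
Variables (R : realType) (A : cstarAlgType R) (n : nat) (u : 'M[A]_n).

(** Entries of one column in different rows annihilate each other, so a product along a column
    survives only when all its row indices agree. *)
Lemma H_column_prod (a x : 'I_n) (s : seq 'I_n) : rel_H u ->
  \prod_(y <- x :: s) u y a = if all (pred1 x) s then u x a ^+ (size s).+1 else 0.
Proof.
case=> _ uH; elim: s x => [|y s IHs] x; first by rewrite big_seq1 expr1.
rewrite big_cons IHs /=; case: (eqVneq y x) => [->|yx] /=.
  by case: all; rewrite ?mulr0 // -exprS.
case: all; last by rewrite mulr0.
by rewrite exprS mulrA (uH _ _ a _).1 ?mul0r // eq_sym.
Qed.

(** Multiplying the row relation by [u x a] leaves the cube of [u x a] equal to [u x a], so the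
    square is idempotent. *)
Lemma H_even_power (x a : 'I_n) m : rel_H u -> u x a ^+ m.+1.*2 = u x a ^+ 2.
Proof.
case=> -[_ ur _] uH; elim: m => [//|m IHm].
rewrite doubleS -addn2 exprD IHm !expr2 -mulrA.
have : u x a * \sum_k u x k * u x k = u x a * 1 by rewrite ur eqxx.
rewrite (bigD1 a) //= mulrDr mulr1 mulr_sumr big1 => [|k ka]; last first.
  by rewrite mulrA (uH _ _ x _).2 ?mul0r // eq_sym.
by rewrite addr0 => ->.
Qed.

Lemma intertwining_even_block m : rel_H u ->
  [set [set: 'I_0 + 'I_m.+1.*2]] \in intertwining u 0 m.+1.*2.
Proof.
move=> hH; have [[us ur uc] _] := hH; apply/intertwiningP; split.
  by apply: setT1_partition; rewrite card_sum !card_ord.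
apply/fixed_vectorP=> j; rewrite sum_delta_setT delta_setT.
have [x [j1 ->]] := tuple_consP j; rewrite theadE.
have E a : matpow u [tuple of x :: j1] [tuple of nseq m.+1.*2 a] =
    if all (pred1 x) j1 then u x a ^+ 2 else 0.
  transitivity (\prod_(y <- [tuple of x :: j1]) u y a).
    by rewrite big_tuple; apply: eq_bigr => r _; rewrite tnth_nseq.
  rewrite /= H_column_prod // size_tuple.
  by case: all; rewrite // -(H_even_power _ _ m).
under eq_bigr do rewrite E.
have -> : ([tuple of x :: j1] == [tuple of nseq m.+1.*2 x]) = all (pred1 x) j1.
  rewrite -val_eqE /= eqseq_cons eqxx /=.
  by rewrite (sameP (all_pred1P _ _) eqP) size_tuple.
case: all; last by rewrite big1.
by apply: etrans (ur x x) _; rewrite eqxx.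
Qed.

(** The claim is [s * s = 1] for the common row sum [s]. Summing the squared row sums over all rows
    and applying column orthogonality gives [n s^2 = n], and [n] can be cancelled. *)
Lemma intertwining_upup : (0 < n)%N -> rel_Bsharp u -> p_upup \in intertwining u 0 2.
Proof.
move=> n0 [[_ _ uc] uB]; apply/intertwiningP; split.
  have -> : p_upup = preim_partition id [set: _]; last exact: preim_partitionP.
  by apply/setP=> b; apply/imsetP/imsetP => -[x _ ->]; exists x; rewrite ?inE //;
    apply/setP=> y; rewrite !inE eq_sym.
have D j : delta_p p_upup ([tuple] : 0.-tuple 'I_n) j = true :> bool.
  by apply/delta_pP=> b x y /imsetP[z _ ->] /set1P-> /set1P->.
apply/fixed_vectorP=> j; rewrite D; have [x [j1 ->]] := tuple_consP j.
have [y [j2 ->]] := tuple_consP j1; rewrite (tuple0 j2).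
transitivity ((\sum_k u x k) * (\sum_k u y k)).
  rewrite big_mkcond sum_tuple_cons mulr_suml; apply: eq_bigr => a _.
  rewrite sum_tuple_cons mulr_sumr; apply: eq_bigr => b _.
  rewrite (bigD1 [tuple]) //= big1 ?addr0 => [|t]; last by case/eqP; apply: tuple0.
  by rewrite D !matpow_cons matpow0 mulr1.
pose s := \sum_k u x k; have rowE i : \sum_k u i k = s.
  by rewrite (uB i x) -(uB x x).
rewrite !rowE; have ns : s * s *+ n = 1 *+ n.
  rewrite -[X in _ *+ X]card_ord -sumr_const.
  transitivity (\sum_(i < n) \sum_a \sum_b u i a * u i b).
    by apply: eq_bigr => i _; rewrite -{1}(rowE i) -(rowE i) big_distrlr.
  rewrite exchange_big /=; under eq_bigr => a _ do rewrite exchange_big /=.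
  rewrite -[X in _ = _ *+ X]card_ord -sumr_const; apply: eq_bigr => a _.
  under eq_bigr do rewrite uc.
  rewrite (bigD1 a) //= eqxx big1 ?addr0 // => b ba.
  by rewrite eq_sym (negPf ba).
have nU : (n%:R : R[i]) \is a GRing.unit by rewrite unitfE pnatr_eq0 -lt0n.
by apply: (can_inj (scalerK nU)); rewrite !scaler_nat ns.
Qed.

End Generators.

Section Span.
Variables (R : realType) (A : cstarAlgType R) (n : nat) (u : 'M[A]_n).

Lemma intertwiner_span (k l : nat) (r : seq 'Hom(tpow R n k, tpow R n l)) T :
  (forall S, S \in r -> intertwiner u S) -> T \in <<r>>%VS -> intertwiner u T.
Proof.
move=> hr /(coord_span (X := in_tuple r)) -> i j.
have E (x : tpow R n k) (y : l.-tuple 'I_n) (c : 'I_(size r) -> R[i]) :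
    ((\sum_s c s *: (in_tuple r)`_s) x y : R[i]) = \sum_s c s * (((in_tuple r)`_s) x y : R[i]).
  rewrite sum_lfunE sum_ffunE; apply: eq_bigr => s _.
  by rewrite scale_lfunE ffunE.
under eq_bigr => i' _ do rewrite E scaler_suml.
under [RHS]eq_bigr => j' _ do rewrite E scaler_suml.
rewrite exchange_big [RHS]exchange_big /=; apply: eq_bigr => s _.
have hs := hr _ (mem_nth 0 (ltn_ord s)) i j.
under eq_bigr => i' _ do rewrite -scalerA.
under [RHS]eq_bigr => j' _ do rewrite -scalerA.
by rewrite -!scaler_sumr hs.
Qed.

Lemma span_intertwiner (X : collection) k l T :
  (forall k l, X k l \subset intertwining u k l) ->
  T \in <<[seq partition_map R n p | p in X k l]>>%VS -> intertwiner u T.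
Proof.
move=> h; apply: intertwiner_span => S /mapP[p]; rewrite mem_enum => pX ->.
by have /intertwiningP[] := subsetP (h k l) _ pX.
Qed.

End Span.

(** * The first fundamental theorem *)

Lemma prim_root_exists (C : numClosedFieldType) n : (n > 0)%N ->
  exists z : C, n.-primitive_root z.
Proof.
pose p : {poly C} := 'X^n - 1; have [r Dp] := closed_field_poly_normal p.
move=> n_gt0; rewrite (monicP _) ?monicXnsubC // scale1r in Dp.
have rn1 : all n.-unity_root r by apply/allP=> z; rewrite -root_prod_XsubC -Dp.
have sz_r : (n < (size r).+1)%N.
  by rewrite -(size_prod_XsubC r id) -Dp size_XnsubC.
have [|z] := hasP (has_prim_root n_gt0 rn1 _ sz_r); last by exists z.
by rewrite -separable_prod_XsubC -Dp separable_Xn_sub_1 // pnatr_eq0 -lt0n.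
Qed.

(** A primitive root of unity of order [N + 1]. Scaling by it detects multiplicities up to [N]. *)
Lemma separating_unit (C : numClosedFieldType) N : exists z : C,
  z * Num.conj z = 1 /\ forall a b, (a <= N)%N -> (b <= N)%N -> z ^+ a = z ^+ b -> a = b.
Proof.
have [z hz] := @prim_root_exists C N.+1 isT; exists z; split.
  rewrite -normCK; have : `|z| ^+ N.+1 = 1 by rewrite -normrX (prim_expr_order hz) normr1.
  by move/eqP; rewrite pexpr_eq1 // => /eqP->; rewrite expr1n.
move=> a b aN bN /eqP; rewrite (eq_prim_root_expr hz) => /eqP.
by rewrite !modn_small.
Qed.

(** * The double commutant of a finite group, cut down by an idempotent *)

Section DoubleCommutant.
Variables (C : numFieldType) (N : nat) (gT : finGroupType) (rho : gT -> 'M[C]_N).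
Hypothesis rhoM : forall g h, rho (g * h)%g = rho g *m rho h.
Hypothesis rho1 : rho 1%g = 1%:M.
Variable P : 'M[C]_N.
Hypothesis PP : P *m P = P.
Hypothesis Pcomm : forall g, rho g *m P = P *m rho g.

Let U : {vspace 'M[C]_N} := <<[seq rho g *m P | g : gT]>>%VS.

Let mem_U g : rho g *m P \in U.
Proof. by apply/memv_span/map_f; rewrite mem_enum. Qed.

Let U_lin (f : {linear 'M[C]_N -> 'M[C]_N}) :
  (forall g, f (rho g *m P) \in U) -> forall x, x \in U -> f x \in U.
Proof.
move=> h x /coord_span ->; rewrite linear_sum; apply: memv_suml => i _.
rewrite linearZ memvZ //; set y := _`_i.
have /mapP[g _ yE] : y \in [seq rho g *m P | g : gT] by apply: mem_nth; rewrite ?size_tuple.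
by rewrite yE.
Qed.

Let U_rho h x : x \in U -> rho h *m x \in U.
Proof.
apply: (@U_lin (mulmx (rho h))) => g /=; rewrite mulmxA -rhoM; exact: mem_U.
Qed.

Let E0 := projv U.
(** Averaging as in Maschke's theorem: the mean of a projection onto [U] still fixes [U], and it
    commutes with left multiplication by the group. *)
Let E x := (#|gT|%:R^-1 : C) *: \sum_g rho g^-1%g *m E0 (rho g *m x).

Let card_neq0 : (#|gT|%:R : C) != 0.
Proof. by rewrite pnatr_eq0 -lt0n; apply/card_gt0P; exists 1%g. Qed.

Let E_id x : x \in U -> E x = x.
Proof.
move=> xU; rewrite /E (eq_bigr (fun=> x)) => [|g _]; last first.
  by rewrite /E0 projv_id ?U_rho // mulmxA -rhoM mulVg rho1 mul1mx.
by rewrite sumr_const cardT -cardE -scaler_nat scalerA mulVf // scale1r.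
Qed.

Let E_mem x : E x \in U.
Proof.
rewrite memvZ //; apply: memv_suml => g _; apply: U_rho; exact: memv_proj.
Qed.

Let E_linear : linear E.
Proof.
move=> a x y; rewrite /E [in RHS]scalerA [a * _]mulrC -scalerA -scalerDr; congr (_ *: _).
rewrite scaler_sumr -big_split; apply: eq_bigr => g _ /=.
by rewrite mulmxDr -scalemxAr linearP mulmxDr -scalemxAr.
Qed.

Let E_rho h x : E (rho h *m x) = rho h *m E x.
Proof.
rewrite /E -scalemxAr; congr (_ *: _); rewrite mulmx_sumr.
rewrite (reindex_inj (mulIg h^-1%g)) /=; apply: eq_bigr => g _.
by rewrite invMg invgK rhoM -!mulmxA [rho (g * _)%g *m _]mulmxA -rhoM mulgKV.
Qed.

Let E_sum (I : Type) (r : seq I) (F : I -> 'M[C]_N) :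
  E (\sum_(i <- r) F i) = \sum_(i <- r) E (F i).
Proof.
elim/big_rec2: _ => [|i y1 y2 _ <-].
  by have := E_linear (-1) 0 0; rewrite scaler0 add0r scaleN1r addNr.
by rewrite -[F i in LHS]scale1r E_linear scale1r.
Qed.

Let E_scale a x : E (a *: x) = a *: E x.
Proof.
have E00 : E 0 = 0 by have := @E_sum unit [::] (fun=> 0); rewrite !big_nil.
by rewrite -[a *: x]addr0 E_linear E00 addr0.
Qed.

(* The averaged projection [E] commutes with left multiplication by the group,
   so its matrix slices lie in the commutant and [T] commutes with them. *)
Lemma double_commutant (T : 'M[C]_N) : T *m P = T -> P *m T = T ->
  (forall X : 'M[C]_N, (forall g, rho g *m X = X *m rho g) ->
     T *m X *m P = P *m X *m T) ->
  exists a : gT -> C, T = \sum_g a g *: (rho g *m P).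
Proof.
move=> TP PT comm.
(* The matrix [X j l] is the contribution of column [l] of the argument to column [j] of the value
   of [E], so that [slice] expresses [E] through ordinary matrix products. *)
pose X j l : 'M[C]_N := \matrix_(i, k) E (delta_mx k l) i j.
have Xcomm j l g : rho g *m X j l = X j l *m rho g.
  apply/matrixP=> i k.
  have : (rho g *m E (delta_mx k l)) i j = E (rho g *m delta_mx k l) i j by rewrite E_rho.
  rewrite mxE [rho g *m delta_mx k l]matrix_sum_delta E_sum summxE => e.
  rewrite mxE (eq_bigr (fun k' => rho g i k' * E (delta_mx k l) k' j)); last first.
    by move=> k' _; rewrite mxE.
  rewrite e mxE; apply: eq_bigr => k' _; rewrite E_sum summxE (bigD1 l) //= E_scale.
  rewrite big1 ?addr0 => [|l' l'l].
    rewrite !mxE (bigD1 k) //= big1 => [|k'' kk]; first by rewrite mxE !eqxx mulr1 addr0 mulrC.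
    by rewrite mxE (negPf kk) mulr0.
  rewrite E_scale mxE mxE big1 ?mul0r // => k'' _.
  by rewrite mxE (negPf l'l) andbF mulr0.
have slice x i j : E x i j = \sum_l (X j l *m x) i l.
  rewrite {1}(matrix_sum_delta x) E_sum summxE.
  under [RHS]eq_bigr do rewrite mxE; rewrite [RHS]exchange_big /=.
  apply: eq_bigr => k _; rewrite E_sum summxE; apply: eq_bigr => l _.
  by rewrite E_scale !mxE mulrC.
have PU : P \in U by rewrite -[P]mul1mx -rho1.
(* Since [E P = P], the matrix [T] equals [T *m E P]. Through the slices its entries are sums of
   entries of [T *m X *m P], and the hypothesis turns these into [P *m X *m T], that is, into
   [P *m E T]. *)
have PET : P *m E T = T.
  rewrite -[RHS]TP -{2}(E_id PU); apply/matrixP=> i j; rewrite !mxE.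
  under eq_bigr do rewrite slice mulr_sumr; rewrite exchange_big /=.
  under [RHS]eq_bigr do rewrite slice mulr_sumr; rewrite [RHS]exchange_big /=.
  apply: eq_bigr => l _; have /matrixP/(_ i l) := comm _ (Xcomm j l).
  by rewrite -!mulmxA mxE [RHS]mxE => <-.
have /coord_span eET := E_mem T.
have h g : exists a : gT -> C, rho g *m P = \sum_g' a g' *: (rho g' *m P).
  exists (fun g' => (g' == g)%:R); rewrite (bigD1 g) //= eqxx scale1r big1 ?addr0 // => g' gg.
  by rewrite (negPf gg) scale0r.
have [a ea] : exists a : gT -> C, E T = \sum_g a g *: (rho g *m P).
  rewrite eET; elim/big_rec: _ => [|s y _ [a ->]].
    by exists (fun=> 0); rewrite big1 // => g _; rewrite scale0r.
  set v := _`_s; have /mapP[g _ ->] : v \in [seq rho g *m P | g : gT].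
    by apply: mem_nth; rewrite size_image ltn_ord.
  have [a' ->] := h g; set c := coord _ _ _.
  exists (fun g' => c * a' g' + a g'); rewrite scaler_sumr -big_split /=.
  by apply: eq_bigr => g' _; rewrite scalerDl scalerA.
exists a; rewrite -PET ea mulmx_sumr; apply: eq_bigr => g _.
by rewrite -scalemxAr mulmxA -Pcomm -mulmxA PP.
Qed.

End DoubleCommutant.

(** * Schur-Weyl duality *)

Section TensorPower.
Variables (C : numClosedFieldType) (n : nat) (Q : finType).
Local Notation W := {ffun Q -> 'I_n}.
Local Notation N := #|{: W}|.

(** Operators on a tensor power are kernels indexed by multi-indices; numbering these makes the
    theory of square matrices available. *)
Definition mxW (K : W -> W -> C) : 'M[C]_N :=
  \matrix_(a, b) K (enum_val a) (enum_val b).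

Lemma mxW_eq K L : (forall i k, K i k = L i k) -> mxW K = mxW L.
Proof. by move=> e; apply/matrixP=> a b; rewrite !mxE e. Qed.

Lemma mxW_inj K L : mxW K = mxW L -> forall i k, K i k = L i k.
Proof.
move=> e i k; have := congr1 (fun X : 'M[C]_N => X (enum_rank i) (enum_rank k)) e.
by rewrite !mxE !enum_rankK.
Qed.

Lemma mxW_surj (X : 'M[C]_N) : X = mxW (fun i k => X (enum_rank i) (enum_rank k)).
Proof. by apply/matrixP=> a b; rewrite mxE !enum_valK. Qed.

Lemma mxWM K L : mxW K *m mxW L = mxW (fun i k => \sum_j K i j * L j k).
Proof.
apply/matrixP=> a b; rewrite !mxE.
rewrite (reindex_onto enum_rank enum_val) /=; last by move=> j _; apply: enum_valK.
apply: eq_big => j; first by rewrite enum_rankK eqxx.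
by rewrite !mxE enum_rankK.
Qed.

Lemma mxW1 : mxW (fun i k => (i == k)%:R) = 1%:M.
Proof. by apply/matrixP=> a b; rewrite !mxE (inj_eq enum_val_inj). Qed.

Lemma mxW_sum (I : finType) (P : pred I) (K : I -> W -> W -> C) :
  \sum_(a | P a) mxW (K a) = mxW (fun i k => \sum_(a | P a) K a i k).
Proof. by apply/matrixP=> a b; rewrite summxE !mxE; apply: eq_bigr => c _; rewrite mxE. Qed.

Lemma mxW_scale c K : c *: mxW K = mxW (fun i k => c * K i k).
Proof. by apply/matrixP=> a b; rewrite !mxE. Qed.

Definition tens (x : Q -> 'M[C]_n) : 'M[C]_N :=
  mxW (fun i k => \prod_q x q (i q) (k q)).

Lemma eq_tens x y : (forall q, x q = y q) -> tens x = tens y.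
Proof. by move=> e; apply: mxW_eq => i k; apply: eq_bigr => q _; rewrite e. Qed.

Lemma tensM x y : tens x *m tens y = tens (fun q => x q *m y q).
Proof.
rewrite mxWM; apply: mxW_eq => i k; under [RHS]eq_bigr do rewrite mxE.
rewrite bigA_distr_bigA; apply: eq_bigr => j _; by rewrite big_split.
Qed.

Lemma tens1 : tens (fun=> 1%:M) = 1%:M.
Proof.
rewrite -mxW1; apply: mxW_eq => i k; have [->|ik] := eqVneq i k.
  by rewrite big1 // => q _; rewrite mxE eqxx.
have /existsP[q iq] : [exists q, i q != k q].
  rewrite -negb_forall; apply: contraNN ik => /forallP h.
  by apply/eqP/ffunP => q; apply/eqP/h.
by rewrite (bigD1 q) //= mxE (negPf iq) mul0r.
Qed.

Definition twist (s : {perm Q}) (k : W) : W := [ffun q => k (s q)].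

Lemma twistM s t k : twist (s * t) k = twist s (twist t k).
Proof. by apply/ffunP=> q; rewrite !ffunE permM. Qed.

Lemma twist1 k : twist 1 k = k.
Proof. by apply/ffunP=> q; rewrite !ffunE perm1. Qed.

Lemma twistK s : cancel (twist s) (twist s^-1).
Proof. by move=> k; rewrite -twistM mulVg twist1. Qed.

Lemma twistKV s : cancel (twist s^-1) (twist s).
Proof. by move=> k; rewrite -twistM mulgV twist1. Qed.

Definition rho (s : {perm Q}) : 'M[C]_N := mxW (fun i k => (i == twist s k)%:R).

Lemma rho_mul s K : rho s *m mxW K = mxW (fun i k => K (twist s^-1 i) k).
Proof.
rewrite mxWM; apply: mxW_eq => i k; rewrite (bigD1 (twist s^-1 i)) //=.
rewrite twistKV eqxx mul1r big1 ?addr0 // => j ji.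
by case: eqP => [e|]; rewrite ?mul0r //; rewrite e twistK eqxx in ji.
Qed.

Lemma mul_rho s K : mxW K *m rho s = mxW (fun i k => K i (twist s k)).
Proof.
rewrite mxWM; apply: mxW_eq => i k; rewrite (bigD1 (twist s k)) //=.
by rewrite eqxx mulr1 big1 ?addr0 // => j /negPf->; rewrite mulr0.
Qed.

Lemma rho1 : rho 1 = 1%:M.
Proof. by rewrite -mxW1; apply: mxW_eq => i k; rewrite twist1. Qed.

Lemma rhoM s t : rho (s * t) = rho s *m rho t.
Proof.
rewrite rho_mul; apply: mxW_eq => i k; rewrite twistM.
by rewrite -[in LHS](can_eq (twistKV s)) twistK.
Qed.

Lemma rhoVK s : rho s^-1 *m rho s = 1%:M.
Proof. by rewrite -rhoM mulVg rho1. Qed.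

Lemma rho_tens s x : rho s *m tens (fun=> x) = tens (fun=> x) *m rho s.
Proof.
rewrite rho_mul mul_rho; apply: mxW_eq => i k.
rewrite [LHS](reindex_inj (@perm_inj _ s)) /=; apply: eq_bigr => q _.
by rewrite !ffunE permK.
Qed.

(** The sum of all conjugates of a pure tensor under permutations of the factors, as [symtens_rho]
    shows. *)
Definition symtens (x : Q -> 'M[C]_n) : 'M[C]_N :=
  mxW (fun i k => \sum_(s : {perm Q}) \prod_q x q (i (s q)) (k (s q))).

Lemma symtens_rho x : symtens x = \sum_(s : {perm Q}) rho s^-1 *m tens x *m rho s.
Proof.
under eq_bigr => s _ do rewrite rho_mul mul_rho invgK.
rewrite mxW_sum; apply: mxW_eq => i k; apply: eq_bigr => s _.
by apply: eq_bigr => q _; rewrite !ffunE.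
Qed.

(** Inclusion-exclusion as a product over the points, in which a point outside [A] contributes
    [1 - 1]. *)
Lemma alternating_supersets (A : {set Q}) :
  \sum_(S : {set Q} | A \subset S) (-1) ^+ #|~: S| = (A == setT)%:R :> C.
Proof.
transitivity (\prod_q (if q \in A then 1 else 0 : C)).
  transitivity (\prod_q (1 + (if q \in A then 0 else -1 : C))).
    rewrite bigA_distr big_mkcond /=; apply: eq_bigr => S _.
    case: ifP => AS; last first.
      have /negbT/subsetPn[q qA qS] := AS.
      by rewrite (bigD1 q) //= (negPf qS) qA mul0r.
    rewrite -prodr_const big_mkcond /=; apply: eq_bigr => q _.
    rewrite inE; case: (boolP (q \in S)) => //= qS; case: ifP => // qA.
    by rewrite (subsetP AS _ qA) in qS.
  by apply: eq_bigr => q _; case: ifP; rewrite ?addr0 ?subrr.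
have [->|AT] := eqVneq A setT; first by rewrite big1 // => q _; rewrite inE.
have /subsetPn[q _ qA] : ~~ (setT \subset A) by rewrite subTset.
by rewrite (bigD1 q) //= (negPf qA) mul0r.
Qed.

(** Expanding the powers gives one term for each map from [Q] to itself. The signed sum over the
    sets [S] containing its image keeps the surjective maps, which are the permutations. *)
Lemma polarization x : symtens x =
  \sum_(S : {set Q}) (-1) ^+ #|~: S| *: tens (fun=> \sum_(a in S) x a).
Proof.
under eq_bigr do rewrite mxW_scale.
rewrite mxW_sum; apply: mxW_eq => i k.
transitivity (\sum_(S : {set Q}) (-1) ^+ #|~: S| *
    \sum_(f : {ffun Q -> Q} | f @: setT \subset S) \prod_q x (f q) (i q) (k q)).
  rewrite (eq_bigr (fun S : {set Q} => \sum_(f : {ffun Q -> Q})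
     (f @: setT \subset S)%:R * ((-1) ^+ #|~: S| * \prod_q x (f q) (i q) (k q)))); last first.
    move=> S _; rewrite mulr_sumr big_mkcond; apply: eq_bigr => f _ /=.
    by case: (_ \subset _); rewrite ?mul1r ?mul0r.
  rewrite exchange_big /=.
  rewrite (eq_bigr (fun f : {ffun Q -> Q} => (f @: setT == setT)%:R *
     \prod_q x (f q) (i q) (k q))); last first.
    move=> f _; rewrite -alternating_supersets mulr_suml big_mkcond [RHS]big_mkcond.
    by apply: eq_bigr => S _; case: (_ \subset _); rewrite ?mul1r ?mul0r.
  rewrite (eq_bigr (fun f : {ffun Q -> Q} => if injectiveb f then
     \prod_q x (f q) (i q) (k q) else 0)); last first.
    move=> f _; have -> : (f @: setT == setT) = injectiveb f.
      rewrite eqEcard subsetT /= cardsT.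
      apply/idP/injectiveP => [le|fi]; last by rewrite card_imset // cardsT.
      have /imset_injP h : #|f @: setT| == #|[set: Q]|.
        by rewrite eqn_leq leq_imset_card cardsT.
      by move=> a b; apply: h; rewrite inE.
    by case: injectiveb; rewrite ?mul1r ?mul0r.
  rewrite -big_mkcond /=.
  (* In [symtens] the permutation acts on the indices, in the expansion on the factors; passing to
     inverses aligns the two. *)
  rewrite (reindex_inj invg_inj) /=.
  rewrite (reindex (fun s : {perm Q} => pval s)) /=; last first.
    exists (fun f => insubd (1%g : {perm Q}) f) => [s _|f fi]; first exact: valKd.
    by apply: insubdK.
  apply: eq_big => [s|s _]; first by rewrite (valP s).
  rewrite (reindex_inj (@perm_inj _ s)) /=; apply: eq_bigr => q _.
  by rewrite permK pvalE.
apply: eq_bigr => S _; congr (_ * _); under [RHS]eq_bigr do rewrite summxE.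
rewrite bigA_distr_big; apply: eq_bigl => f.
apply/subsetP/ffun_onP => [h q|h y /imsetP[q _ ->] //].
by apply: h; rewrite imset_f ?inE.
Qed.

Section Commutation.
Variables (E : 'M[C]_n).
Hypothesis EE : E *m E = E.
Hypothesis Eadj : adjmx E = E.

(** The unitaries acting trivially on the complement of the range of [E]: all of them for [E = 1],
    those fixing the vector of ones for [E = 1 - J]. *)
Definition fixing (v : 'M[C]_n) : Prop :=
  v *m adjmx v = 1%:M /\ v *m (1%:M - E) = 1%:M - E.

Variable T : 'M[C]_N.
Hypothesis Tcomm : forall v, fixing v -> T *m tens (fun=> v) = tens (fun=> v) *m T.

Lemma tens_diag (f : 'rV[C]_n) :
  tens (fun=> diag_mx f) = diag_mx (\row_a \prod_q f 0 ((enum_val a : W) q)).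
Proof.
apply/matrixP=> a b; rewrite !mxE; have [->|ab] := eqVneq a b.
  by rewrite mulr1n; apply: eq_bigr => q _; rewrite mxE eqxx mulr1n.
have : enum_val a != enum_val b by rewrite (inj_eq enum_val_inj).
move: (enum_val a) (enum_val b) => i k ik.
have /existsP[q iq] : [exists q, i q != k q].
  rewrite -negb_forall; apply: contraNN ik => /forallP h.
  by apply/eqP/ffunP => q; apply/eqP/h.
by rewrite mulr0n (bigD1 q) //= mxE (negPf iq) mulr0n mul0r.
Qed.

(** The multiplicity of zero follows from the others because the number of points is fixed. Nonzero
    values are those that the unitaries in [comm_hermitian] can mark. *)
Lemma prod_eq_counts (u w : Q -> C) :
  (forall c, c != 0 -> #|[set q | u q == c]| = #|[set q | w q == c]|) ->
  \prod_q u q = \prod_q w q.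
Proof.
move=> h; have cnt (v : Q -> C) c : count_mem c [seq v q | q <- enum Q] = #|[set q | v q == c]|.
  rewrite cardE [in RHS]/enum_mem size_filter count_map enumT.
  by apply: eq_count => q; rewrite /= inE.
have nz : perm_eq [seq c <- [seq u q | q <- enum Q] | c != 0]
                  [seq c <- [seq w q | q <- enum Q] | c != 0].
  apply/allP=> c _; apply/eqP; rewrite !count_filter.
  have [->|c0] := eqVneq c 0.
    by rewrite !(eq_count (a2 := pred0)) ?count_pred0 // => x /=; case: eqP.
  have e (v : Q -> C) : count (predI (pred1 c) (fun c => c != 0)) [seq v q | q <- enum Q] =
      count_mem c [seq v q | q <- enum Q].
    by apply: eq_count => x /=; case: eqP => // ->; rewrite c0.
  by rewrite !e !cnt h.
have z : count_mem (0 : C) [seq u q | q <- enum Q] = count_mem (0 : C) [seq w q | q <- enum Q].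
  have e (v : Q -> C) : count_mem (0 : C) [seq v q | q <- enum Q] =
      (size (enum Q) - size [seq c <- [seq v q | q <- enum Q] | (c : C) != 0%R])%N.
    by rewrite size_filter -(size_map v) -(count_predC (pred1 0)) addnK.
  by rewrite !e (perm_size nz).
have pE (v : Q -> C) : \prod_q v q = \prod_(c <- [seq v q | q <- enum Q]) c.
  by rewrite big_map big_enum.
rewrite !pE; apply: perm_big.
apply/allP=> c _; apply/eqP; have [->|c0] := eqVneq c 0; first exact: z.
by rewrite !cnt h.
Qed.

(** In an eigenbasis of [h], a unitary equal to [z] on one nonzero eigenspace and to 1 elsewhere
    satisfies [fixing]. As the relevant powers of [z] are distinct, a nonzero entry of the
    conjugated [T] links multi-indices with equal eigenvalue multiplicities, on which the tensor
    power of [h] acts by equal scalars. *)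
Lemma comm_hermitian h : adjmx h = h -> h *m E = h ->
  T *m tens (fun=> h) = tens (fun=> h) *m T.
Proof.
move=> hadj hE.
have adjE (M : 'M[C]_n) : map_mx Num.conj M^T = adjmx M by apply/matrixP=> i j; rewrite !mxE.
have hnormal : h \is normalmx by apply/normalmxP; rewrite adjE hadj.
pose W0 := spectralmx h; pose d := spectral_diag h.
have WU : W0 \is unitarymx by apply: spectral_unitarymx.
have WW : W0 *m adjmx W0 = 1%:M by have /unitarymxP := WU; rewrite adjE.
have WW' : adjmx W0 *m W0 = 1%:M by apply: mulmx1C.
have hS : h = adjmx W0 *m diag_mx d *m W0.
  by have /orthomx_spectralP := hnormal; rewrite -/W0 -/d invmx_unitary // adjE.
have hE0 : h *m (1%:M - E) = 0 by rewrite mulmxBr mulmx1 hE subrr.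
(* Eigenvectors with nonzero eigenvalue are orthogonal to the range of [1 - E], so that range is
   seen only by the coordinates of eigenvalue zero. *)
have row0 a b : d 0 a * (W0 *m (1%:M - E)) a b = 0.
  have : (diag_mx d *m (W0 *m (1%:M - E))) a b = 0.
    have -> : diag_mx d *m (W0 *m (1%:M - E)) = W0 *m (h *m (1%:M - E)).
      by rewrite hS !mulmxA WW mul1mx.
    by rewrite hE0 mulmx0 mxE.
  by rewrite mul_diag_mx mxE.
pose T' := tens (fun=> W0) *m T *m tens (fun=> adjmx W0).
have key (f : 'rV[C]_n) : (forall a, f 0 a * Num.conj (f 0 a) = 1) ->
    (forall a, d 0 a = 0 -> f 0 a = 1) ->
    T' *m tens (fun=> diag_mx f) = tens (fun=> diag_mx f) *m T'.
  move=> f1 f0; pose v := adjmx W0 *m diag_mx f *m W0.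
  have ff : diag_mx f *m adjmx (diag_mx f) = 1%:M.
    apply/matrixP=> a b; rewrite mul_diag_mx !mxE eq_sym.
    by case: eqVneq => [->|_]; rewrite ?mulr1n ?f1 // mulr0n rmorph0 mulr0.
  have fv : fixing v.
    split.
      rewrite /v !adjmxM adjmxK !mulmxA -(mulmxA _ W0) WW mulmx1.
      by rewrite -(mulmxA _ (diag_mx f)) ff mulmx1.
    have -> : v *m (1%:M - E) = adjmx W0 *m (diag_mx f *m (W0 *m (1%:M - E))).
      by rewrite /v !mulmxA.
    have -> : diag_mx f *m (W0 *m (1%:M - E)) = W0 *m (1%:M - E).
      apply/matrixP=> a b; rewrite mul_diag_mx mxE.
      have [/f0 ->|d0] := eqVneq (d 0 a) 0; first by rewrite mul1r.
      have := row0 a b; move/eqP; rewrite mulf_eq0 (negPf d0) => /eqP ->.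
      by rewrite mulr0.
    by rewrite mulmxA WW' mul1mx.
  have vW : tens (fun=> v) = tens (fun=> adjmx W0) *m tens (fun=> diag_mx f) *m tens (fun=> W0).
    by rewrite !tensM.
  have wwT : tens (fun=> adjmx W0) *m tens (fun=> W0) = 1%:M.
    by rewrite tensM -tens1; apply: eq_tens.
  have wwT' : tens (fun=> W0) *m tens (fun=> adjmx W0) = 1%:M.
    by rewrite tensM -tens1; apply: eq_tens.
  have := congr1 (fun M => tens (fun=> W0) *m M *m tens (fun=> adjmx W0)) (Tcomm fv).
  rewrite /= vW /T' !mulmxA wwT' mul1mx => e.
  rewrite -e -!mulmxA wwT' mulmx1 //.
have T'd : T' *m tens (fun=> diag_mx d) = tens (fun=> diag_mx d) *m T'.
  rewrite tens_diag; move: T' key => {}T' key.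
  apply/matrixP=> a b; rewrite mul_mx_diag mul_diag_mx !mxE.
  have [->|T0] := eqVneq (T' a b) 0; first by rewrite mulr0 mul0r.
  rewrite mulrC; congr (_ * _); apply: prod_eq_counts => c c0.
  have [z [zz zinj]] := separating_unit C #|Q|.
  pose f : 'rV[C]_n := \row_x (if d 0 x == c then z else 1).
  have pf (k : W) : \prod_q f 0 (k q) = z ^+ #|[set q | d 0 (k q) == c]|.
    rewrite -prodr_const big_mkcond [RHS]big_mkcond /=.
    by apply: eq_bigr => q _; rewrite mxE inE.
  have f1 x : f 0 x * Num.conj (f 0 x) = 1.
    by rewrite mxE; case: ifP; rewrite ?zz // rmorph1 mulr1.
  have f0 x : d 0 x = 0 -> f 0 x = 1.
    by move=> dx; rewrite mxE dx eq_sym (negPf c0).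
  have /matrixP/(_ a b) := key f f1 f0; rewrite tens_diag mul_mx_diag mul_diag_mx.
  rewrite !mxE !pf => e; apply: zinj; rewrite ?max_card //.
  by apply: (mulIf T0); rewrite -e mulrC.
have -> : tens (fun=> h) = tens (fun=> adjmx W0) *m tens (fun=> diag_mx d) *m tens (fun=> W0).
  by rewrite !tensM; apply: eq_tens => q.
have wwT : tens (fun=> adjmx W0) *m tens (fun=> W0) = 1%:M.
  by rewrite tensM -tens1; apply: eq_tens.
have := congr1 (fun M => tens (fun=> adjmx W0) *m M *m tens (fun=> W0)) T'd.
rewrite /= /T' !mulmxA wwT mul1mx => e.
by rewrite e -!mulmxA wwT mulmx1.
Qed.

Lemma comm_symtens_hermitian x :
  (forall q, adjmx (x q) = x q) -> (forall q, x q *m E = x q) ->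
  T *m symtens x = symtens x *m T.
Proof.
move=> xa xE; rewrite polarization mulmx_sumr mulmx_suml; apply: eq_bigr => S _.
rewrite -scalemxAr -scalemxAl comm_hermitian //.
  rewrite /adjmx map_mx_sum raddf_sum; apply: eq_bigr => q _; exact: xa.
by rewrite mulmx_suml; apply: eq_bigr => q _.
Qed.

(** Each factor is written as [a + i b] with Hermitian [a] and [b], and multilinearity expands
    [symtens] over the set [J] of factors where [b] is chosen. The conditions on both sides of [x]
    together keep [a] and [b] supported by [E]. *)
Lemma comm_symtens x : (forall q, x q *m E = x q) -> (forall q, E *m x q = x q) ->
  T *m symtens x = symtens x *m T.
Proof.
move=> xE Ex.
have xaE q : adjmx (x q) *m E = adjmx (x q) by rewrite -{1}Eadj -adjmxM Ex.
pose a q := 2^-1 *: (x q + adjmx (x q)).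
pose b q := (- 'i / 2) *: (x q - adjmx (x q)).
have xab q : x q = a q + 'i *: b q.
  rewrite /a /b scalerA mulrA mulrN -expr2 sqrCi opprK mul1r -scalerDr.
  by rewrite addrACA subrr addr0 -mulr2n -scaler_nat scalerA mulVf ?scale1r ?pnatr_eq0.
have conj2 : Num.conj (2^-1 : C) = 2^-1 by rewrite fmorphV rmorph_nat.
have aa q : adjmx (a q) = a q.
  by rewrite /a adjmxZ adjmxD adjmxK addrC conj2.
have ba q : adjmx (b q) = b q.
  have cb : Num.conj (- 'i / 2 : C) = 'i / 2.
    by rewrite rmorphM /= rmorphN /= conjCi opprK conj2.
  rewrite /b adjmxZ cb adjmxD -scaleN1r adjmxZ adjmxK rmorphN1 scaleN1r.
  by rewrite scaleN1r -[adjmx _ - _]opprB scalerN -scaleNr mulNr.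
have aE q : a q *m E = a q by rewrite /a -scalemxAl mulmxDl xE xaE.
have bE q : b q *m E = b q by rewrite /b -scalemxAl mulmxBl xE xaE.
have -> : symtens x = \sum_(J : {set Q}) (\prod_q (if q \in J then 'i else 1)) *:
    symtens (fun q => if q \in J then b q else a q).
  under eq_bigr do rewrite mxW_scale.
  rewrite mxW_sum; apply: mxW_eq => i k.
  under [RHS]eq_bigr do rewrite mulr_sumr; rewrite exchange_big /=.
  apply: eq_bigr => s _.
  transitivity (\prod_q ('i * b q (i (s q)) (k (s q)) + a q (i (s q)) (k (s q)))).
    by apply: eq_bigr => q _; rewrite {1}xab !mxE addrC.
  rewrite bigA_distr; apply: eq_bigr => J _; rewrite -big_split; apply: eq_bigr => q _ /=.
  by case: ifP; rewrite ?mul1r.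
rewrite mulmx_sumr mulmx_suml; apply: eq_bigr => J _.
rewrite -scalemxAr -scalemxAl comm_symtens_hermitian // => q; by case: ifP.
Qed.

Let P := tens (fun=> E).

Let PP : P *m P = P. Proof. by rewrite /P tensM; apply: eq_tens. Qed.

Hypothesis TP : T *m P = T.
Hypothesis PT : P *m T = T.

(** Elementary matrices expand [X] into pure tensors, cut down by [P] on both sides. As [P X P] is
    symmetric, averaging over permutations replaces these by symmetrised tensors, with which [T]
    commutes. *)
Lemma comm_symmetric X : (forall s, rho s *m X = X *m rho s) -> T *m X *m P = P *m X *m T.
Proof.
move=> hX; pose x (ik : W * W) q : 'M[C]_n := E *m delta_mx (ik.1 q) (ik.2 q) *m E.
pose K i k := X (enum_rank i) (enum_rank k).
have nQ : (#|{: {perm Q}}|%:R : C) != 0.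
  by rewrite pnatr_eq0 -lt0n; apply/card_gt0P; exists 1%g.
have XS : X = \sum_(ik : W * W) K ik.1 ik.2 *: tens (fun q => delta_mx (ik.1 q) (ik.2 q)).
  under eq_bigr do rewrite mxW_scale.
  rewrite mxW_sum [LHS]mxW_surj; apply: mxW_eq => i k.
  rewrite (bigD1 (i, k)) //= big1 => [|q _]; last by rewrite mxE !eqxx.
  rewrite mulr1 big1 ?addr0 // => -[i' k'] /=; rewrite xpair_eqE negb_and => ne.
  have [q hq] : exists q, (i q != i' q) || (k q != k' q).
    apply/existsP; apply: contraT; rewrite negb_exists => /forallP h.
    have ii : i' = i by apply/ffunP=> q; have := h q; rewrite negb_or !negbK => /andP[/eqP].
    have kk : k' = k by apply/ffunP=> q; have := h q; rewrite negb_or !negbK => /andP[_ /eqP].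
    by rewrite ii kk !eqxx in ne.
  rewrite (bigD1 q) //= mxE; have -> : (i q == i' q) && (k q == k' q) = false.
    by apply/negbTE; rewrite negb_and.
  by rewrite mul0r mulr0.
have PXP : #|{: {perm Q}}|%:R *: (P *m X *m P) = \sum_(ik : W * W) K ik.1 ik.2 *: symtens (x ik).
  have hPX s : rho s^-1 *m (P *m X *m P) *m rho s = P *m X *m P.
    have h := rho_tens s^-1 E.
    rewrite -/P in h; rewrite !mulmxA h -(mulmxA P) hX !mulmxA -(mulmxA (P *m X)) h.
    by rewrite -!mulmxA rhoVK mulmx1.
  transitivity (\sum_(s : {perm Q}) rho s^-1 *m (P *m X *m P) *m rho s).
    by rewrite (eq_bigr (fun=> P *m X *m P)) // sumr_const -scaler_nat.
  rewrite {1}XS.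
  transitivity (\sum_(s : {perm Q}) \sum_(ik : W * W) K ik.1 ik.2 *:
      (rho s^-1 *m tens (x ik) *m rho s)).
    apply: eq_bigr => s _; rewrite mulmx_sumr mulmx_suml mulmx_sumr mulmx_suml.
    apply: eq_bigr => ik _; rewrite -scalemxAr -!scalemxAl -scalemxAr -scalemxAl.
    by congr (_ *: (_ *m _ *m _)); rewrite /P !tensM.
  rewrite exchange_big; apply: eq_bigr => ik _ /=.
  by rewrite -scaler_sumr symtens_rho.
have comm : T *m (P *m X *m P) = P *m X *m P *m T.
  have := congr1 (fun M => #|{: {perm Q}}|%:R^-1 *: M) PXP.
  rewrite /= scalerA mulVf // scale1r => ->.
  rewrite -scalemxAr -scalemxAl; congr (_ *: _); rewrite mulmx_sumr mulmx_suml.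
  apply: eq_bigr => ik _; rewrite -scalemxAr -scalemxAl comm_symtens // => q.
    by rewrite /x -!mulmxA EE.
  by rewrite /x !mulmxA EE.
by have := comm; rewrite !mulmxA TP -!mulmxA PT !mulmxA.
Qed.

Theorem schur_weyl : exists a : {perm Q} -> C, T = \sum_s a s *: (rho s *m P).
Proof.
apply: (@double_commutant C N _ rho) => //.
- exact: rhoM.
- exact: rho1.
- by move=> s; apply: rho_tens.
- exact: comm_symmetric.
Qed.

End Commutation.
End TensorPower.

(** * From invariant tensors to colour-reversing matchings *)

Section Action.
Variables (C : numClosedFieldType) (n : nat) (P : finType).
Local Notation W := {ffun P -> 'I_n}.
Implicit Types (m : P -> 'M[C]_n) (F : W -> C).

Definition tensor_act m F (i : W) : C := \sum_(j : W) (\prod_x m x (i x) (j x)) * F j.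

Lemma eq_tensor_act m m' F F' : (forall x, m x = m' x) -> F =1 F' -> tensor_act m F =1 tensor_act m' F'.
Proof.
move=> em eF i; apply: eq_bigr => j _; rewrite eF; congr (_ * _).
by apply: eq_bigr => x _; rewrite em.
Qed.

Lemma tensor_act_comp m m' F : tensor_act m (tensor_act m' F) =1 tensor_act (fun x => m x *m m' x) F.
Proof.
move=> i; rewrite /tensor_act; under eq_bigr do rewrite mulr_sumr.
rewrite exchange_big /=; apply: eq_bigr => k _.
under eq_bigr do rewrite mulrA; rewrite -mulr_suml; congr (_ * _).
under [RHS]eq_bigr do rewrite mxE.
by rewrite bigA_distr_bigA; apply: eq_bigr => j _; rewrite big_split.
Qed.

Lemma tensor_act1 F : tensor_act (fun=> 1%:M) F =1 F.
Proof.
move=> i; rewrite /tensor_act (bigD1 i) //= big1 => [|x _]; last by rewrite mxE eqxx.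
rewrite mul1r big1 ?addr0 // => j ji.
have /existsP[x ix] : [exists x, i x != j x].
  rewrite -negb_forall; apply: contraNN ji => /forallP h.
  by rewrite eq_sym; apply/eqP/ffunP => q; apply/eqP/h.
by rewrite (bigD1 x) //= mxE (negPf ix) !mul0r.
Qed.

Lemma tensor_act_scale (z : P -> C) m F i :
  tensor_act (fun x => z x *: m x) F i = (\prod_x z x) * tensor_act m F i.
Proof.
rewrite /tensor_act mulr_sumr; apply: eq_bigr => j _; rewrite mulrA -big_split; congr (_ * _).
by apply: eq_bigr => x _; rewrite mxE.
Qed.

Variable (c : pred P).

Definition coloured (v : 'M[C]_n) (x : P) : 'M[C]_n := if c x then v else map_mx Num.conj v.

Lemma colouredM v w x : coloured v x *m coloured w x = coloured (v *m w) x.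
Proof. by rewrite /coloured; case: (c x); rewrite ?map_mxM. Qed.

Definition on_set (S : {set P}) m (x : P) : 'M[C]_n := if x \in S then m x else 1%:M.

Definition matching (S : {set P}) (p : P -> P) : Prop :=
  (forall x, x \in S -> [/\ p x \in S, c (p x) = ~~ c x & p (p x) = x]) /\
  (forall x, x \notin S -> p x = x).

Section FirstFundamental.
Variables (S : {set P}) (E : 'M[C]_n) (n0 : 'I_n) (F : W -> C).
Hypothesis EE : E *m E = E.
Hypothesis Eadj : adjmx E = E.
Hypothesis F_indep : forall i j : W, (forall x, x \in S -> i x = j x) -> F i = F j.
Hypothesis F_inv : forall v, fixing E v -> tensor_act (on_set S (coloured v)) F =1 F.
Hypothesis F_supp : tensor_act (on_set S (coloured E)) F =1 F.

Let Ap := [set x in S | c x].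
Let Am := [set x in S | ~~ c x].
Let Q := {x | x \in Ap}.
Let Q' := {x | x \in Am}.

Let mem_Ap (q : Q) : val q \in S /\ c (val q).
Proof. by have := valP q; rewrite inE => /andP. Qed.

Let mem_Am (q : Q') : val q \in S /\ c (val q) = false.
Proof. by have := valP q; rewrite inE => /andP[? /negbTE]. Qed.

Let E1E : E *m (1%:M - E) = 0. Proof. by rewrite mulmxBr mulmx1 EE subrr. Qed.

(** The unitary [z E + (1 - E)] multiplies a tensor supported by [E] by [z] at each point of one
    colour and by its conjugate at each point of the other; invariance equates the two exponents. *)
Lemma balanced_support i : F i != 0 -> #|Ap| = #|Am|.
Proof.
move=> Fi; have [z [zz zinj]] := separating_unit C #|P|.
have zE (w : C) : (w *: E + (1%:M - E)) *m (1%:M - E) = 1%:M - E.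
  by rewrite mulmxDl -scalemxAl E1E scaler0 add0r mulmxBl mul1mx E1E subr0.
have zE2 (w : C) : (w *: E + (1%:M - E)) *m E = w *: E.
  by rewrite mulmxDl -scalemxAl EE mulmxBl mul1mx EE subrr addr0.
have fz : fixing E (z *: E + (1%:M - E)).
  split=> //; rewrite adjmxD adjmxZ Eadj -scaleN1r adjmxD adjmxZ adjmx1 Eadj.
  rewrite rmorphN1 scaleN1r mulmxDr -scalemxAr zE2 zE scalerA mulrC zz scale1r.
  by rewrite addrC subrK.
have e := F_inv fz i; rewrite -(eq_tensor_act (fun=> erefl) F_supp) tensor_act_comp in e.
pose w x := if x \in Ap then z else if x \in Am then Num.conj z else 1.
have e2 : tensor_act (fun x => w x *: on_set S (coloured E) x) F i = F i.
  rewrite -[RHS]e; apply: eq_tensor_act => // x; rewrite /w /on_set !inE.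
  case: (x \in S); rewrite /= ?mulmx1 ?scale1r // colouredM zE2 /coloured.
  by case: (c x); rewrite ?map_mxZ.
rewrite tensor_act_scale F_supp in e2.
have pw : \prod_x w x = z ^+ #|Ap| * Num.conj z ^+ #|Am|.
  rewrite -!prodr_const [X in _ = X * _]big_mkcond [X in _ = _ * X]big_mkcond -big_split /=.
  apply: eq_bigr => x _; rewrite /w !inE; case: (x \in S); rewrite /= ?mulr1 //.
  by case: (c x); rewrite /= ?mulr1 ?mul1r.
apply: zinj; rewrite ?max_card //; apply: (mulIf Fi).
rewrite -[in RHS]e2 pw mulrA [z ^+ #|Am| * _]mulrCA -exprMn zz expr1n mulr1 //.
Qed.

Hypothesis cardA : #|Ap| = #|Am|.

Let cardQ : #|{: Q}| = #|{: Q'}|.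
Proof. by rewrite !card_sig. Qed.

Let h (q : Q) : Q' := enum_val (cast_ord cardQ (enum_rank q)).
Let h' (q : Q') : Q := enum_val (cast_ord (esym cardQ) (enum_rank q)).

Let hK : cancel h h'. Proof. by move=> q; rewrite /h' /h enum_valK cast_ordK enum_rankK. Qed.
Let hK' : cancel h' h. Proof. by move=> q; rewrite /h' /h enum_valK cast_ordKV enum_rankK. Qed.

(** A multi-index assembled from its values on the two colour classes, the second one read through
    the bijection [h]. The default [n0] outside [S] is harmless because [F] depends only on the
    points of [S]. *)
Let glue (a b : {ffun Q -> 'I_n}) : W :=
  [ffun x => if (insub x : option Q) is Some q then a q
             else if (insub x : option Q') is Some q then b (h' q) else n0].

Let glue_p a b (q : Q) : glue a b (val q) = a q.
Proof. by rewrite ffunE valK. Qed.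

Let glue_m a b (q : Q) : glue a b (val (h q)) = b q.
Proof.
rewrite ffunE insubF; last first.
  by have [_ cq] := mem_Am (h q); rewrite inE cq andbF.
by rewrite valK hK.
Qed.

Let glue_out a b x : x \notin S -> glue a b x = n0.
Proof. by move=> xS; rewrite ffunE !insubF // inE (negPf xS). Qed.

Let ffun_eqP (i j : W) : (forall q : Q, i (val q) = j (val q)) ->
  (forall q : Q, i (val (h q)) = j (val (h q))) ->
  (forall x, x \in S -> i x = j x).
Proof.
move=> hp hm x xS; have [cx|cx] := boolP (c x).
  have xA : x \in Ap by rewrite inE xS.
  by have := hp (Sub x xA).
have xA : x \in Am by rewrite inE xS.
by have := hm (h' (Sub x xA)); rewrite hK'.
Qed.

Let prod_split (G : P -> C) : (forall x, x \notin S -> G x = 1) ->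
  \prod_x G x = (\prod_(q : Q) G (val q)) * (\prod_(q : Q) G (val (h q))).
Proof.
move=> G1; rewrite -(big_sub (mem Ap) G) /=.
rewrite (bigID (mem S)) /= [X in _ * X]big1 ?mulr1 // (bigID c) /=; congr (_ * _).
  by apply: eq_bigl => x; rewrite inE.
transitivity (\prod_(x in Am) G x); first by apply: eq_bigl => x; rewrite inE.
rewrite (big_sub (mem Am) G) (reindex h) //=.
by exists h' => q _; rewrite ?hK ?hK'.
Qed.

Let act_glue m a b : (forall x, x \notin S -> m x = 1%:M) ->
  tensor_act m F (glue a b) = \sum_(a' : {ffun Q -> 'I_n}) \sum_(b' : {ffun Q -> 'I_n})
    (\prod_(q : Q) m (val q) (a q) (a' q)) * F (glue a' b') *
    (\prod_(q : Q) m (val (h q)) (b q) (b' q)).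
Proof.
move=> m1; rewrite /tensor_act (bigID (fun j : W => [forall x, (x \notin S) ==> (j x == n0)])) /=.
rewrite [X in _ + X]big1 ?addr0 => [|j]; last first.
  rewrite negb_forall => /existsP[x]; rewrite negb_imply => /andP[xS jx].
  by rewrite (bigD1 x) //= m1 // glue_out // mxE eq_sym (negPf jx) !mul0r.
rewrite pair_big /= (reindex_onto (fun ab : {ffun Q -> 'I_n} * {ffun Q -> 'I_n} => glue ab.1 ab.2)
  (fun j => ([ffun q => j (val q)], [ffun q => j (val (h q))]))) /=; last first.
  move=> j /forallP jS; apply/ffunP=> x; have [xS|xS] := boolP (x \in S); last first.
    by rewrite glue_out //; apply/esym/eqP; have := jS x; rewrite xS.
  by apply: ffun_eqP xS => q; rewrite ?glue_p ?glue_m ffunE.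
apply: eq_big => [[a' b']|[a' b'] _] /=.
  rewrite xpair_eqE; apply/and3P; split.
  - by apply/forallP=> x; apply/implyP=> xS; rewrite glue_out.
  - by apply/eqP/ffunP=> q; rewrite ffunE glue_p.
  - by apply/eqP/ffunP=> q; rewrite ffunE glue_m.
rewrite prod_split => [|x xS]; last by rewrite m1 // !glue_out // mxE eqxx.
rewrite mulrAC; congr (_ * _ * _); apply: eq_bigr => q _; by rewrite ?glue_p ?glue_m.
Qed.

Let T := mxW (fun a b : {ffun Q -> 'I_n} => F (glue a b)).

(** Read as an operator between the colour classes, [F] transforms by conjugation, so invariance
    becomes commutation with the tensor power of [v]. *)
Let T_act (v : 'M[C]_n) : tensor_act (on_set S (coloured v)) F =1 F ->
  T = tens (fun _ : Q => v) *m T *m tens (fun _ : Q => adjmx v).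
Proof.
move=> Fv; rewrite /T /tens !mxWM; apply: mxW_eq => a b.
rewrite -[LHS]Fv act_glue => [|x xS]; last by rewrite /on_set (negPf xS).
under [RHS]eq_bigr do rewrite mulr_suml; rewrite [RHS]exchange_big /=.
apply: eq_bigr => a' _; apply: eq_bigr => b' _; congr (_ * _ * _);
  apply: eq_bigr => q _; rewrite /on_set /coloured.
  by have [-> ->] := mem_Ap q.
by have [-> ->] := mem_Am (h q); rewrite !mxE.
Qed.

Let adj_left v : fixing E v -> adjmx v *m v = 1%:M.
Proof. by case=> h1 _; apply: mulmx1C. Qed.

(** Schur-Weyl duality writes the operator through permutations [s]. Each gives the matching that
    joins [q] to [h (s q)], and the entries of [rho s *m P] are products of entries of [E] along the
    matched pairs. *)
Lemma first_fundamental_balanced : exists (I : finType) (a : I -> C) (p : I -> P -> P),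
  (forall s, matching S (p s)) /\
  forall i, F i = \sum_s a s * \prod_(x in Ap) E (i x) (i (p s x)).
Proof.
have TE := T_act F_supp; rewrite Eadj in TE.
have EEt : tens (fun _ : Q => E) *m tens (fun _ : Q => E) = tens (fun _ : Q => E).
  by rewrite tensM; apply: eq_tens.
have [v fv|||a aT] := @schur_weyl C n Q E EE Eadj T.
- have vv : tens (fun _ : Q => adjmx v) *m tens (fun _ : Q => v) = 1%:M.
    by rewrite tensM -tens1; apply: eq_tens => q; apply: adj_left.
  by rewrite [in LHS](T_act (F_inv fv)) -(mulmxA (_ *m T)) vv mulmx1.
- by rewrite [in LHS]TE -(mulmxA (_ *m T)) EEt -TE.
- by rewrite [in LHS]TE !mulmxA EEt -TE.
pose p (s : {perm Q}) (x : P) : P :=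
  if (insub x : option Q) is Some q then val (h (s q))
  else if (insub x : option Q') is Some q then val ((s^-1)%g (h' q)) else x.
have pp s (q : Q) : p s (val q) = val (h (s q)) by rewrite /p valK.
have pm s (q : Q) : p s (val (h q)) = val ((s^-1)%g q).
  rewrite /p insubF; last by have [_ cq] := mem_Am (h q); rewrite inE cq andbF.
  by rewrite valK hK.
exists {perm Q}, a, p; split=> [s|i].
  split=> [x xS|x xS]; last by rewrite /p !insubF // inE (negPf xS).
  have [cx|cx] := boolP (c x).
    have xA : x \in Ap by rewrite inE xS.
    pose q : Q := Sub x xA; have -> : x = val q by [].
    have cq : c (val q) = true := cx; have [h1 h2] := mem_Am (h (s q)).
    by rewrite pp pm permK h1 h2 ?cq.
  have xA : x \in Am by rewrite inE xS.
  pose q : Q := h' (Sub x xA); have -> : x = val (h q) by rewrite /q hK'.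
  have [h1 h2] := mem_Ap ((s^-1)%g q); have [_ h3] := mem_Am (h q).
  by rewrite pm pp permKV h1 h2 ?h3.
pose ai : {ffun Q -> 'I_n} := [ffun q => i (val q)].
pose bi : {ffun Q -> 'I_n} := [ffun q => i (val (h q))].
have -> : F i = F (glue ai bi).
  by apply: F_indep; apply: ffun_eqP => q; rewrite ?glue_p ?glue_m ffunE.
have := aT; under eq_bigr do rewrite rho_mul mxW_scale.
rewrite mxW_sum => /mxW_inj/(_ ai bi) ->; apply: eq_bigr => s _; congr (_ * _).
rewrite (big_sub (mem Ap) (fun x => E (i x) (i (p s x)))) /=.
rewrite (reindex_inj (@perm_inj _ s)) /=; apply: eq_bigr => q _.
by rewrite !ffunE permK pp.
Qed.

End FirstFundamental.

Theorem first_fundamental (S : {set P}) (E : 'M[C]_n) (n0 : 'I_n) (F : W -> C) :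
  E *m E = E -> adjmx E = E ->
  (forall i j : W, (forall x, x \in S -> i x = j x) -> F i = F j) ->
  (forall v, fixing E v -> tensor_act (on_set S (coloured v)) F =1 F) ->
  tensor_act (on_set S (coloured E)) F =1 F ->
  exists (I : finType) (a : I -> C) (p : I -> P -> P),
    (forall s, matching S (p s)) /\
    forall i, F i = \sum_s a s * \prod_(x in [set x in S | c x]) E (i x) (i (p s x)).
Proof.
move=> EE Ea Fi Fv FE.
have [e|ne] := eqVneq #|[set x in S | c x]| #|[set x in S | ~~ c x]|.
  exact: (first_fundamental_balanced n0 EE Ea Fi Fv FE e).
(* Colour classes of different sizes leave only the zero tensor, written as an empty sum. *)
exists void, (fun=> 0), (fun _ x => x); split; first by case.
move=> i; rewrite big1 => [|[]//]; apply/eqP; apply: contraNT ne => Fi0.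
exact/eqP/(balanced_support EE Ea Fv FE Fi0).
Qed.

End Action.

(** * The model in 2 x 2 matrices *)

Section Model.
Variable R : realType.
Local Notation C := R[i].
Local Notation M2 := 'M[C]_2.

Definition antidiag (x y : C) : M2 :=
  \matrix_(a, b) (if a == b then 0 else if a == 0 then x else y).
Definition diag2 (x y : C) : M2 :=
  \matrix_(a, b) (if a == b then if a == 0 then x else y else 0).

Lemma mx2P (X Y : M2) : X 0 0 = Y 0 0 -> X 0 1 = Y 0 1 -> X 1 0 = Y 1 0 -> X 1 1 = Y 1 1 -> X = Y.
Proof.
move=> h1 h2 h3 h4; apply/matrixP=> a b.
have o (c : 'I_2) : c = 0 \/ c = 1.
  by case: c => -[|[|//]] lt; [left|right]; apply: val_inj.
by case: (o a) => ->; case: (o b) => ->.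
Qed.

Lemma antidiagM x y z w : antidiag x y * antidiag z w = diag2 (x * w) (y * z).
Proof.
by apply: mx2P; rewrite mxE !big_ord_recl big_ord0 !mxE /= ?mul0r ?mulr0 ?add0r ?addr0.
Qed.

Lemma diag2_antidiag x y z w : diag2 x y * antidiag z w = antidiag (x * z) (y * w).
Proof.
by apply: mx2P; rewrite mxE !big_ord_recl big_ord0 !mxE /= ?mul0r ?mulr0 ?add0r ?addr0.
Qed.

Lemma diag2_sum (I : finType) (x y : I -> C) :
  \sum_k diag2 (x k) (y k) = diag2 (\sum_k x k) (\sum_k y k).
Proof.
apply: mx2P; rewrite summxE mxE /=; under eq_bigr do rewrite mxE /=; by rewrite ?sumr_const ?mul0rn.
Qed.

Lemma antidiag_sum (I : finType) (x y : I -> C) :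
  \sum_k antidiag (x k) (y k) = antidiag (\sum_k x k) (\sum_k y k).
Proof.
apply: mx2P; rewrite summxE mxE /=; under eq_bigr do rewrite mxE /=; by rewrite ?sumr_const ?mul0rn.
Qed.

Lemma diag2_nat m : diag2 m%:R m%:R = m%:R.
Proof.
have -> : (m%:R : M2) = m%:R%:M by rewrite -scalemx1 scaler_nat.
by apply: mx2P; rewrite !mxE /= ?mulr1n ?mulr0n.
Qed.

Lemma antidiag_adj x y : adjmx (antidiag x y) = antidiag (Num.conj y) (Num.conj x).
Proof. by apply: mx2P; rewrite !mxE /= ?rmorph0. Qed.

Variable n : nat.
Implicit Types v : 'M[C]_n.

Definition model v : 'M[M2]_n :=
  \matrix_(i, j) antidiag (v i j) (Num.conj (v i j)).

(** In a product of three antidiagonal matrices the outer factors contribute the same corner and the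
    middle one the opposite corner; scalars commute, so the outer factors can be exchanged. *)
Lemma model_half_commuting v : half_commuting (model v).
Proof.
move=> i j k l p q; rewrite !mxE !antidiagM !diag2_antidiag.
by congr antidiag; rewrite mulrAC [RHS]mulrAC; congr (_ * _); apply: mulrC.
Qed.

Definition unitary v : Prop := v *m adjmx v = 1%:M.

Lemma unitary_rows v i j : unitary v -> \sum_k v i k * Num.conj (v j k) = (i == j)%:R.
Proof.
move=> /matrixP/(_ i j); rewrite !mxE => <-; apply: eq_bigr => k _; by rewrite !mxE.
Qed.

Lemma unitary_cols v i j : unitary v -> \sum_k v k i * Num.conj (v k j) = (i == j)%:R.
Proof.
move=> /mulmx1C /matrixP/(_ j i); rewrite !mxE eq_sym => <-.
by apply: eq_bigr => k _; rewrite !mxE mulrC.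
Qed.

Lemma model_O v : unitary v -> rel_O (model v).
Proof.
move=> vU.
have rows' i j : \sum_k Num.conj (v i k) * v j k = (i == j)%:R.
  by rewrite eq_sym -(unitary_rows j i vU); apply: eq_bigr => k _; rewrite mulrC.
have cols' i j : \sum_k Num.conj (v k i) * v k j = (i == j)%:R.
  by rewrite eq_sym -(unitary_cols j i vU); apply: eq_bigr => k _; rewrite mulrC.
split=> i j.
- by rewrite !mxE; apply: etrans (antidiag_adj _ _) _; rewrite conjCK.
- under eq_bigr do rewrite !mxE antidiagM.
  by rewrite diag2_sum unitary_rows // rows' diag2_nat.
- under eq_bigr do rewrite !mxE antidiagM.
  by rewrite diag2_sum unitary_cols // cols' diag2_nat.
Qed.

Lemma model_H v : unitary v ->
  (forall i j k, i != j -> v i k * v j k = 0 /\ v k i * v k j = 0) -> rel_H (model v).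
Proof.
move=> vU vH; split; first exact: model_O.
have d0 : diag2 0 0 = 0 by rewrite -[0 in LHS]/(0%:R) diag2_nat.
have z (x y : C) : x * y = 0 -> x * Num.conj y = 0 /\ Num.conj x * y = 0.
  by move/eqP; rewrite mulf_eq0 => /orP[] /eqP->; rewrite ?rmorph0 ?mulr0 ?mul0r.
move=> i j k ij; have [h1 h2] := vH i j k ij; rewrite !mxE !antidiagM.
by have [-> ->] := z _ _ h1; have [-> ->] := z _ _ h2; rewrite !d0.
Qed.

Lemma model_Bsharp v (s : C) : unitary v ->
  (forall i, \sum_k v i k = s) -> (forall j, \sum_k v k j = s) -> rel_Bsharp (model v).
Proof.
move=> vU vr vc; split=> [|i j]; first exact: model_O.
under eq_bigr do rewrite mxE; under [RHS]eq_bigr do rewrite mxE.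
by rewrite !antidiag_sum -!rmorph_sum /= vr vc.
Qed.

(** The entry of a product of [k] model matrices that lies in the first row and can be nonzero:
    along it the factors alternate between [v] and its conjugate. *)
Definition alternating v k (i j : k.-tuple 'I_n) : C :=
  \prod_(r < k) (if odd r then Num.conj (v (tnth i r) (tnth j r)) else v (tnth i r) (tnth j r)).

Lemma prod_antidiag k (x : 'I_k -> C) :
  let p := \prod_(r < k) (if odd r then Num.conj (x r) else x r) in
  \prod_(r < k) antidiag (x r) (Num.conj (x r)) =
  if odd k then antidiag p (Num.conj p) else diag2 p (Num.conj p).
Proof.
elim: k x => [|k IHk] x /=; first by rewrite !big_ord0 rmorph1 (diag2_nat 1).
rewrite !big_ord_recr /= IHk; case: (odd k) => /=.
  by rewrite antidiagM rmorphM /= conjCK.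
by rewrite diag2_antidiag rmorphM.
Qed.

Lemma matpow_model v k (i j : k.-tuple 'I_n) (p := alternating v i j) :
  matpow (model v) i j = if odd k then antidiag p (Num.conj p) else diag2 p (Num.conj p).
Proof.
rewrite -prod_antidiag /matpow; apply: eq_bigr => r _; by rewrite mxE.
Qed.

Lemma matpow_model_entry v k (i j : k.-tuple 'I_n) b :
  matpow (model v) i j 0 (if b then 1 else 0) = if odd k == b then alternating v i j else 0.
Proof. by rewrite matpow_model; case: (odd k); case: b; rewrite mxE. Qed.

Lemma alternating_orth v k (i i' : k.-tuple 'I_n) : unitary v ->
  \sum_(j : k.-tuple 'I_n) alternating v i j * Num.conj (alternating v i' j) = (i == i')%:R.
Proof.
move=> vU; pose G (r : 'I_k) (a : 'I_n) :=
  (if odd r then Num.conj (v (tnth i r) a) else v (tnth i r) a) *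
  Num.conj (if odd r then Num.conj (v (tnth i' r) a) else v (tnth i' r) a).
have GE r : \sum_a G r a = (tnth i r == tnth i' r)%:R.
  rewrite /G; case: (odd r); last exact: unitary_rows.
  rewrite -(conjCK (\sum_a _)) rmorph_sum /=.
  under eq_bigr do rewrite rmorphM /= !conjCK.
  by rewrite unitary_rows // rmorph_nat.
transitivity (\prod_r \sum_a G r a).
  rewrite bigA_distr_bigA (reindex (fun f : {ffun 'I_k -> 'I_n} => [tuple f r | r < k])) /=.
    apply: eq_bigr => f _; rewrite /alternating rmorph_prod -big_split; apply: eq_bigr => r _ /=.
    by rewrite !tnth_mktuple.
  exists (fun t => [ffun r => tnth t r]) => [f _|t _].
    by apply/ffunP=> r; rewrite ffunE tnth_mktuple.
  by apply: eq_from_tnth => r; rewrite tnth_mktuple ffunE.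
under eq_bigr do rewrite GE; have [->|ne] := eqVneq i i'.
  by rewrite big1 // => r _; rewrite eqxx.
have /existsP[r ir] : [exists r, tnth i r != tnth i' r].
  rewrite -negb_forall; apply: contraNN ne => /forallP h.
  by apply/eqP/eq_from_tnth => r; apply/eqP/h.
by rewrite (bigD1 r) //= (negPf ir) mul0r.
Qed.

Section Invariance.
Variables (A : cstarAlgType R) (u : 'M[A]_n) (k l : nat) (T : 'Hom(tpow R n k, tpow R n l)).
Hypothesis hT : intertwiner u T.
Variables (v : 'M[C]_n) (f : {lrmorphism A -> M2}).
Hypothesis vU : unitary v.
Hypothesis fE : forall i j, f (u i j) = model v i j.

Let t (i : k.-tuple 'I_n) (j : l.-tuple 'I_n) : C := T (tbasis R i) j.

Let alternating_intertwiner (i : k.-tuple 'I_n) (j : l.-tuple 'I_n) :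
  \sum_i' t i' j * alternating v i' i =
  if odd k == odd l then \sum_j' t i j' * alternating v j j' else 0.
Proof.
have fm m (a b : m.-tuple 'I_n) : f (matpow u a b) = matpow (model v) a b.
  by rewrite rmorph_prod; apply: eq_bigr => r _ /=; rewrite fE.
have := congr1 f (hT i j); rewrite !linear_sum /=.
under eq_bigr do rewrite linearZ /= fm.
under [X in _ = X -> _]eq_bigr do rewrite linearZ /= fm.
(* The left side lives in the column given by the parity of [k], the right side in the one given by
   the parity of [l]. *)
move=> /(congr1 (fun M : M2 => M 0 (if odd k then 1 else 0))); rewrite !summxE.
have sE (a : C) (M : ('M[C]_2 : cstarAlgType R)) b c : (a *: M : 'M[C]_2) b c = a * (M : 'M[C]_2) b c.
  exact: mxE.
under [X in X = _ -> _]eq_bigr do rewrite sE matpow_model_entry eqxx.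
under [X in _ = X -> _]eq_bigr do rewrite sE matpow_model_entry.
move=> ->; rewrite eq_sym; case: eqP => // _.
by apply: big1 => j' _; rewrite mulr0.
Qed.

Let recover (i : k.-tuple 'I_n) (j : l.-tuple 'I_n) : t i j =
  \sum_i' (\sum_i'' t i'' j * alternating v i'' i') * Num.conj (alternating v i i').
Proof.
under eq_bigr do rewrite mulr_suml; rewrite exchange_big /=.
under eq_bigr => i'' _.
  under eq_bigr do rewrite -mulrA.
  rewrite -mulr_sumr alternating_orth //.
  over.
rewrite (bigD1 i) //= eqxx mulr1 big1 ?addr0 // => i'' /negPf->.
by rewrite mulr0.
Qed.

Lemma intertwiner_parity i j : odd k != odd l -> t i j = 0.
Proof.
move=> /negPf kl; rewrite recover big1 // => i' _.
by rewrite alternating_intertwiner kl mul0r.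
Qed.

Definition index_tensor (w : {ffun 'I_k + 'I_l -> 'I_n}) : C :=
  t [tuple w (inl r) | r < k] [tuple w (inr s) | s < l].

(** Solving the intertwining relation for [T] conjugates the factors at the upper points, so [v]
    itself acts at odd places above and at even places below. *)
Definition alt_colour (x : 'I_k + 'I_l) : bool :=
  match x with inl r => odd r | inr s => ~~ odd s end.

Lemma index_tensor_invariant : odd k = odd l ->
  tensor_act (on_set setT (coloured alt_colour v)) index_tensor =1 index_tensor.
Proof.
move=> kl w; rewrite {2}/index_tensor recover.
under eq_bigr do rewrite alternating_intertwiner kl eqxx mulr_suml.
rewrite pair_big /= /tensor_act.
rewrite (reindex (fun ij : k.-tuple 'I_n * l.-tuple 'I_n =>
  [ffun x => point_index ij.1 ij.2 x])) /=; last first.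
  exists (fun w : {ffun 'I_k + 'I_l -> 'I_n} => ([tuple w (inl r) | r < k], [tuple w (inr s) | s < l])).
    move=> [a b] _; congr pair; apply: eq_from_tnth => r; by rewrite tnth_mktuple ffunE.
  by move=> w' _; apply/ffunP; case=> r; rewrite ffunE /= tnth_mktuple.
apply: eq_bigr => -[a b] _ /=.
have -> : index_tensor [ffun x => point_index a b x] = t a b.
  by congr (t _ _); apply: eq_from_tnth => r; rewrite tnth_mktuple ffunE.
rewrite mulrC -mulrA; congr (_ * _); rewrite big_sumType mulrC /=; congr (_ * _).
  rewrite rmorph_prod; apply: eq_bigr => r _ /=.
  rewrite /on_set inE /coloured /= ffunE /= tnth_mktuple.
  by case: (odd r); rewrite ?mxE ?conjCK.
apply: eq_bigr => r _; rewrite /on_set inE /coloured /= ffunE /= tnth_mktuple.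
by case: (odd r); rewrite ?mxE.
Qed.

End Invariance.

Lemma span_partition_maps (X : collection) k l (T : 'Hom(tpow R n k, tpow R n l))
    (a : diagram k l -> C) :
  (forall i j, (T (tbasis R i) j : C) = \sum_(p in X k l) a p * (delta_p p i j)%:R) ->
  T \in <<[seq partition_map R n p | p in X k l]>>%VS.
Proof.
move=> h; have -> : T = \sum_(p in X k l) a p *: partition_map R n p.
  have basisE (x : tpow R n k) : x = \sum_i (x i : C) *: tbasis R i.
    apply/ffunP=> i; rewrite sum_ffunE (bigD1 i) //= big1 => [|i' ii'].
      by rewrite addr0 !ffunE eqxx; apply/esym/mulr1.
    by rewrite !ffunE eq_sym (negPf ii'); apply: mulr0.
  apply/lfunP=> x; rewrite (basisE x) !linear_sum; apply: eq_bigr => i _.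
  rewrite !linearZ; congr (_ *: _); apply/ffunP=> j /=; rewrite sum_lfunE sum_ffunE.
  rewrite h; apply: eq_bigr => p _; rewrite scale_lfunE ffunE.
  by rewrite partition_map_entry.
apply: memv_suml => p pX; apply: memvZ; apply: memv_span.
by apply: map_f; rewrite mem_enum.
Qed.

End Model.

(** * Invariant tensors are spanned by partitions *)

(** The two colourings agree up to a global exchange, which the symmetric counting conditions do not
    see. *)
Lemma alt_colourE k l (x : 'I_k + 'I_l) : alt_colour x = (x \in oplus k l) (+) odd k.
Proof.
rewrite inE; case: x => r /=; last by rewrite oddD; case: (odd k); case: (odd r).
by rewrite oddB ?ltn_ord //=; case: (odd k); case: (odd r).
Qed.

Section Orbits.
Variables (k l : nat) (p : 'I_k + 'I_l -> 'I_k + 'I_l).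
Hypothesis pK : involutive p.
Local Notation P := ('I_k + 'I_l)%type.

Definition orbit_diagram : diagram k l := [set [set x; p x] | x : P].

Lemma orbit_diagram_partition : finset.partition orbit_diagram [set: P].
Proof.
have e x : [set x; p x] = [set y in [set: P] | [set x; p x] == [set y; p y]].
  apply/setP=> y; rewrite !inE; apply/idP/eqP => [|e].
    by case/orP=> /eqP-> //; rewrite pK setUC.
  by have := set21 y (p y); rewrite -e !inE.
have -> : orbit_diagram = preim_partition (fun x => [set x; p x]) [set: P].
  by apply/setP=> b; apply/imsetP/imsetP => -[x _ ->]; exists x => //; rewrite ?inE -?e.
exact: preim_partitionP.
Qed.

Hypothesis even_kl : ~~ odd (k + l).

Lemma orbit_diagram_colour (phi : nat -> nat -> bool) :
  (forall x, (phi 1 1 /\ alt_colour (p x) = ~~ alt_colour x) \/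
             [/\ phi 1 0, phi 0 1 & p x = x])%N ->
  orbit_diagram \in colour_cat phi k l.
Proof.
move=> h; apply/colour_catP; split=> // [|_ /imsetP[x _ ->]]; first exact: orbit_diagram_partition.
case: (h x) => [[phi11 e]|[phi10 phi01 ->]]; last first.
  rewrite setUid; case: (boolP (x \in oplus k l)) => xo.
    have -> : [set x] :&: oplus k l = [set x] by apply/setIidPl; rewrite sub1set.
    have -> : [set x] :&: ominus k l = finset.set0.
      by apply/setP=> y; rewrite !inE; case: eqP => // ->; move: xo; rewrite inE => /negbTE->.
    by rewrite cards1 cards0.
  have -> : [set x] :&: oplus k l = finset.set0.
    by apply/setP=> y; rewrite !inE; case: eqP => // ->; move: xo; rewrite inE => /negbTE->.
  have -> : [set x] :&: ominus k l = [set x].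
    by apply/setIidPl; rewrite sub1set; move: xo; rewrite !inE negbK.
  by rewrite cards1 cards0.
have {}e : (p x \in oplus k l) = (x \notin oplus k l).
  by move: e; rewrite !alt_colourE; do 3!case: (_ \in _) || case: odd.
have one (y z : P) : y \in oplus k l -> z \notin oplus k l ->
    phi #|[set y; z] :&: oplus k l| #|[set y; z] :&: ominus k l|.
  rewrite !inE negbK => yo zo.
  have -> : [set y; z] :&: oplus k l = [set y].
    apply/setP=> w; rewrite !inE; case: (eqVneq w y) => [->|wy] //=.
    by case: eqP => // ->; rewrite zo.
  have -> : [set y; z] :&: ominus k l = [set z].
    apply/setP=> w; rewrite !inE orbC; case: (eqVneq w z) => [->|wz] //=.
    by case: eqP => // ->; rewrite (negPf yo).
  by rewrite !cards1.
case: (boolP (x \in oplus k l)) => xo; first by apply: one; rewrite ?e ?xo.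
by rewrite setUC; apply: one; rewrite ?e.
Qed.

End Orbits.

Section Spanned.
Variables (C : numClosedFieldType) (n k l : nat).
Local Notation P := ('I_k + 'I_l)%type.
Local Notation W := {ffun P -> 'I_n}.
Implicit Types (X : {set diagram k l}) (F : W -> C).

Definition constant_on (p : diagram k l) (w : W) : bool :=
  [forall b in p, forall x in b, forall y in b, w x == w y].

Lemma constant_onP (p : diagram k l) (w : W) :
  reflect (forall b x y, b \in p -> x \in b -> y \in b -> w x = w y) (constant_on p w).
Proof.
apply: (iffP forall_inP) => [h b x y pb xb yb|h b pb].
  by move/forall_inP/(_ x xb)/forall_inP/(_ y yb)/eqP: (h b pb).
by apply/forall_inP=> x xb; apply/forall_inP=> y yb; apply/eqP/(h b).
Qed.

Definition spanned X F : Prop :=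
  exists a : diagram k l -> C, forall w, F w = \sum_(p in X) a p * (constant_on p w)%:R.

Lemma eq_spanned X F F' : F =1 F' -> spanned X F -> spanned X F'.
Proof. by move=> e [a h]; exists a => w; rewrite -e. Qed.

Lemma spanned_sum X (J : finType) (F : J -> W -> C) :
  (forall j, spanned X (F j)) -> spanned X (fun w => \sum_j F j w).
Proof.
move=> h; have /choice[a ha] := h; exists (fun p => \sum_j a j p) => w.
under eq_bigr do rewrite ha; rewrite exchange_big /=.
by apply: eq_bigr => p _; rewrite mulr_suml.
Qed.

Lemma spanned_scale X (z : C) F : spanned X F -> spanned X (fun w => z * F w).
Proof.
case=> a h; exists (fun p => z * a p) => w.
by rewrite h mulr_sumr; apply: eq_bigr => p _; rewrite mulrA.
Qed.

Lemma spanned_constant_on X p : p \in X -> spanned X (fun w => (constant_on p w)%:R).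
Proof.
move=> pX; exists (fun q => (q == p)%:R) => w.
rewrite (bigD1 p) //= eqxx mul1r big1 ?addr0 // => q /andP[_ /negPf->].
by rewrite mul0r.
Qed.

Lemma spanned0 X : spanned X (fun=> 0).
Proof. by exists (fun=> 0) => w; rewrite big1 // => p _; rewrite mul0r. Qed.

Lemma constant_on_orbit (p : P -> P) (w : W) :
  constant_on (orbit_diagram p) w = [forall x, w x == w (p x)].
Proof.
apply/constant_onP/forallP => [h x|h b x y /imsetP[z _ ->]].
  by apply/eqP/(h [set x; p x]); rewrite ?set21 ?set22 //; apply: imset_f.
by move=> /set2P[]-> /set2P[]->; rewrite -?(eqP (h z)).
Qed.

(** Only the pairs of [p] that meet [D] are kept; the other points become fixed points, hence
    singletons of the orbit diagram. *)
Definition restrict_pairs (D : {set P}) (p : P -> P) (x : P) : P :=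
  if (x \in D) || (p x \in D) then p x else x.

Lemma matching_involutive c (S : {set P}) (p : P -> P) : matching c S p -> involutive p.
Proof.
case=> pS pNS x; have [/pS[_ _ ->]//|/pNS e] := boolP (x \in S); by rewrite !e.
Qed.

Lemma restrict_pairs_involutive (D : {set P}) p : involutive p -> involutive (restrict_pairs D p).
Proof.
move=> pK x; rewrite /restrict_pairs; case e: ((x \in D) || (p x \in D)); last by rewrite e.
by rewrite pK orbC e.
Qed.

Lemma constant_on_restrict_pairs (D : {set P}) (p : P -> P) (w : W) : involutive p ->
  (constant_on (orbit_diagram (restrict_pairs D p)) w)%:R = \prod_(x in D) (w x == w (p x))%:R :> C.
Proof.
move=> pK; rewrite constant_on_orbit.
have -> : [forall x, w x == w (restrict_pairs D p x)] = [forall x in D, w x == w (p x)].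
  apply/forallP/forall_inP => [h x xD|h x]; first by have := h x; rewrite /restrict_pairs xD.
  rewrite /restrict_pairs; case: ifP => [/orP[/h//|/h]|//]; by rewrite pK eq_sym.
case: (boolP [forall x in D, _]) => [/forall_inP h|].
  by rewrite big1 // => x /h ->.
rewrite negb_forall => /existsP[x]; rewrite negb_imply => /andP[xD /negPf e].
by rewrite (bigD1 x) //= e mul0r.
Qed.

End Spanned.

Section Spanning.
Variables (C : numClosedFieldType) (n k l : nat) (n0 : 'I_n).
Local Notation P := ('I_k + 'I_l)%type.
Local Notation W := {ffun P -> 'I_n}.
Local Notation c := (@alt_colour k l).
Hypothesis even_kl : ~~ odd (k + l).

(** For [E = 1] on all points, the products in the first fundamental theorem are Kronecker deltas
    along a matching, that is, indicators of a pair partition. *)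
Lemma spanned_pairs (F : W -> C) :
  (forall v : 'M[C]_n, v *m adjmx v = 1%:M ->
     tensor_act (on_set setT (coloured c v)) F =1 F) ->
  spanned (colour_cat phiO k l) F.
Proof.
move=> Finv; have c1 x : coloured c (1%:M : 'M[C]_n) x = 1%:M.
  by rewrite /coloured; case: (c x); rewrite ?map_mx1.
have [|||v [vU _]||I [a [p [pM FE]]]] := @first_fundamental C n P c setT 1%:M n0 F.
- by rewrite mulmx1.
- exact: adjmx1.
- by move=> i j ij; congr F; apply/ffunP=> x; rewrite ij ?inE.
- exact: Finv.
- move=> w; rewrite -[RHS](tensor_act1 F); apply: eq_tensor_act => // x.
  by rewrite /on_set inE c1.
apply: eq_spanned (fun w => esym (FE w)) _; apply: spanned_sum => s.
have pK := matching_involutive (pM s).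
apply: spanned_scale; pose q := restrict_pairs [set x in setT | c x] (p s).
apply: (@eq_spanned _ _ _ _ _ (fun w => (constant_on (orbit_diagram q) w)%:R)) => [w|].
  by rewrite constant_on_restrict_pairs //; apply: eq_bigr => x _; rewrite mxE.
apply: spanned_constant_on.
apply: orbit_diagram_colour => // [|x]; first exact: restrict_pairs_involutive.
left; split=> //; have [_ ce _] := (pM s).1 x (in_setT x).
have -> // : q x = p s x.
by rewrite /q /restrict_pairs !inE ce; case: (c x).
Qed.

Let J : 'M[C]_n := const_mx n%:R^-1.
Let E := 1%:M - J.

Let n_neq0 : n%:R != 0 :> C.
Proof. by rewrite pnatr_eq0; case: (n) n0 => // -[]. Qed.

Let JJ : J *m J = J.
Proof.
apply/matrixP=> i j; rewrite !mxE; under eq_bigr do rewrite !mxE.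
by rewrite sumr_const card_ord -[RHS]mulr1 -mulrnAr -[n%:R^-1 *+ n]mulr_natr mulVf.
Qed.

Let J_conj : map_mx Num.conj J = J.
Proof. by apply/matrixP=> i j; rewrite !mxE fmorphV rmorph_nat. Qed.

Let J_adj : adjmx J = J.
Proof. by apply/matrixP=> i j; rewrite !mxE fmorphV rmorph_nat. Qed.

Let J_coloured x : coloured c J x = J.
Proof. by rewrite /coloured J_conj; case: (c x). Qed.

Let E_coloured x : coloured c E x = E.
Proof. by rewrite /coloured /E map_mxB map_mx1 J_conj; case: (c x). Qed.

Let EE : E *m E = E.
Proof. by rewrite /E mulmxBl !mulmxBr !mul1mx mulmx1 JJ subrr subr0. Qed.

Let E_adj : adjmx E = E.
Proof. by rewrite /E adjmxD adjmx1 -scaleN1r adjmxZ J_adj rmorphN1 scaleN1r. Qed.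

(** In the summand [G S] the points outside [S] carry [J], whose constant entries make the index
    there irrelevant; on [S] the first fundamental theorem applies with [E]. Expanding each entry of
    [E] as a delta minus [1/n] leaves a set [D] of selected pairs, and all other points become
    singletons. *)
Lemma spanned_small (F : W -> C) :
  (forall v : 'M[C]_n, v *m adjmx v = 1%:M -> v *m J = J -> J *m v = J ->
     tensor_act (on_set setT (coloured c v)) F =1 F) ->
  spanned (colour_cat phiB k l) F.
Proof.
move=> Finv; pose m (S : {set P}) (x : P) := if x \in S then E else J.
pose G S := tensor_act (m S) F.
have FG w : F w = \sum_S G S w.
  rewrite -[LHS](tensor_act1 F) /G /tensor_act exchange_big /=; apply: eq_bigr => j _.
  rewrite -mulr_suml; congr (_ * _).
  transitivity (\prod_x (E (w x) (j x) + J (w x) (j x))).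
    by apply: eq_bigr => x _; rewrite -[in LHS](subrK J 1%:M) mxE.
  rewrite bigA_distr; apply: eq_bigr => S _; apply: eq_bigr => x _.
  by rewrite /m; case: (x \in S).
apply: eq_spanned (fun w => esym (FG w)) _; apply: spanned_sum => S.
have [||i j ij|v [vU vE]||I [a [p [pM GE]]]] := @first_fundamental C n P c S E n0 (G S).
- exact: EE.
- exact: E_adj.
- apply: eq_bigr => w _; congr (_ * _); apply: eq_bigr => x _; rewrite /m.
  by case: (boolP (x \in S)) => [/ij->//|_]; rewrite !mxE.
- have vJ : v *m J = J by rewrite -[J in LHS](subKr 1%:M) vE subKr.
  (* The adjoint of a unitary that fixes the vector of ones fixes it as well. *)
  have Jv : J *m v = J.
    have /mulmx1C vU' := vU; rewrite -[LHS]adjmxK adjmxM J_adj.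
    by rewrite -[in LHS]vJ mulmxA vU' mul1mx J_adj.
  move=> w; rewrite -[RHS](eq_tensor_act (fun=> erefl) (Finv v vU vJ Jv)) !tensor_act_comp.
  apply: eq_tensor_act => // x; rewrite /on_set /m inE; case: (x \in S).
    by rewrite -(E_coloured x) !colouredM mulmxBr mulmxBl vJ Jv mulmx1 mul1mx.
  by rewrite mul1mx -(J_coloured x) colouredM Jv.
- move=> w; rewrite tensor_act_comp; apply: eq_tensor_act => // x.
  by rewrite /on_set /m; case: (x \in S); rewrite ?E_coloured ?EE ?mul1mx.
apply: eq_spanned (fun w => esym (GE w)) _; apply: spanned_sum => s.
have pK := matching_involutive (pM s).
apply: spanned_scale; set Sc := [set x in S | c x].
have expand (w : W) : \prod_(x in Sc) E (w x) (w (p s x)) =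
    \sum_(D : {set P}) (if D \subset Sc then (- n%:R^-1) ^+ #|Sc :\: D| else 0) *
      (constant_on (orbit_diagram (restrict_pairs D (p s))) w)%:R.
  have Ee x : E (w x) (w (p s x)) = (w x == w (p s x))%:R + (- n%:R^-1).
    by rewrite !mxE.
  under eq_bigr do rewrite Ee; rewrite big_mkcond /=.
  transitivity (\prod_x ((if x \in Sc then (w x == w (p s x))%:R else 0) +
                         (if x \in Sc then - n%:R^-1 else 1) : C)).
    by apply: eq_bigr => x _; case: ifP; rewrite ?add0r.
  rewrite bigA_distr; apply: eq_bigr => D _; rewrite constant_on_restrict_pairs //.
  case: ifP => [/subsetP DS|/negbT/subsetPn[x xD /negPf xS]]; last first.
    by rewrite mul0r (bigD1 x) //= xD xS mul0r.
  rewrite (bigID (mem D)) /= mulrC; congr (_ * _); last first.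
    by apply: eq_bigr => x xD; rewrite xD DS.
  rewrite -prodr_const [RHS]big_mkcond [LHS]big_mkcond /=.
  by apply: eq_bigr => x _; rewrite in_setD; case: (x \in D).
apply: eq_spanned (fun w => esym (expand w)) _; apply: spanned_sum => D.
case: (boolP (D \subset Sc)) => [DS|_]; last first.
  by apply: eq_spanned (spanned0 _ _ _) => w; rewrite mul0r.
apply: spanned_scale; apply: spanned_constant_on.
apply: orbit_diagram_colour => // [|x]; first exact: restrict_pairs_involutive.
rewrite /restrict_pairs; case: ifP => [xD|_]; last by right.
left; split=> //; have xS : x \in S.
  case/orP: xD => /(subsetP DS); rewrite inE => /andP[xS _] //.
  by have [_ pNS] := pM s; apply: contraTT xS => xS; rewrite pNS.
by have [_ ce _] := (pM s).1 x xS.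
Qed.

End Spanning.

Lemma tensor_act_monomial (C : numClosedFieldType) (n : nat) (P : finType)
    (m : P -> 'M[C]_n) (g : P -> 'I_n -> 'I_n) (z : P -> 'I_n -> C) F w :
  (forall x a b, m x a b = if b == g x a then z x a else 0) ->
  tensor_act m F w = (\prod_x z x (w x)) * F [ffun x => g x (w x)].
Proof.
move=> h; rewrite /tensor_act (bigD1 [ffun x => g x (w x)]) //= [X in _ + X]big1 ?addr0 => [|j].
  by congr (_ * _); apply: eq_bigr => x _; rewrite h ffunE eqxx.
rewrite eq_sym => ne; have /existsP[x jx] : [exists x, j x != g x (w x)].
  rewrite -negb_forall; apply: contraNN ne => /forallP e.
  by apply/eqP/ffunP => x; rewrite ffunE; apply/esym/eqP/e.
by rewrite (bigD1 x) //= h (negPf jx) !mul0r.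
Qed.

(** * Kernels of index functions and balanced partitions *)

Section Kernel.
Variables (T : finType) (n : nat).
Implicit Types (w : {ffun T -> 'I_n}) (p q : {set {set T}}).

Definition kernel w : {set {set T}} := preim_partition w [set: T].

Lemma kernel_partition w : finset.partition (kernel w) [set: T].
Proof. exact: preim_partitionP. Qed.

Lemma mem_kernel w x y : (y \in finset.pblock (kernel w) x) = (w x == w y).
Proof. by rewrite pblock_equivalence_partition ?inE // => a b d _ _ _; split=> // /eqP->. Qed.

Lemma kernel_perm w w' : kernel w = kernel w' -> exists s : 'S_n, forall x, w' x = s (w x).
Proof.
move=> e; have ww' x y : (w x == w y) = (w' x == w' y) by rewrite -!mem_kernel e.
have [x0 _|T0] := pickP (@predT T); last by exists 1%g => x; have := T0 x.
pose s := undup (codom w); pose g a := w' (odflt x0 [pick x | w x == a]).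
have gE x : g (w x) = w' x.
  rewrite /g; case: pickP => [y /=|/(_ x)]; last by rewrite eqxx.
  by rewrite ww' => /eqP.
have sU : uniq s by exact: undup_uniq.
have sP a : a \in s -> exists x, a = w x.
  by rewrite mem_undup => /codomP.
have s'U : uniq (map g s).
  rewrite map_inj_in_uniq // => a b /sP[x ->] /sP[y ->]; rewrite !gE => /eqP.
  by rewrite -ww' => /eqP.
pose full (t : seq 'I_n) := t ++ [seq a <- enum 'I_n | a \notin t].
have fullU t : uniq t -> uniq (full t).
  move=> tU; rewrite cat_uniq tU filter_uniq ?enum_uniq //= andbT.
  by apply/hasPn=> a; rewrite mem_filter => /andP[].
have mem_full t a : a \in full t.
  by rewrite mem_cat mem_filter mem_enum inE andbT orbN.
have size_full t : uniq t -> size (full t) = n.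
  move=> /fullU/card_uniqP<-; rewrite -[RHS]card_ord; apply: eq_card => a.
  by rewrite mem_full inE.
pose f a := nth (w x0) (full (map g s)) (index a (full s)).
have f_inj : injective f.
  move=> a b /eqP; rewrite nth_uniq ?fullU ?size_full //; last first.
  - by rewrite -[ltnRHS](size_full s) // index_mem.
  - by rewrite -[ltnRHS](size_full s) // index_mem.
  by move=> /eqP/(congr1 (nth (w x0) (full s))); rewrite !nth_index.
exists (perm f_inj) => x; rewrite permE /f.
have xs : w x \in s by rewrite mem_undup codom_f.
rewrite index_cat xs nth_cat size_map index_mem xs (nth_map (w x0)) ?index_mem //.
by rewrite nth_index ?gE.
Qed.

(** Coarsening becomes inclusion of finite sets, so that induction on cardinality is available. *)
Definition block_relation q : {set T * T} := [set xy | xy.2 \in finset.pblock q xy.1].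

Lemma block_relation_inj p q : finset.partition p [set: T] -> finset.partition q [set: T] ->
  block_relation p = block_relation q -> p = q.
Proof.
move=> hp hq e; apply: (eq_partition hp hq) => x y.
by have := congr1 (fun B : {set _} => (x, y) \in B) e; rewrite !inE.
Qed.

Lemma kernel_coarser q w : finset.partition q [set: T] ->
  reflect (forall b x y, b \in q -> x \in b -> y \in b -> w x = w y)
          (block_relation q \subset block_relation (kernel w)).
Proof.
move=> hq; apply: (iffP subsetP) => [h b x y qb xb yb|h [x y]].
  apply/eqP; rewrite -mem_kernel; have := h (x, y); rewrite !inE /=; apply.
  by rewrite (pblockT_def hq qb xb).
rewrite !inE mem_kernel /= => xy; apply/eqP/(h (finset.pblock q x)) => //.
  exact: pblockT_mem.
exact: mem_pblockT.
Qed.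

End Kernel.

Section SpannedH.
Variables (C : numClosedFieldType) (n k l : nat).
Local Notation P := ('I_k + 'I_l)%type.
Local Notation W := {ffun P -> 'I_n}.
Local Notation c := (@alt_colour k l).
Local Notation X := (colour_cat phiH k l).

Lemma coarser_balanced (p q : diagram k l) : q \in X -> finset.partition p [set: P] ->
  block_relation q \subset block_relation p -> p \in X.
Proof.
move=> /colour_catP[hq ev qb] hp /subsetP qp; apply/colour_catP; split=> // b pb.
apply/balancedP; rewrite (sum_saturated _ hq) => [|d x qd xd xb].
  apply: big1 => d /andP[qd _]; apply/balancedP; exact: qb.
apply/subsetP=> y yd; rewrite -(pblockT_def hp pb xb).
by have := qp (x, y); rewrite !inE /=; apply; rewrite (pblockT_def hq qd xd).
Qed.

Lemma spanned_add (Y : {set diagram k l}) (F G : W -> C) :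
  spanned Y F -> spanned Y G -> spanned Y (fun w => F w + G w).
Proof.
move=> hF hG; have := @spanned_sum _ _ _ _ Y bool (fun b => if b then F else G).
case=> [[]//|a ha]; exists a => w; by rewrite -ha big_bool.
Qed.

(** Moebius inversion as an induction from the coarsest partitions: constancy on the blocks of [q]
    means that the kernel is [q] or strictly coarser, and coarser partitions stay in the
    category. *)
Lemma spanned_kernel (q : diagram k l) : q \in X ->
  spanned X (fun w : W => (kernel w == q)%:R : C).
Proof.
have [N] := ubnP #|~: block_relation q|; elim: N q => // N IHN q; rewrite ltnS => qN qX.
have hq : finset.partition q [set: P] by case/colour_catP: qX.
pose above (p : diagram k l) := (p \in X) && (block_relation q \proper block_relation p).
have E (w : W) : (kernel w == q)%:R = (constant_on q w)%:R +
    \sum_p (if above p then -1 else 0) * (kernel w == p)%:R :> C.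
  rewrite (bigD1 (kernel w)) //= eqxx mulr1 big1 ?addr0 => [|p]; last first.
    by rewrite eq_sym => /negPf->; rewrite mulr0.
  have -> : constant_on q w = (block_relation q \subset block_relation (kernel w)).
    by apply/constant_onP/(kernel_coarser _ hq).
  rewrite /above properEneq.
  case: (boolP (_ \subset _)) => qw; last first.
    rewrite !andbF addr0; case: eqP qw => // ->; by rewrite subxx.
  rewrite (coarser_balanced qX (kernel_partition w) qw) /= andbT.
  case: (eqVneq (kernel w) q) => [->|wq]; first by rewrite eqxx addr0.
  case: eqP => [/(block_relation_inj hq (kernel_partition w)) e|_] /=; last by rewrite subrr.
  by rewrite e eqxx in wq.
apply: eq_spanned (fun w => esym (E w)) _; apply: spanned_add.
  exact: spanned_constant_on.
apply: spanned_sum => p; case: (boolP (above p)) => [/andP[pX qp]|_]; last first.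
  by apply: eq_spanned (spanned0 _ _ _) => w; rewrite mul0r.
apply: spanned_scale; apply: IHN pX; apply: leq_trans qN.
by apply: proper_card; rewrite properC.
Qed.

Lemma spanned_balanced (F : W -> C) :
  (forall v : 'M[C]_n, v *m adjmx v = 1%:M ->
     (forall i j r, i != j -> v i r * v j r = 0 /\ v r i * v r j = 0) ->
     tensor_act (on_set setT (coloured c v)) F =1 F) ->
  ~~ odd (k + l) ->
  spanned X F.
Proof.
move=> Finv even_kl.
have F_perm (s : 'S_n) (w : W) : F [ffun x => s (w x)] = F w.
  have vU : perm_mx s *m adjmx (perm_mx s) = 1%:M :> 'M[C]_n.
    rewrite (_ : adjmx _ = perm_mx s^-1%g) -?perm_mxM ?mulgV ?perm_mx1 //.
    by rewrite -tr_perm_mx; apply/matrixP=> a b; rewrite !mxE rmorph_nat.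
  have vM i j r : i != j -> (perm_mx s : 'M[C]_n) i r * perm_mx s j r = 0 /\
      (perm_mx s : 'M[C]_n) r i * perm_mx s r j = 0.
    rewrite !mxE => ij; split.
      case: (eqVneq (s i) r) => [<-|_]; last by rewrite mul0r.
      by rewrite (inj_eq perm_inj) eq_sym (negPf ij) mulr0.
    case: (eqVneq (s r) i) => [->|_]; last by rewrite mul0r.
    by rewrite (negPf ij) mulr0.
  rewrite -[RHS](Finv _ vU vM) (@tensor_act_monomial _ _ _ _ (fun _ => s) (fun _ _ => 1)).
    by rewrite big1 // mul1r.
  move=> x a b; rewrite /on_set inE /coloured; case: (c x); rewrite !mxE eq_sym ?rmorph_nat;
    by case: (_ == _).
have F_kernel (w : W) : F w != 0 -> kernel w \in X.
  move=> Fw; apply/colour_catP; split=> // [|b]; first exact: kernel_partition.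
  move=> /(partition_block_inhab (kernel_partition w))[y ->]; set b' := finset.pblock _ _.
  have [z [zz zinj]] := separating_unit C #|{: P}|.
  have z0 : z != 0 by apply/eqP=> e; move: zz; rewrite e mul0r => /esym/eqP; rewrite oner_eq0.
  (* This diagonal unitary marks the value taken on the block of [y]. It multiplies [F w] by [z] for
     each point of one colour in that block and by its conjugate for each point of the other. *)
  pose d : 'rV[C]_n := \row_a (if a == w y then z else 1).
  have dE a : d 0 a * Num.conj (d 0 a) = 1.
    by rewrite mxE; case: eqP => // _; rewrite rmorph1 mulr1.
  have vU : diag_mx d *m adjmx (diag_mx d) = 1%:M.
    rewrite mul_diag_mx; apply/matrixP=> a b0; rewrite !mxE [b0 == a]eq_sym.
    by case: (eqVneq a b0) => [->|_]; rewrite ?mulr1n ?mulr0n ?rmorph0 ?mulr0 //; have := dE b0; rewrite mxE.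
  have vM i j r : i != j -> diag_mx d i r * diag_mx d j r = 0 /\
      diag_mx d r i * diag_mx d r j = 0.
    move=> ij; rewrite !mxE; split.
      case: (eqVneq i r) => [<-|_]; last by rewrite mulr0n mul0r.
      by rewrite [j == i]eq_sym (negPf ij) mulr0n mulr0.
    case: (eqVneq r i) => [->|_]; last by rewrite mulr0n mul0r.
    by rewrite (negPf ij) mulr0n mulr0.
  pose zc (x : P) a := if c x then d 0 a else Num.conj (d 0 a).
  have := Finv _ vU vM w; rewrite (@tensor_act_monomial _ _ _ _ (fun _ => id) zc); last first.
    move=> x a b0; rewrite /on_set inE /coloured /zc; case: (c x); rewrite !mxE [b0 == a]eq_sym;
      by case: (eqVneq a b0) => _; rewrite ?mulr1n ?mulr0n ?rmorph0.
  have -> : [ffun x => w x] = w by apply/ffunP=> x; rewrite ffunE.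
  rewrite -[X in _ = X -> _]mul1r => /(mulIf Fw) prod1.
  pose N e := #|[set x in b' | c x == e]|.
  have Nc : N true = N false.
    apply: zinj; rewrite ?max_card //.
    have -> : z ^+ N true = z ^+ N true * Num.conj z ^+ N false * z ^+ N false.
      by rewrite -mulrA -exprMn mulrC [_ * z]mulrC zz expr1n mul1r.
    suff -> : z ^+ N true * Num.conj z ^+ N false = 1 by rewrite mul1r.
    rewrite -prod1 /N -!prodr_const big_mkcond [X in _ * X]big_mkcond -big_split.
    apply: eq_bigr => x _ /=; rewrite !inE mem_kernel /zc !mxE [w x == w y]eq_sym.
    by case: (w y == w x); case: (c x) => /=; rewrite ?mul1r ?mulr1 ?rmorph1.
  have NE e : N e = #|b' :&: (if e (+) odd k then oplus k l else ominus k l)|.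
    apply: eq_card => x; rewrite inE in_setI alt_colourE; congr (_ && _).
    by case: e; case: (odd k); rewrite /= !inE; case: odd.
  by move: Nc; rewrite !NE /phiH; case: (odd k) => /= ->.
(* Permutation invariance makes [F] constant on index functions with a given kernel, so any
   representative gives the coefficient; it is 0 when the kernel [q] does not occur. *)
pose f (q : diagram k l) := if [pick w | kernel w == q] is Some w then F w else 0.
have FE (w : W) : F w = \sum_q f q * (kernel w == q)%:R.
  rewrite (bigD1 (kernel w)) //= eqxx mulr1 big1 ?addr0 => [|q]; last first.
    by rewrite eq_sym => /negPf->; rewrite mulr0.
  rewrite /f; case: pickP => [w' /eqP/kernel_perm[s h]|/(_ w)]; last by rewrite eqxx.
  by rewrite -(F_perm s w'); congr F; apply/ffunP=> x; rewrite ffunE h.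
apply: eq_spanned (fun w => esym (FE w)) _; apply: spanned_sum => q.
case: (boolP (q \in X)) => [qX|qX]; first by apply/spanned_scale/spanned_kernel.
apply: eq_spanned (spanned0 _ _ _) => w; rewrite /f.
case: pickP => [w' /eqP e|_]; last by rewrite mul0r.
case: (eqVneq (F w') 0) => [->|/F_kernel]; first by rewrite mul0r.
by rewrite e (negPf qX).
Qed.

End SpannedH.

(** * The correspondence *)

Lemma cat_Ostar_sub k l : cat_Ostar k l \subset cat_Hstar k l :&: cat_Bstar k l.
Proof.
apply/subsetP=> p; rewrite cat_Ostar_count colour_cat_O => /andP[pH pB].
by rewrite inE cat_Hstar_count cat_Bstar_count pH.
Qed.

Section HalfLiberated.
Variables (R : realType) (n : nat) (rel : relation_family R n).
Hypothesis rel_orth : forall (A : cstarAlgType R) (u : 'M[A]_n), rel u -> rel_O u.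
Hypothesis rel_image : forall (A B : cstarAlgType R) (f : {lrmorphism A -> B}) (u : 'M[A]_n),
  star_preserving f -> rel u -> rel (map_mx f u).
Variables (A : cstarAlgType R) (u : 'M[A]_n).
Hypothesis hu : half_liberated rel u.

(** By universality, the model of every admissible unitary is an image of [u], which makes the index
    tensor invariant. When [k] and [l] differ in parity, the model of the identity matrix alone
    forces [T] to vanish. *)
Lemma half_liberated_span (X : collection) :
  rel (model (1%:M : 'M[R[i]]_n)) ->
  (forall k l (F : {ffun 'I_k + 'I_l -> 'I_n} -> R[i]), ~~ odd (k + l) ->
     (forall v : 'M[R[i]]_n, unitary v -> rel (model v) ->
        tensor_act (on_set setT (coloured (@alt_colour k l) v)) F =1 F) ->
     spanned (X k l) F) ->
  forall k l (T : 'Hom(tpow R n k, tpow R n l)), intertwiner u T ->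
  T \in <<[seq partition_map R n p | p in X k l]>>%VS.
Proof.
move=> rel1 Xspan k l T hT.
have [e|ne] := eqVneq (odd k) (odd l); last first.
  have U1 : unitary (1%:M : 'M[R[i]]_n) by rewrite /unitary adjmx1 mulmx1.
  have [f _ fE] := half_liberated_universal hu rel1 (model_half_commuting _).
  apply: (@span_partition_maps _ _ _ _ _ _ (fun=> 0)) => i j.
  rewrite (intertwiner_parity hT U1 fE) // big1 // => p _.
  by rewrite mul0r.
have [||a aE] := Xspan k l (index_tensor T).
- by rewrite oddD e addbb.
- move=> v vU rv; have [f _ fE] := half_liberated_universal hu rv (model_half_commuting v).
  by have h := index_tensor_invariant hT vU fE e; apply: h.
apply: (@span_partition_maps _ _ _ _ _ _ a) => i j.
have := aE [ffun x => point_index i j x]; rewrite /index_tensor.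
have -> : [tuple [ffun x => point_index i j x] (inl r) | r < k] = i.
  by apply: eq_from_tnth => r; rewrite tnth_mktuple ffunE.
have -> : [tuple [ffun x => point_index i j x] (inr r) | r < l] = j.
  by apply: eq_from_tnth => r; rewrite tnth_mktuple ffunE.
move=> ->; apply: eq_bigr => p _; congr (_ * (nat_of_bool _)%:R).
apply/constant_onP/delta_pP => h b x y pb xb yb.
  by have := h b x y pb xb yb; rewrite !ffunE.
by rewrite !ffunE; apply: h yb.
Qed.

Let uO : rel_O u. Proof. exact/rel_orth/(half_liberated_rel rel_image hu). Qed.
Let hc : half_commuting u. Proof. exact: half_liberated_half_commuting hu. Qed.

Lemma half_liberated_contains_O k l : colour_cat phiO k l \subset intertwining u k l.
Proof.
apply: generation_O; [exact: intertwining_rot uO|exact: intertwining_swap hc|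
  exact: intertwining_tensor|exact: intertwining_nil|exact: intertwining_pair].
Qed.

Lemma half_liberated_contains_H : rel_H u ->
  forall k l, colour_cat phiH k l \subset intertwining u k l.
Proof.
move=> uH; apply: generation_H; [exact: intertwining_rot uO|exact: intertwining_swap hc|
  exact: intertwining_tensor|exact: intertwining_nil|].
by move=> m; apply: intertwining_even_block.
Qed.

Lemma half_liberated_contains_B : (0 < n)%N -> rel_Bsharp u ->
  forall k l, colour_cat phiB k l \subset intertwining u k l.
Proof.
move=> n0 uB; apply: generation_B; [exact: intertwining_rot uO|exact: intertwining_swap hc|
  exact: intertwining_tensor|exact: intertwining_nil|exact: intertwining_pair|].
exact: intertwining_upup.
Qed.

Lemma half_liberated_easy (X : collection) : 
  (forall (A T : cstarAlgType R) (i1 i2 : {lrmorphism A -> T}) (u : 'M[A]_n),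
     star_preserving i1 -> star_preserving i2 ->
     (forall a b, i1 a * i2 b = i2 b * i1 a) -> rel u -> rel (coproduct u i1 i2)) ->
  (forall (A : cstarAlgType R) (u : 'M[A]_n), rel u -> rel (transpose u)) ->
  (forall s : 'S_n, rel (perm_matrix R s)) ->
  (forall k l, X k l \subset partitions k l) -> (forall k l, cat_Ostar k l \subset X k l) ->
  corresponds X u -> easy u.
Proof.
move=> rel_cop rel_tr rel_perm Xp OX cX; split.
- exact: (half_liberated_oqg rel_orth rel_image rel_cop rel_tr rel_perm hu).
- exact: (half_liberated_Sn rel_perm hu).
exists X; split=> // k l p /noncrossing_pair_Ostar; apply: (subsetP (OX k l)).
Qed.

End HalfLiberated.

Section Correspondence.
Variables (R : realType) (n : nat) (A : cstarAlgType R) (u : 'M[A]_n).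
Hypothesis n_gt0 : (0 < n)%N.
Let n0 : 'I_n := Ordinal n_gt0.

Let unitary1 : unitary (1%:M : 'M[R[i]]_n).
Proof. by rewrite /unitary adjmx1 mulmx1. Qed.

Let H_orth (B : cstarAlgType R) (v : 'M[B]_n) : rel_H v -> rel_O v. Proof. by case. Qed.
Let B_orth (B : cstarAlgType R) (v : 'M[B]_n) : rel_Bsharp v -> rel_O v. Proof. by case. Qed.

Lemma corresponds_O : is_Ostar u -> corresponds cat_Ostar u.
Proof.
move=> hu k l T; split; last first.
  apply: span_intertwiner => k' l'; rewrite cat_Ostar_count.
  have img (B D : cstarAlgType R) (f : {lrmorphism B -> D}) (v : 'M[B]_n) :
    star_preserving f -> rel_O v -> rel_O (map_mx f v) by apply: image_O.
  exact: (half_liberated_contains_O (fun _ _ h => h) img hu).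
apply: (half_liberated_span hu) => [|k1 l1 F ev Finv]; first exact: model_O.
rewrite cat_Ostar_count; apply: (spanned_pairs n0 ev) => v vU.
by apply: Finv => //; apply: model_O.
Qed.

Lemma corresponds_H : is_Hstar u -> corresponds cat_Hstar u.
Proof.
move=> hu k l T; split; last first.
  apply: span_intertwiner => k' l'; rewrite cat_Hstar_count.
  have img (B D : cstarAlgType R) (f : {lrmorphism B -> D}) (v : 'M[B]_n) :
    star_preserving f -> rel_H v -> rel_H (map_mx f v) by apply: image_H.
  by apply: (half_liberated_contains_H H_orth img hu); apply: half_liberated_rel hu.
apply: (half_liberated_span hu) => [|k1 l1 F ev Finv].
  apply: model_H => // i j r ij; rewrite !mxE; split.
    by case: (eqVneq i r) => [<-|_]; rewrite ?mul0r // eq_sym (negPf ij) mulr0.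
  by case: (eqVneq r i) => [->|_]; rewrite ?mul0r // (negPf ij) mulr0.
rewrite cat_Hstar_count; apply: spanned_balanced => // v vU vM.
by apply: Finv => //; apply: model_H.
Qed.

Lemma corresponds_B : is_Bsharpstar u -> corresponds cat_Bstar u.
Proof.
move=> hu k l T; split; last first.
  apply: span_intertwiner => k' l'; rewrite cat_Bstar_count.
  have img (B D : cstarAlgType R) (f : {lrmorphism B -> D}) (v : 'M[B]_n) :
    star_preserving f -> rel_Bsharp v -> rel_Bsharp (map_mx f v) by apply: image_Bsharp.
  by apply: (half_liberated_contains_B B_orth img hu) => //; apply: half_liberated_rel hu.
apply: (half_liberated_span hu) => [|k1 l1 F ev Finv].
  apply: (@model_Bsharp _ _ _ 1) => // i.
    by rewrite (bigD1 i) //= mxE eqxx big1 ?addr0 // => r /negPf e; rewrite mxE eq_sym e.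
  by rewrite (bigD1 i) //= mxE eqxx big1 ?addr0 // => r /negPf e; rewrite mxE e.
rewrite cat_Bstar_count; apply: (spanned_small n0 ev) => v vU vJ Jv.
have nz : n%:R != 0 :> R[i] by rewrite pnatr_eq0 -lt0n.
apply: Finv => //; apply: (@model_Bsharp _ _ _ 1) => // i.
  (* A column of [v *m J = J] states, after cancelling [1/n], that the row sums of [v] are 1. *)
  have /matrixP/(_ i n0) := vJ; rewrite !mxE; under eq_bigr do rewrite mxE.
  by rewrite -mulr_suml -[RHS]mul1r => /(mulIf (invr_neq0 nz)).
have /matrixP/(_ n0 i) := Jv; rewrite !mxE; under eq_bigr do rewrite mxE.
by rewrite -mulr_sumr -[RHS]mulr1 => /(mulfI (invr_neq0 nz)).
Qed.

End Correspondence.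

Theorem proposition3p5 (R : realType) :
  [/\ [/\ full_category cat_Ostar,
          forall k l, generated_category [:: Sized p_hl] k l = cat_Ostar k l
        & forall (n : nat) (A : cstarAlgType R) (u : 'M[A]_n), (0 < n)%N ->
            is_Ostar u -> corresponds cat_Ostar u /\ easy u],
      [/\ full_category cat_Hstar,
          forall k l,
            generated_category [:: Sized p_hl; Sized p_four] k l = cat_Hstar k l
        & forall (n : nat) (A : cstarAlgType R) (u : 'M[A]_n), (0 < n)%N ->
            is_Hstar u -> corresponds cat_Hstar u /\ easy u]
    & [/\ full_category cat_Bstar,
          forall k l,
            generated_category [:: Sized p_hl; Sized p_upup] k l = cat_Bstar k l
        & forall (n : nat) (A : cstarAlgType R) (u : 'M[A]_n), (0 < n)%N ->
            is_Bsharpstar u -> corresponds cat_Bstar u /\ easy u]].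
Proof.
split; split.
- exact: full_cat_Ostar.
- exact: generated_Ostar.
- move=> n A u n0 hu; have cu := corresponds_O n0 hu; split=> //.
  apply: half_liberated_easy hu cat_Ostar _ _ _ _ _ cu => //.
  + by move=> *; apply: image_O.
  + by move=> *; apply: coproduct_O.
  + by move=> *; apply: transpose_O.
  + by move=> *; apply: perm_matrix_O.
  + exact: cat_sub full_cat_Ostar.
- exact: full_cat_Hstar.
- exact: generated_Hstar.
- move=> n A u n0 hu; have cu := corresponds_H hu; split=> //.
  apply: half_liberated_easy hu cat_Hstar _ _ _ _ _ cu.
  + by move=> ? ? [].
  + by move=> *; apply: image_H.
  + by move=> *; apply: coproduct_H.
  + by move=> *; apply: transpose_H.
  + by move=> *; apply: perm_matrix_H.
  + exact: cat_sub full_cat_Hstar.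
  + by move=> k l; have := cat_Ostar_sub k l; rewrite subsetI => /andP[].
- exact: full_cat_Bstar.
- exact: generated_Bstar.
- move=> n A u n0 hu; have cu := corresponds_B n0 hu; split=> //.
  apply: half_liberated_easy hu cat_Bstar _ _ _ _ _ cu.
  + by move=> ? ? [].
  + by move=> *; apply: image_Bsharp.
  + by move=> *; apply: coproduct_Bsharp.
  + by move=> *; apply: transpose_Bsharp.
  + by move=> *; apply: perm_matrix_Bsharp.
  + exact: cat_sub full_cat_Bstar.
  + by move=> k l; have := cat_Ostar_sub k l; rewrite subsetI => /andP[].
Qed.
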